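(* Let $D\subseteq\mathbb{C}$ be a domain. (a) If $\mathcal{F}_1$ and $\mathcal{F}_2$ are two subfamilies of $\mathcal{H}(D)$, then $J(\mathcal{F}_1\cup\mathcal{F}_2)=J(\mathcal{F}_1)\cup J(\mathcal{F}_2)$. (b) Let $\mathcal{F}$ be a subfamily of $\mathcal{H}(D)$. If $z_0\in J(\mathcal{F})$ and $N\subseteq D$ is any neighborhood of $z_0$, then $\mathbb{C}\setminus U$ contains at most one point, where $U=\bigcup_{f\in\mathcal{F}}f(N)$.
   Context: For a domain $D\subseteq\mathbb{C}$, $\mathcal{H}(D)$ denotes the class of all holomorphic functions on $D$. A family $\mathcal{F}\subseteq\mathcal{H}(D)$ is normal on an open set $G\subseteq D$ if every sequence in $\mathcal{F}$ contains a subsequence that converges locally uniformly on $G$, where the limit is either a holomorphic function or identically $\infty$ (locally uniform convergence to $\infty$ is allowed). $\mathcal{F}$ is normal at a point $z_0\in D$ if it is normal in some neighborhood of $z_0$ in $D$. The Fatou-like set $F(\mathcal{F})$ is the set of points of $D$ at which $\mathcal{F}$ is normal, and the Julia-like set is $J(\mathcal{F}):=D\setminus F(\mathcal{F})$. *)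

(* Defs.v *)
(* Rocq standard library + Coquelicot: the complex plane is Coquelicot's [C],
   with its product topology, and subsets of [C] are predicates [C -> Prop]. *)
From Stdlib Require Import Reals.
From Coquelicot Require Import Coquelicot.
Open Scope R_scope.

Definition sub_set (A B : C -> Prop) : Prop := forall z, A z -> B z.

Definition connected_set (A : C -> Prop) : Prop :=
  forall U V : C -> Prop,
    open U -> open V ->
    (forall z, A z -> U z \/ V z) ->
    (exists z, A z /\ U z) -> (exists z, A z /\ V z) ->
    exists z, A z /\ U z /\ V z.

Definition is_domain (D : C -> Prop) : Prop :=
  (exists z, D z) /\ open D /\ connected_set D.

(* A function on an open set [D] is represented by a total function [C -> C];
   nothing below depends on its values outside [D]. *)
Definition holomorphic (D : C -> Prop) (f : C -> C) : Prop :=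
  forall z : C, D z -> ex_derive (K := C_AbsRing) (V := C_NormedModule) f z.

Definition fun_family := (C -> C) -> Prop.

Definition subfamily_H (D : C -> Prop) (F : fun_family) : Prop :=
  forall f, F f -> holomorphic D f.

Definition family_union (F1 F2 : fun_family) : fun_family := fun f => F1 f \/ F2 f.

Definition loc_unif_cvg (G : C -> Prop) (u : nat -> C -> C) (g : C -> C) : Prop :=
  forall z, G z -> exists V : C -> Prop, locally z V /\
    forall eps : R, 0 < eps ->
      eventually (fun n => forall w, V w -> G w -> Cmod (u n w - g w)%C < eps).

Definition loc_unif_cvg_infty (G : C -> Prop) (u : nat -> C -> C) : Prop :=
  forall z, G z -> exists V : C -> Prop, locally z V /\
    forall M : R,
      eventually (fun n => forall w, V w -> G w -> M < Cmod (u n w)).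

Definition normal_on (F : fun_family) (G : C -> Prop) : Prop :=
  forall u : nat -> C -> C, (forall n, F (u n)) ->
    exists phi : nat -> nat, (forall n, (phi n < phi (S n))%nat) /\
      ((exists g : C -> C,
          holomorphic G g /\ loc_unif_cvg G (fun n => u (phi n)) g) \/
       loc_unif_cvg_infty G (fun n => u (phi n))).

Definition normal_at (D : C -> Prop) (F : fun_family) (z0 : C) : Prop :=
  exists G : C -> Prop, open G /\ G z0 /\ sub_set G D /\ normal_on F G.

Definition Fatou (D : C -> Prop) (F : fun_family) (z : C) : Prop :=
  D z /\ normal_at D F z.

Definition Julia (D : C -> Prop) (F : fun_family) (z : C) : Prop :=
  D z /\ ~ Fatou D F z.

Definition family_image (F : fun_family) (N : C -> Prop) (w : C) : Prop :=
  exists f z, F f /\ N z /\ w = f z.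

(* Main.v *)
Require Import Defs.
From Stdlib Require Import Reals Lra Lia Arith Classical ClassicalEpsilon.
From Stdlib Require Cantor.
From Coquelicot Require Import Coquelicot.
Open Scope R_scope.

(** Part (b) is Montel's theorem for families omitting two values.  On the plane
    punctured at [0] and [1] the explicit metric [rho(w) |dw|] with
    [rho(w)^2 = 1 / (|w| ln(1 + |w|^(1/2)) |w - 1| ln(1 + |w - 1|^(1/2)))] has
    curvature bounded above by a negative constant.  For [f] omitting [0] and [1], the
    Ahlfors-Schwarz argument (the Laplacian of the logarithm of
    [(s^2 - |z - c|^2) |f'| rho(f)] is nonpositive at a maximum point) bounds
    [rho(f) |f'|] locally.  At infinity [rho] dominates [1 / (|w| ln |w|)], so
    [ln (ln (2 + |f|))] is locally Lipschitz with a constant independent of [f].  A sequence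
    from the family is therefore uniformly bounded along a subsequence, and
    Arzela-Ascoli applies, or it tends to infinity uniformly. *)

(** The explicit density stands in for the hyperbolic metric of the twice punctured plane.
    Boundedness is wanted only towards infinity, so only that end has to lie at infinite distance;
    the density may be of order |w|^(-3/4) at 0, of finite length there, and this is what lets it be
    elementary. Each of its two factors depends on ln |w| or ln |w - 1| alone. As ln |f| and ln |f -
    1| are harmonic, the Laplacian of ln rho(f) reduces to one-variable second derivatives times
    |f'/f|^2 and |f'/(f - 1)|^2. The maximum argument also uses that ln |f'| is harmonic, which
    calls for derivatives of f up to order three. The Cauchy theory serves this purpose: a single
    statement, that a continuous function with a primitive is differentiable, yields both the higher
    derivatives and Morera's theorem for the limit functions. *)

(** * Discs, complex differentiability and compactness *)

Definition cball (c : C) (r : R) (z : C) : Prop := Cmod (z - c)%C < r.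

Definition is_cderive (f : C -> C) (z l : C) : Prop :=
  forall eps : R, 0 < eps -> exists delta : R, 0 < delta /\
    forall w : C, Cmod (w - z)%C < delta ->
      Cmod (f w - f z - l * (w - z))%C <= eps * Cmod (w - z)%C.

Definition ccontinuous (f : C -> C) (z : C) : Prop :=
  forall eps : R, 0 < eps -> exists delta : R, 0 < delta /\
    forall w : C, Cmod (w - z)%C < delta -> Cmod (f w - f z)%C < eps.

Lemma Cmod_sub_sym (a b : C) : Cmod (a - b)%C = Cmod (b - a)%C.
Proof.
  rewrite <- Cmod_opp. f_equal. ring.
Qed.

Lemma Cmod_sub_triangle (a b c : C) : Cmod (a - c)%C <= Cmod (a - b)%C + Cmod (b - c)%C.
Proof.
  replace (a - c)%C with ((a - b) + (b - c))%C by ring. apply Cmod_triangle.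
Qed.

Lemma Cmod_sub_ge (a b : C) : Cmod a - Cmod b <= Cmod (a - b)%C.
Proof.
  assert (H := Cmod_triangle (a - b) b).
  replace (a - b + b)%C with a in H by ring. lra.
Qed.

Lemma Cmod_le_components (z : C) : Cmod z <= Rabs (Re z) + Rabs (Im z).
Proof.
  destruct z as [x y]. unfold Cmod; simpl.
  assert (Hx := Rabs_pos x). assert (Hy := Rabs_pos y).
  rewrite <- (sqrt_Rsqr (Rabs x + Rabs y)) by lra.
  apply sqrt_le_1_alt. unfold Rsqr.
  assert (Rabs x * Rabs x = x * x) by (rewrite <- Rabs_mult; apply Rabs_pos_eq; nra).
  assert (Rabs y * Rabs y = y * y) by (rewrite <- Rabs_mult; apply Rabs_pos_eq; nra).
  nra.
Qed.

Lemma im_le_Cmod (z : C) : Rabs (Im z) <= Cmod z.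
Proof.
  eapply Rle_trans; [ | apply Rmax_Cmod ]. apply Rmax_r.
Qed.

(** The uniform balls of the product topology on [C] are squares. The square with half-side
    [r / sqrt 2] lies in the disc of radius r, whence the factor. *)
Lemma locally_cball (z : C) (P : C -> Prop) :
  locally z P <-> exists r : R, 0 < r /\ forall w, cball z r w -> P w.
Proof.
  split.
  - intros [e He]. exists (pos e); split; [ apply cond_pos | ].
    intros w Hw. apply He. apply C_NormedModule_mixin_compat1. exact Hw.
  - intros [r [Hr H]].
    assert (H2 : 0 < sqrt 2) by (apply sqrt_lt_R0; lra).
    assert (Hp : 0 < r / sqrt 2) by (apply Rdiv_lt_0_compat; lra).
    exists (mkposreal _ Hp). intros w Hw. apply H. unfold cball.
    apply C_NormedModule_mixin_compat2 in Hw. simpl in Hw.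
    replace (sqrt 2 * (r / sqrt 2)) with r in Hw by (field; lra). exact Hw.
Qed.

(** [is_derive] over [C_AbsRing] uses the topology of the absolute value, while [locally_cball]
    describes the product topology; [locally_C] identifies the two. *)
Lemma is_cderive_iff (f : C -> C) (z l : C) :
  is_derive (K := C_AbsRing) (V := C_NormedModule) f z l <-> is_cderive f z l.
Proof.
  split.
  - intros [_ H] eps Heps.
    assert (Hz : is_filter_lim (locally (T := AbsRing_UniformSpace C_AbsRing) z) z)
      by (intros P HP; exact HP).
    specialize (H z Hz (mkposreal eps Heps)).
    apply (locally_C z) in H. apply locally_cball in H.
    destruct H as [r [Hr H]]. exists r; split; [ exact Hr | ].
    intros w Hw. specialize (H w Hw).
    change (Cmod (f w - f z - (w - z) * l)%C <= eps * Cmod (w - z)%C) in H.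
    rewrite (Cmult_comm l). exact H.
  - intros H. split; [ apply is_linear_scal_l | ].
    intros x Hx.
    assert (x = z).
    { symmetry. apply (is_filter_lim_locally_unique (K := C_AbsRing) (V := AbsRing_NormedModule C_AbsRing)). exact Hx. }
    subst x. intros eps. apply (locally_C z). apply locally_cball.
    destruct (H eps (cond_pos eps)) as [r [Hr H']].
    exists r; split; [ exact Hr | ]. intros w Hw. specialize (H' w Hw).
    change (Cmod (f w - f z - (w - z) * l)%C <= eps * Cmod (w - z)%C).
    rewrite (Cmult_comm (w - z)). exact H'.
Qed.

Lemma is_cderive_continuous (f : C -> C) (z l : C) : is_cderive f z l -> ccontinuous f z.
Proof.
  intros H eps Heps. destruct (H 1 Rlt_0_1) as [d [Hd H']].
  assert (Hl := Cmod_ge_0 l).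
  assert (He : 0 < eps / (2 + Cmod l)) by (apply Rdiv_lt_0_compat; lra).
  exists (Rmin d (eps / (2 + Cmod l))); split; [ apply Rmin_pos; lra | ].
  intros w Hw.
  assert (Hw1 := Rlt_le_trans _ _ _ Hw (Rmin_l _ _)).
  assert (Hw2 := Rlt_le_trans _ _ _ Hw (Rmin_r _ _)).
  specialize (H' w Hw1).
  replace (f w - f z)%C with ((f w - f z - l * (w - z)) + l * (w - z))%C by ring.
  eapply Rle_lt_trans; [ apply Cmod_triangle | ]. rewrite Cmod_mult.
  assert (Hp := Cmod_ge_0 (w - z)).
  apply Rle_lt_trans with ((1 + Cmod l) * Cmod (w - z)%C); [ lra | ].
  apply Rle_lt_trans with ((1 + Cmod l) * (eps / (2 + Cmod l))).
  - apply Rmult_le_compat_l; lra.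
  - assert (eps / (2 + Cmod l) * (2 + Cmod l) = eps) by (field; lra). lra.
Qed.

(** Bolzano-Weierstrass is applied to the real parts, then to the imaginary parts along indices
    [s k >= k] on which the real parts already converge. *)
Lemma bounded_seq_cluster (u : nat -> C) (c : C) (M : R) :
  (forall n, Cmod (u n - c)%C <= M) ->
  exists p : C, forall eps N, 0 < eps -> exists n, (N <= n)%nat /\ Cmod (u n - p)%C < eps.
Proof.
  intros Hu.
  assert (Hx : forall n, Rabs (fst (u n) - fst c) <= M).
  { intros n. eapply Rle_trans; [ | apply (Hu n) ].
    apply (re_le_Cmod (u n - c)). }
  assert (Hy : forall n, Rabs (snd (u n) - snd c) <= M).
  { intros n. eapply Rle_trans; [ | apply (Hu n) ].
    apply (im_le_Cmod (u n - c)). }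
  destruct (Bolzano_Weierstrass (fun n => fst (u n)) (fun x => fst c - M <= x <= fst c + M)
              (compact_P3 _ _)) as [x Hlx].
  { intros n. specialize (Hx n). apply Rabs_le_between in Hx. lra. }
  assert (Hsub : forall k : nat, exists n, (k <= n)%nat /\ Rabs (fst (u n) - x) < / (INR k + 1)).
  { intros k.
    assert (Hk : 0 < / (INR k + 1)) by (apply Rinv_0_lt_compat; assert (H := pos_INR k); lra).
    destruct (Hlx (disc x (mkposreal _ Hk)) k) as [p [Hp1 Hp2]].
    - exists (mkposreal _ Hk). intros y Hy'; exact Hy'.
    - exists p; split; [ lia | exact Hp2 ]. }
  set (s := fun k => proj1_sig (constructive_indefinite_description _ (Hsub k))).
  assert (Hs : forall k, (k <= s k)%nat /\ Rabs (fst (u (s k)) - x) < / (INR k + 1)).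
  { intros k. exact (proj2_sig (constructive_indefinite_description _ (Hsub k))). }
  destruct (Bolzano_Weierstrass (fun k => snd (u (s k))) (fun y => snd c - M <= y <= snd c + M)
              (compact_P3 _ _)) as [y Hly].
  { intros k. specialize (Hy (s k)). apply Rabs_le_between in Hy. lra. }
  exists (x, y). intros eps N Heps.
  destruct (archimed_cor1 (eps / 2)) as [K [HK1 HK2]]; [ lra | ].
  assert (He2 : 0 < eps / 2) by lra.
  destruct (Hly (disc y (mkposreal _ He2)) (max N K)) as [k [Hk1 Hk2]].
  { exists (mkposreal _ He2). intros z Hz; exact Hz. }
  destruct (Hs k) as [Hs1 Hs2].
  exists (s k); split; [ lia | ].
  eapply Rle_lt_trans; [ apply Cmod_le_components | ].
  unfold disc in Hk2; simpl in Hk2.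
  change (Rabs (fst (u (s k)) - x) + Rabs (snd (u (s k)) - y) < eps).
  assert (Hik : / (INR k + 1) <= / INR K).
  { apply Rinv_le_contravar; [ apply lt_0_INR; lia | ].
    assert (INR K <= INR k) by (apply le_INR; lia). lra. }
  lra.
Qed.

Lemma cluster_in_closed_ball (u : nat -> C) (c p : C) (M : R) :
  (forall n, Cmod (u n - c)%C <= M) ->
  (forall eps N, 0 < eps -> exists n, (N <= n)%nat /\ Cmod (u n - p)%C < eps) ->
  Cmod (p - c)%C <= M.
Proof.
  intros Hu Hp. apply Rnot_lt_le; intros Hlt.
  destruct (Hp (Cmod (p - c)%C - M) O) as [n [_ Hn]]; [ lra | ].
  specialize (Hu n). assert (H := Cmod_sub_triangle p (u n) c).
  rewrite (Cmod_sub_sym p (u n)) in H. lra.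
Qed.

Lemma inv_INR_pos (n : nat) : 0 < / (INR n + 1).
Proof.
  apply Rinv_0_lt_compat. assert (H := pos_INR n). lra.
Qed.

Lemma inv_INR_small (eps : R) : 0 < eps ->
  exists N : nat, forall n, (N <= n)%nat -> / (INR n + 1) < eps.
Proof.
  intros He. destruct (archimed_cor1 eps He) as [N [H1 H2]].
  exists N. intros n Hn. eapply Rle_lt_trans; [ | exact H1 ].
  apply Rinv_le_contravar; [ apply lt_0_INR; lia | ].
  assert (INR N <= INR n) by (apply le_INR; lia). lra.
Qed.

(** Compactness for a property with a threshold: if no d worked throughout the disc, points failing
    at d = 1/(n+1) would cluster at some p and contradict the local threshold there. It turns
    continuity into uniform continuity and pointwise into uniform convergence. *)
Lemma closed_ball_uniform (c : C) (M : R) (Q : C -> R -> Prop) :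
  (forall z d d', Q z d -> 0 < d' <= d -> Q z d') ->
  (forall p, Cmod (p - c)%C <= M -> exists d, 0 < d /\
     forall z, Cmod (z - c)%C <= M -> Cmod (z - p)%C < d -> Q z d) ->
  exists d, 0 < d /\ forall z, Cmod (z - c)%C <= M -> Q z d.
Proof.
  intros Hmono Hloc. apply NNPP; intros Hno.
  assert (Hbad : forall n : nat, exists z, Cmod (z - c)%C <= M /\ ~ Q z (/ (INR n + 1))).
  { intros n. apply NNPP; intros Hn. apply Hno.
    exists (/ (INR n + 1)); split; [ apply inv_INR_pos | ].
    intros z Hz. apply NNPP; intros HQ. apply Hn. exists z; auto. }
  apply (choice (fun (n : nat) z => Cmod (z - c)%C <= M /\ ~ Q z (/ (INR n + 1)))) in Hbad.
  destruct Hbad as [u Hu].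
  destruct (bounded_seq_cluster u c M) as [p Hp]; [ intros n; apply Hu | ].
  assert (Hpc : Cmod (p - c)%C <= M)
    by (apply (cluster_in_closed_ball u); [ intros n; apply Hu | exact Hp ]).
  destruct (Hloc p Hpc) as [d [Hd H]].
  destruct (inv_INR_small d Hd) as [N HN].
  destruct (Hp d N Hd) as [n [Hn1 Hn2]].
  destruct (Hu n) as [Hu1 Hu2]. apply Hu2. apply (Hmono _ d).
  - apply H; auto.
  - split; [ apply inv_INR_pos | ]. left. apply HN. exact Hn1.
Qed.

Lemma closed_ball_argmax (v : C -> R) (c : C) (M : R) : 0 <= M ->
  (forall z, Cmod (z - c)%C <= M -> continuous (U := R_UniformSpace) v z) ->
  exists p, Cmod (p - c)%C <= M /\ forall z, Cmod (z - c)%C <= M -> v z <= v p.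
Proof.
  intros HM Hc.
  (* [atan] makes the values bounded, so that no separate boundedness argument is needed. *)
  destruct (completeness (fun y => exists z, Cmod (z - c)%C <= M /\ y = atan (v z)))
    as [s [Hs1 Hs2]].
  - exists (PI / 2). intros y [z [_ ->]]. left. apply atan_bound.
  - exists (atan (v c)), c; split; [ | reflexivity ].
    replace (c - c)%C with (RtoC 0) by ring. rewrite Cmod_0. exact HM.
  - assert (Hn : forall n : nat, exists z, Cmod (z - c)%C <= M /\ s - / (INR n + 1) < atan (v z)).
    { intros n. apply NNPP; intros Hno.
      assert (Hup : s <= s - / (INR n + 1)).
      { apply Hs2. intros y [z [Hz ->]]. apply Rnot_lt_le; intros Hlt.
        apply Hno; exists z; auto. }
      assert (H := inv_INR_pos n). lra. }
    apply (choice (fun (n : nat) z => Cmod (z - c)%C <= M /\ s - / (INR n + 1) < atan (v z))) in Hn.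
    destruct Hn as [u Hu].
    destruct (bounded_seq_cluster u c M) as [p Hp]; [ intros n; apply Hu | ].
    assert (Hpc : Cmod (p - c)%C <= M)
      by (apply (cluster_in_closed_ball u); [ intros n; apply Hu | exact Hp ]).
    exists p; split; [ exact Hpc | ]. intros z Hz.
    assert (Hcont : continuous (U := R_UniformSpace) (fun w => atan (v w)) p).
    { apply (continuous_comp v atan); [ apply Hc; exact Hpc | ].
      apply continuity_pt_filterlim. apply derivable_continuous_pt.
      apply derivable_pt_atan. }
    assert (Hsp : s <= atan (v p)).
    { apply Rnot_lt_le; intros Hlt.
      assert (He : 0 < (s - atan (v p)) / 2) by lra.
      assert (Hl : locally p (fun w => Rabs (atan (v w) - atan (v p)) < (s - atan (v p)) / 2)).
      { apply (Hcont (fun y => Rabs (y - atan (v p)) < (s - atan (v p)) / 2)). exists (mkposreal _ He). intros y Hy. exact Hy. }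
      apply locally_cball in Hl. destruct Hl as [r [Hr Hl]].
      destruct (inv_INR_small _ He) as [N HN].
      destruct (Hp r N Hr) as [n [Hn1 Hn2]].
      specialize (Hl _ Hn2). specialize (HN n Hn1). destruct (Hu n) as [_ Hun].
      apply Rabs_lt_between in Hl. lra. }
    apply Rnot_lt_le; intros Hlt. apply atan_increasing in Hlt.
    assert (atan (v z) <= s) by (apply Hs1; exists z; auto). lra.
Qed.

(** * Paths and integrals in the complex plane *)

(* The integral of a complex-valued function is taken componentwise, since Coquelicot
   does not equip [C] with a normed-module structure over [R]. *)
Definition is_CInt (g : R -> C) (a b : R) (l : C) : Prop :=
  is_RInt (fun t => Re (g t)) a b (Re l) /\ is_RInt (fun t => Im (g t)) a b (Im l).

Definition ccontinuous_path (g : R -> C) (t : R) : Prop :=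
  continuous (fun s => Re (g s)) t /\ continuous (fun s => Im (g s)) t.

Definition is_path_derive (g : R -> C) (t : R) (l : C) : Prop :=
  is_derive (fun s => Re (g s)) t (Re l) /\ is_derive (fun s => Im (g s)) t (Im l).

Lemma C_ext (z w : C) : Re z = Re w -> Im z = Im w -> z = w.
Proof.
  destruct z, w; simpl; intros -> ->; reflexivity.
Qed.

Lemma is_CInt_unique (g : R -> C) (a b : R) (l l' : C) :
  is_CInt g a b l -> is_CInt g a b l' -> l = l'.
Proof.
  intros [H1 H2] [H3 H4].
  apply (is_RInt_unique (V := R_CompleteNormedModule)) in H1, H2, H3, H4.
  apply C_ext; congruence.
Qed.

Lemma is_CInt_ext (f g : R -> C) (a b : R) (l : C) :
  (forall t, f t = g t) -> is_CInt f a b l -> is_CInt g a b l.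
Proof.
  intros H [H1 H2]. split.
  - eapply is_RInt_ext; [ | exact H1 ]. intros t _. simpl. now rewrite H.
  - eapply is_RInt_ext; [ | exact H2 ]. intros t _. simpl. now rewrite H.
Qed.

Lemma is_CInt_scal (k : C) (f : R -> C) (a b : R) (l : C) :
  is_CInt f a b l -> is_CInt (fun t => k * f t)%C a b (k * l)%C.
Proof.
  intros [H1 H2]. destruct k as [p q]. split; simpl.
  - apply (is_RInt_minus (V := R_NormedModule)).
    + exact (is_RInt_scal (V := R_NormedModule) _ _ _ p _ H1).
    + exact (is_RInt_scal (V := R_NormedModule) _ _ _ q _ H2).
  - apply (is_RInt_plus (V := R_NormedModule)).
    + exact (is_RInt_scal (V := R_NormedModule) _ _ _ p _ H2).
    + exact (is_RInt_scal (V := R_NormedModule) _ _ _ q _ H1).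
Qed.

Lemma is_CInt_minus (f g : R -> C) (a b : R) (l m : C) :
  is_CInt f a b l -> is_CInt g a b m -> is_CInt (fun t => f t - g t)%C a b (l - m)%C.
Proof.
  intros [H1 H2] [H3 H4]. split.
  - exact (is_RInt_minus (V := R_NormedModule) _ _ _ _ _ _ H1 H3).
  - exact (is_RInt_minus (V := R_NormedModule) _ _ _ _ _ _ H2 H4).
Qed.

Lemma is_CInt_const (a b : R) (k : C) : is_CInt (fun _ => k) a b ((b - a) * k)%C.
Proof.
  assert (H : forall r, (RtoC (b - a) * r)%C = ((b - a) * Re r, (b - a) * Im r)).
  { intros [x y]. apply C_ext; simpl; ring. }
  rewrite <- RtoC_minus, H. split; apply (is_RInt_const (V := R_NormedModule)).
Qed.

(** Real and imaginary parts are bounded separately, which costs the factor 2; the later arguments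
    tolerate a constant factor. *)
Lemma is_CInt_bound (g : R -> C) (a b M : R) (l : C) : a <= b ->
  (forall t, a <= t <= b -> Cmod (g t) <= M) -> is_CInt g a b l ->
  Cmod l <= 2 * ((b - a) * M).
Proof.
  intros Hab HM [H1 H2].
  assert (B1 : Rabs (Re l) <= (b - a) * M).
  { apply (norm_RInt_le_const (V := R_NormedModule) (fun t => Re (g t))); auto.
    intros t Ht. eapply Rle_trans; [ apply re_le_Cmod | apply HM; exact Ht ]. }
  assert (B2 : Rabs (Im l) <= (b - a) * M).
  { apply (norm_RInt_le_const (V := R_NormedModule) (fun t => Im (g t))); auto.
    intros t Ht. eapply Rle_trans; [ apply im_le_Cmod | apply HM; exact Ht ]. }
  assert (H := Cmod_le_components l). lra.
Qed.

Lemma is_CInt_exists (g : R -> C) (a b : R) : a <= b ->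
  (forall t, a <= t <= b -> ccontinuous_path g t) -> exists l, is_CInt g a b l.
Proof.
  intros Hab Hc.
  destruct (ex_RInt_continuous (V := R_CompleteNormedModule) (fun t => Re (g t)) a b) as [l1 H1].
  { intros t Ht. rewrite Rmin_left, Rmax_right in Ht by lra. apply Hc; exact Ht. }
  destruct (ex_RInt_continuous (V := R_CompleteNormedModule) (fun t => Im (g t)) a b) as [l2 H2].
  { intros t Ht. rewrite Rmin_left, Rmax_right in Ht by lra. apply Hc; exact Ht. }
  exists (l1, l2). split; assumption.
Qed.

Lemma is_CInt_derive (g g' : R -> C) (a b : R) : a <= b ->
  (forall t, a <= t <= b -> is_path_derive g t (g' t)) ->
  (forall t, a <= t <= b -> ccontinuous_path g' t) ->
  is_CInt g' a b (g b - g a)%C.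
Proof.
  intros Hab Hd Hc. split.
  - apply (is_RInt_derive (V := R_CompleteNormedModule) (fun t => Re (g t)));
      intros t Ht; rewrite Rmin_left, Rmax_right in Ht by lra; [ apply Hd | apply Hc ]; exact Ht.
  - apply (is_RInt_derive (V := R_CompleteNormedModule) (fun t => Im (g t)));
      intros t Ht; rewrite Rmin_left, Rmax_right in Ht by lra; [ apply Hd | apply Hc ]; exact Ht.
Qed.

Lemma is_path_derive_continuous (g : R -> C) (t : R) (l : C) :
  is_path_derive g t l -> ccontinuous_path g t.
Proof.
  intros [H1 H2]. split.
  - apply (ex_derive_continuous (V := R_NormedModule)). eexists; exact H1.
  - apply (ex_derive_continuous (V := R_NormedModule)). eexists; exact H2.
Qed.

Lemma continuous_R_iff (h : R -> R) (t : R) : continuous h t <->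
  forall eps, 0 < eps -> exists d, 0 < d /\ forall s, Rabs (s - t) < d -> Rabs (h s - h t) < eps.
Proof.
  split.
  - intros H eps He.
    destruct (H (fun y => Rabs (y - h t) < eps)) as [d Hd].
    { exists (mkposreal _ He). intros y Hy; exact Hy. }
    exists d; split; [ apply cond_pos | ]. intros s Hs. apply Hd. exact Hs.
  - intros H P [e HP]. destruct (H e (cond_pos e)) as [d [Hd Hs]].
    exists (mkposreal _ Hd). intros s Hs'. apply HP. apply Hs. exact Hs'.
Qed.

Lemma ccontinuous_path_iff (g : R -> C) (t : R) : ccontinuous_path g t <->
  forall eps, 0 < eps -> exists d, 0 < d /\
    forall s, Rabs (s - t) < d -> Cmod (g s - g t)%C < eps.
Proof.
  split.
  - intros [H1 H2] eps He.
    assert (He2 : 0 < eps / 2) by lra.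
    destruct (proj1 (continuous_R_iff _ _) H1 _ He2) as [d1 [Hd1 H1']].
    destruct (proj1 (continuous_R_iff _ _) H2 _ He2) as [d2 [Hd2 H2']].
    exists (Rmin d1 d2); split; [ apply Rmin_pos; auto | ].
    intros s Hs.
    specialize (H1' s (Rlt_le_trans _ _ _ Hs (Rmin_l _ _))).
    specialize (H2' s (Rlt_le_trans _ _ _ Hs (Rmin_r _ _))).
    eapply Rle_lt_trans; [ apply Cmod_le_components | ].
    change (Rabs (Re (g s) - Re (g t)) + Rabs (Im (g s) - Im (g t)) < eps). lra.
  - intros H. split; apply continuous_R_iff; intros eps He;
      destruct (H eps He) as [d [Hd Hs]]; exists d; split; auto; intros s Hs';
      (eapply Rle_lt_trans; [ | apply (Hs s Hs') ]).
    + apply (re_le_Cmod (g s - g t)).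
    + apply (im_le_Cmod (g s - g t)).
Qed.

Lemma ccontinuous_path_comp (f : C -> C) (g : R -> C) (t : R) :
  ccontinuous f (g t) -> ccontinuous_path g t -> ccontinuous_path (fun s => f (g s)) t.
Proof.
  intros Hf Hg. apply ccontinuous_path_iff. intros eps He.
  destruct (Hf eps He) as [d [Hd H1]].
  destruct (proj1 (ccontinuous_path_iff _ _) Hg d Hd) as [d' [Hd' H2]].
  exists d'; split; auto.
Qed.

Lemma ccontinuous_path_mult (f g : R -> C) (t : R) :
  ccontinuous_path f t -> ccontinuous_path g t -> ccontinuous_path (fun s => f s * g s)%C t.
Proof.
  intros [H1 H2] [H3 H4]. split; simpl.
  - apply (continuous_minus (V := R_NormedModule)); apply (continuous_mult (K := R_AbsRing)); assumption.
  - apply (continuous_plus (V := R_NormedModule)); apply (continuous_mult (K := R_AbsRing)); assumption.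
Qed.

Lemma ccontinuous_path_minus (f g : R -> C) (t : R) :
  ccontinuous_path f t -> ccontinuous_path g t -> ccontinuous_path (fun s => f s - g s)%C t.
Proof.
  intros [H1 H2] [H3 H4].
  split; apply (continuous_minus (V := R_NormedModule)); assumption.
Qed.

Lemma ccontinuous_path_const (k : C) (t : R) : ccontinuous_path (fun _ => k) t.
Proof.
  split; apply continuous_const.
Qed.

Lemma is_derive_R_iff (h : R -> R) (t l : R) : is_derive h t l <->
  forall eps, 0 < eps -> exists d, 0 < d /\
    forall s, Rabs (s - t) < d -> Rabs (h s - h t - l * (s - t)) <= eps * Rabs (s - t).
Proof.
  split.
  - intros [_ H] eps He.
    destruct (H t (fun P HP => HP) (mkposreal _ He)) as [d Hd].
    exists d; split; [ apply cond_pos | ]. intros s Hs. specialize (Hd s Hs).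
    rewrite (Rmult_comm l). exact Hd.
  - intros H. split; [ apply is_linear_scal_l | ]. intros x Hx.
    assert (x = t) by (symmetry; apply (is_filter_lim_locally_unique (K := R_AbsRing) (V := R_NormedModule)); exact Hx).
    subst x. intros eps. destruct (H eps (cond_pos eps)) as [d [Hd Hs]].
    exists (mkposreal _ Hd). intros s Hs'. specialize (Hs s Hs').
    rewrite (Rmult_comm l) in Hs. exact Hs.
Qed.

Lemma is_path_derive_iff (g : R -> C) (t : R) (l : C) : is_path_derive g t l <->
  forall eps, 0 < eps -> exists d, 0 < d /\
    forall s, Rabs (s - t) < d ->
      Cmod (g s - g t - l * RtoC (s - t))%C <= eps * Rabs (s - t).
Proof.
  assert (Hre : forall s, Re (g s - g t - l * RtoC (s - t))%C
                          = Re (g s) - Re (g t) - Re l * (s - t)).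
  { intros s. destruct (g s), (g t), l; simpl; ring. }
  assert (Him : forall s, Im (g s - g t - l * RtoC (s - t))%C
                          = Im (g s) - Im (g t) - Im l * (s - t)).
  { intros s. destruct (g s), (g t), l; simpl; ring. }
  split.
  - intros [H1 H2] eps He.
    assert (He2 : 0 < eps / 2) by lra.
    destruct (proj1 (is_derive_R_iff _ _ _) H1 _ He2) as [d1 [Hd1 H1']].
    destruct (proj1 (is_derive_R_iff _ _ _) H2 _ He2) as [d2 [Hd2 H2']].
    exists (Rmin d1 d2); split; [ apply Rmin_pos; auto | ].
    intros s Hs.
    specialize (H1' s (Rlt_le_trans _ _ _ Hs (Rmin_l _ _))).
    specialize (H2' s (Rlt_le_trans _ _ _ Hs (Rmin_r _ _))).
    eapply Rle_trans; [ apply Cmod_le_components | ].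
    rewrite Hre, Him. lra.
  - intros H. split; apply is_derive_R_iff; intros eps He;
      destruct (H eps He) as [d [Hd Hs]]; exists d; split; auto; intros s Hs';
      (eapply Rle_trans; [ | apply (Hs s Hs') ]).
    + rewrite <- Hre. apply re_le_Cmod.
    + rewrite <- Him. apply im_le_Cmod.
Qed.

Lemma is_path_derive_comp (F : C -> C) (g : R -> C) (t : R) (l m : C) :
  is_cderive F (g t) l -> is_path_derive g t m ->
  is_path_derive (fun s => F (g s)) t (l * m)%C.
Proof.
  intros HF Hg. apply is_path_derive_iff. intros eps He.
  assert (Hl := Cmod_ge_0 l). assert (Hm := Cmod_ge_0 m).
  set (e1 := eps / (2 * (Cmod m + 1))).
  assert (He1 : 0 < e1) by (apply Rdiv_lt_0_compat; lra).
  assert (He1' : e1 * (Cmod m + 1) = eps / 2) by (unfold e1; field; lra).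
  (* The cap 1 gives |g s - g t| <= (|m| + 1) |s - t|; the other bound absorbs the factor |l|. *)
  set (e2 := Rmin 1 (eps / (2 * (Cmod l + 1)))).
  assert (He2 : 0 < e2) by (apply Rmin_pos; [ lra | apply Rdiv_lt_0_compat; lra ]).
  assert (He2' : e2 * (Cmod l + 1) <= eps / 2).
  { apply Rle_trans with (eps / (2 * (Cmod l + 1)) * (Cmod l + 1)).
    - apply Rmult_le_compat_r; [ lra | apply Rmin_r ].
    - right; field; lra. }
  destruct (HF e1 He1) as [d1 [Hd1 H1]].
  destruct (proj1 (is_path_derive_iff _ _ _) Hg e2 He2) as [d2 [Hd2 H2]].
  destruct (proj1 (ccontinuous_path_iff _ _) (is_path_derive_continuous _ _ _ Hg) d1 Hd1)
    as [d3 [Hd3 H3]].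
  exists (Rmin d2 d3); split; [ apply Rmin_pos; auto | ].
  intros s Hs.
  specialize (H2 s (Rlt_le_trans _ _ _ Hs (Rmin_l _ _))).
  specialize (H3 s (Rlt_le_trans _ _ _ Hs (Rmin_r _ _))).
  specialize (H1 (g s) H3).
  replace (F (g s) - F (g t) - l * m * RtoC (s - t))%C with
    ((F (g s) - F (g t) - l * (g s - g t)) + l * (g s - g t - m * RtoC (s - t)))%C by ring.
  eapply Rle_trans; [ apply Cmod_triangle | ]. rewrite (Cmod_mult l).
  assert (Hgs : Cmod (g s - g t)%C <= (Cmod m + 1) * Rabs (s - t)).
  { replace (g s - g t)%C with ((g s - g t - m * RtoC (s - t)) + m * RtoC (s - t))%C by ring.
    eapply Rle_trans; [ apply Cmod_triangle | ]. rewrite Cmod_mult, Cmod_R.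
    assert (e2 <= 1) by apply Rmin_l. assert (Hp := Rabs_pos (s - t)). nra. }
  assert (Hp := Rabs_pos (s - t)).
  apply Rle_trans with (eps / 2 * Rabs (s - t) + eps / 2 * Rabs (s - t)); [ | lra ].
  apply Rplus_le_compat.
  - eapply Rle_trans; [ exact H1 | ]. rewrite <- He1', Rmult_assoc.
    apply Rmult_le_compat_l; lra.
  - apply Rle_trans with (Cmod l * (e2 * Rabs (s - t))).
    + apply Rmult_le_compat_l; lra.
    + nra.
Qed.

Definition CInt (g : R -> C) (a b : R) : C :=
  (RInt (fun t => Re (g t)) a b, RInt (fun t => Im (g t)) a b).

Lemma CInt_eq (g : R -> C) (a b : R) (l : C) : is_CInt g a b l -> CInt g a b = l.
Proof.
  intros [H1 H2]. apply C_ext; simpl; now apply (is_RInt_unique (V := R_CompleteNormedModule)).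
Qed.

Lemma CInt_correct (g : R -> C) (a b : R) : a <= b ->
  (forall t, a <= t <= b -> ccontinuous_path g t) -> is_CInt g a b (CInt g a b).
Proof.
  intros Hab Hc. destruct (is_CInt_exists g a b Hab Hc) as [l Hl].
  now rewrite (CInt_eq _ _ _ _ Hl).
Qed.

Lemma is_CInt_swap (g : R -> C) (a b : R) (l : C) :
  is_CInt g a b l -> is_CInt g b a (- l)%C.
Proof.
  intros [H1 H2]. split.
  - exact (is_RInt_swap (V := R_NormedModule) _ _ _ _ H1).
  - exact (is_RInt_swap (V := R_NormedModule) _ _ _ _ H2).
Qed.

Lemma is_CInt_Chasles (g : R -> C) (a b c : R) (l m : C) :
  is_CInt g a b l -> is_CInt g b c m -> is_CInt g a c (l + m)%C.
Proof.
  intros [H1 H2] [H3 H4].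
  split; eapply (is_RInt_Chasles (V := R_NormedModule)); eassumption.
Qed.

Lemma is_CInt_comp_lin (g : R -> C) (u v a b : R) (l : C) :
  is_CInt g (u * a + v) (u * b + v) l ->
  is_CInt (fun t => RtoC u * g (u * t + v)%R)%C a b l.
Proof.
  intros [H1 H2]. split.
  - apply (is_RInt_comp_lin (V := R_NormedModule)) in H1.
    eapply is_RInt_ext; [ | exact H1 ]. intros t _.
    change (u * Re (g (u * t + v)) = Re (RtoC u * g (u * t + v)%R)%C).
    destruct (g (u * t + v)); simpl; ring.
  - apply (is_RInt_comp_lin (V := R_NormedModule)) in H2.
    eapply is_RInt_ext; [ | exact H2 ]. intros t _.
    change (u * Im (g (u * t + v)) = Im (RtoC u * g (u * t + v)%R)%C).
    destruct (g (u * t + v)); simpl; ring.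
Qed.

Definition seg_pt (a b : C) (t : R) : C := (a + RtoC t * (b - a))%C.

Definition seg_int (f : C -> C) (a b : C) : C :=
  ((b - a) * CInt (fun t => f (seg_pt a b t)) 0 1)%C.

Definition seg_continuous (f : C -> C) (a b : C) : Prop :=
  forall t, 0 <= t <= 1 -> ccontinuous f (seg_pt a b t).

Lemma seg_pt_dist (a b p : C) (M t : R) : 0 <= t <= 1 ->
  Cmod (a - p)%C <= M -> Cmod (b - p)%C <= M -> Cmod (seg_pt a b t - p)%C <= M.
Proof.
  intros Ht Ha Hb. unfold seg_pt.
  replace (a + t * (b - a) - p)%C with (RtoC (1 - t) * (a - p) + RtoC t * (b - p))%C
    by (rewrite RtoC_minus; ring).
  eapply Rle_trans; [ apply Cmod_triangle | ]. rewrite !Cmod_mult, !Cmod_R.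
  rewrite !Rabs_pos_eq by lra. nra.
Qed.

Lemma seg_pt_cball (a b c : C) (r t : R) : 0 <= t <= 1 ->
  cball c r a -> cball c r b -> cball c r (seg_pt a b t).
Proof.
  intros Ht Ha Hb. unfold cball in *.
  apply Rle_lt_trans with (Rmax (Cmod (a - c)%C) (Cmod (b - c)%C)).
  - apply seg_pt_dist; [ exact Ht | apply Rmax_l | apply Rmax_r ].
  - apply Rmax_lub_lt; assumption.
Qed.

Lemma seg_pt_derive (a b : C) (t : R) : is_path_derive (seg_pt a b) t (b - a)%C.
Proof.
  apply is_path_derive_iff. intros eps He. exists 1; split; [ lra | ]. intros s _.
  replace (seg_pt a b s - seg_pt a b t - (b - a) * RtoC (s - t))%C with (RtoC 0)
    by (unfold seg_pt; rewrite RtoC_minus; ring).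
  rewrite Cmod_0. assert (H := Rabs_pos (s - t)). nra.
Qed.

Lemma seg_continuous_path (f : C -> C) (a b : C) (t : R) :
  seg_continuous f a b -> 0 <= t <= 1 -> ccontinuous_path (fun t => f (seg_pt a b t)) t.
Proof.
  intros Hf Ht. apply ccontinuous_path_comp; [ apply Hf; exact Ht | ].
  eapply is_path_derive_continuous. apply seg_pt_derive.
Qed.

Lemma seg_int_spec (f : C -> C) (a b : C) : seg_continuous f a b ->
  is_CInt (fun t => ((b - a) * f (seg_pt a b t))%C) 0 1 (seg_int f a b).
Proof.
  intros Hf. apply is_CInt_scal. apply CInt_correct; [ lra | ].
  intros t Ht. now apply seg_continuous_path.
Qed.

Lemma seg_int_eq (f : C -> C) (a b l : C) :
  is_CInt (fun t => f (seg_pt a b t)) 0 1 l -> seg_int f a b = ((b - a) * l)%C.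
Proof.
  intros H. unfold seg_int. now rewrite (CInt_eq _ _ _ _ H).
Qed.

Lemma seg_int_swap (f : C -> C) (a b : C) : seg_continuous f a b ->
  seg_int f b a = (- seg_int f a b)%C.
Proof.
  intros Hf.
  assert (H : is_CInt (fun t => f (seg_pt a b t)) 0 1 (CInt (fun t => f (seg_pt a b t)) 0 1)).
  { apply CInt_correct; [ lra | ]. intros t Ht. now apply seg_continuous_path. }
  assert (E : seg_int f a b = ((b - a) * CInt (fun t => f (seg_pt a b t)) 0 1)%C) by reflexivity.
  rewrite E. clear E. revert H. generalize (CInt (fun t => f (seg_pt a b t)) 0 1). intros l H.
  rewrite (seg_int_eq f b a l); [ ring | ].
  apply is_CInt_swap in H.
  assert (H' : is_CInt (fun t => f (seg_pt a b t)) (-1 * 0 + 1) (-1 * 1 + 1) (- l)%C).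
  { replace (-1 * 0 + 1) with 1 by ring. replace (-1 * 1 + 1) with 0 by ring. exact H. }
  apply is_CInt_comp_lin, (is_CInt_scal (-1)) in H'.
  replace (-1 * - l)%C with l in H' by ring.
  eapply is_CInt_ext; [ | exact H' ]. intros t. simpl.
  replace (seg_pt a b (-1 * t + 1)) with (seg_pt b a t)
    by (unfold seg_pt; rewrite RtoC_plus, RtoC_mult; ring).
  ring.
Qed.

Definition midpt (a b : C) : C := ((a + b) / 2)%C.

Lemma midpt_seg_pt (a b : C) : midpt a b = seg_pt a b (/ 2).
Proof.
  unfold midpt, seg_pt. rewrite RtoC_inv by lra. field.
Qed.

Lemma seg_int_mid (f : C -> C) (a b : C) : seg_continuous f a b ->
  seg_int f a b = (seg_int f a (midpt a b) + seg_int f (midpt a b) b)%C.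
Proof.
  intros Hf. set (g := fun t => f (seg_pt a b t)).
  assert (Hg : forall t, 0 <= t <= 1 -> ccontinuous_path g t)
    by (intros t Ht; now apply seg_continuous_path).
  destruct (is_CInt_exists g 0 (/ 2)) as [l1 H1]; [ lra | intros t Ht; apply Hg; lra | ].
  destruct (is_CInt_exists g (/ 2) 1) as [l2 H2]; [ lra | intros t Ht; apply Hg; lra | ].
  rewrite (seg_int_eq f a b _ (is_CInt_Chasles _ _ _ _ _ _ H1 H2)).
  rewrite (seg_int_eq f a (midpt a b) (2 * l1)%C).
  - rewrite (seg_int_eq f (midpt a b) b (2 * l2)%C).
    + unfold midpt. field.
    + assert (H : is_CInt g (/ 2 * 0 + / 2) (/ 2 * 1 + / 2) l2).
      { replace (/ 2 * 0 + / 2) with (/ 2) by lra. replace (/ 2 * 1 + / 2) with 1 by lra.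
        exact H2. }
      apply is_CInt_comp_lin, (is_CInt_scal 2) in H.
      eapply is_CInt_ext; [ | exact H ]. intros t. unfold g.
      replace (seg_pt a b (/ 2 * t + / 2)) with (seg_pt (midpt a b) b t).
      * rewrite RtoC_inv by lra. field.
      * unfold seg_pt, midpt. rewrite RtoC_plus, RtoC_mult, RtoC_inv by lra. field.
  - assert (H : is_CInt g (/ 2 * 0 + 0) (/ 2 * 1 + 0) l1).
    { replace (/ 2 * 0 + 0) with 0 by lra. replace (/ 2 * 1 + 0) with (/ 2) by lra.
      exact H1. }
    apply is_CInt_comp_lin, (is_CInt_scal 2) in H.
    eapply is_CInt_ext; [ | exact H ]. intros t. unfold g.
    replace (seg_pt a b (/ 2 * t + 0)) with (seg_pt a (midpt a b) t).
    + rewrite RtoC_inv by lra. field.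
    + unfold seg_pt, midpt. rewrite RtoC_plus, RtoC_mult, RtoC_inv by lra. field.
Qed.

Lemma seg_int_derive (F f : C -> C) (a b : C) :
  (forall t, 0 <= t <= 1 -> is_cderive F (seg_pt a b t) (f (seg_pt a b t))) ->
  seg_continuous f a b -> seg_int f a b = (F b - F a)%C.
Proof.
  intros HF Hf.
  assert (H : is_CInt (fun t => f (seg_pt a b t) * (b - a))%C 0 1
                (F (seg_pt a b 1) - F (seg_pt a b 0))%C).
  { apply (is_CInt_derive (fun t => F (seg_pt a b t))); [ lra | | ].
    - intros t Ht. apply is_path_derive_comp; [ now apply HF | apply seg_pt_derive ].
    - intros t Ht. apply ccontinuous_path_mult; [ | apply ccontinuous_path_const ].
      now apply seg_continuous_path. }
  replace (seg_pt a b 1) with b in H by (unfold seg_pt; ring).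
  replace (seg_pt a b 0) with a in H by (unfold seg_pt; ring).
  rewrite <- (CInt_eq _ _ _ _ H). symmetry. apply CInt_eq.
  eapply is_CInt_ext; [ | now apply seg_int_spec ]. intros t; simpl. ring.
Qed.

Lemma is_cderive_quadratic (p q z : C) :
  is_cderive (fun z => p * z + q * (z * z))%C z (p + 2 * q * z)%C.
Proof.
  intros eps He. assert (Hq := Cmod_ge_0 q).
  exists (eps / (Cmod q + 1)); split; [ apply Rdiv_lt_0_compat; lra | ].
  intros w Hw.
  replace (p * w + q * (w * w) - (p * z + q * (z * z)) - (p + 2 * q * z) * (w - z))%C
    with (q * (w - z) * (w - z))%C by ring.
  rewrite !Cmod_mult. assert (Hp := Cmod_ge_0 (w - z)).
  apply Rmult_le_compat_r; [ exact Hp | ].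
  apply Rle_trans with ((Cmod q + 1) * (eps / (Cmod q + 1))).
  - nra.
  - right; field; lra.
Qed.

(** The slope is written 2 q so that p z + q z^2 is a primitive without division. Affine functions
    are what Goursat's argument subtracts. *)
Lemma seg_int_affine (p q a b : C) :
  seg_int (fun z => p + 2 * q * z)%C a b = (p * b + q * (b * b) - (p * a + q * (a * a)))%C.
Proof.
  apply (seg_int_derive (fun z => p * z + q * (z * z))%C (fun z => p + 2 * q * z)%C).
  - intros t _. apply is_cderive_quadratic.
  - intros t _. apply is_cderive_continuous with (2 * q)%C.
    intros eps He. exists 1; split; [ lra | ]. intros w _.
    match goal with |- Cmod ?e <= _ => replace e with (RtoC 0) by ring end.
    rewrite Cmod_0. assert (H := Cmod_ge_0 (w - seg_pt a b t)). nra.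
Qed.

Lemma seg_int_bound (f : C -> C) (a b : C) (M : R) : seg_continuous f a b ->
  (forall t, 0 <= t <= 1 -> Cmod (f (seg_pt a b t)) <= M) ->
  Cmod (seg_int f a b) <= 2 * (Cmod (b - a)%C * M).
Proof.
  intros Hf HM.
  apply Rle_trans with (2 * ((1 - 0) * (Cmod (b - a)%C * M))); [ | lra ].
  apply (is_CInt_bound (fun t => (b - a) * f (seg_pt a b t))%C); [ lra | | now apply seg_int_spec ].
  intros t Ht. rewrite Cmod_mult. apply Rmult_le_compat_l; [ apply Cmod_ge_0 | auto ].
Qed.

Lemma ccontinuous_minus (f g : C -> C) (z : C) :
  ccontinuous f z -> ccontinuous g z -> ccontinuous (fun w => f w - g w)%C z.
Proof.
  intros Hf Hg eps He. assert (He2 : 0 < eps / 2) by lra.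
  destruct (Hf _ He2) as [d1 [Hd1 H1]]. destruct (Hg _ He2) as [d2 [Hd2 H2]].
  exists (Rmin d1 d2); split; [ apply Rmin_pos; auto | ]. intros w Hw.
  specialize (H1 w (Rlt_le_trans _ _ _ Hw (Rmin_l _ _))).
  specialize (H2 w (Rlt_le_trans _ _ _ Hw (Rmin_r _ _))).
  replace (f w - g w - (f z - g z))%C with ((f w - f z) + - (g w - g z))%C by ring.
  eapply Rle_lt_trans; [ apply Cmod_triangle | ]. rewrite Cmod_opp. lra.
Qed.

Lemma seg_int_minus (f g : C -> C) (a b : C) :
  seg_continuous f a b -> seg_continuous g a b ->
  seg_int (fun z => f z - g z)%C a b = (seg_int f a b - seg_int g a b)%C.
Proof.
  intros Hf Hg. unfold seg_int.
  rewrite (CInt_eq (fun t => f (seg_pt a b t) - g (seg_pt a b t))%C 0 1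
    (CInt (fun t => f (seg_pt a b t)) 0 1 - CInt (fun t => g (seg_pt a b t)) 0 1)%C).
  - ring.
  - apply is_CInt_minus; apply CInt_correct; try lra; intros t Ht; now apply seg_continuous_path.
Qed.

(** * Goursat's theorem *)

Definition tri_int (f : C -> C) (a b c : C) : C :=
  (seg_int f a b + seg_int f b c + seg_int f c a)%C.

Definition tri_perimeter (a b c : C) : R :=
  Cmod (b - a)%C + Cmod (c - b)%C + Cmod (a - c)%C.

Lemma seg_continuous_ball (f : C -> C) (c : C) (r : R) (a b : C) :
  (forall z, cball c r z -> ccontinuous f z) -> cball c r a -> cball c r b ->
  seg_continuous f a b.
Proof.
  intros Hf Ha Hb t Ht. apply Hf. now apply seg_pt_cball.
Qed.

Lemma midpt_dist (a b p : C) (M : R) :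
  Cmod (a - p)%C <= M -> Cmod (b - p)%C <= M -> Cmod (midpt a b - p)%C <= M.
Proof.
  intros Ha Hb. rewrite midpt_seg_pt. apply seg_pt_dist; auto; lra.
Qed.

Lemma midpt_cball (c : C) (r : R) (a b : C) :
  cball c r a -> cball c r b -> cball c r (midpt a b).
Proof.
  intros Ha Hb. rewrite midpt_seg_pt. apply seg_pt_cball; auto; lra.
Qed.

Lemma tri_int_split (f : C -> C) (c0 : C) (r : R) (a b c : C) :
  (forall z, cball c0 r z -> ccontinuous f z) ->
  cball c0 r a -> cball c0 r b -> cball c0 r c ->
  tri_int f a b c =
    (tri_int f a (midpt a b) (midpt c a) + tri_int f (midpt a b) b (midpt b c)
     + tri_int f (midpt c a) (midpt b c) c
     + tri_int f (midpt a b) (midpt b c) (midpt c a))%C.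
Proof.
  intros Hf Ha Hb Hc. unfold tri_int.
  assert (H1 := midpt_cball _ _ _ _ Ha Hb). assert (H2 := midpt_cball _ _ _ _ Hb Hc).
  assert (H3 := midpt_cball _ _ _ _ Hc Ha).
  assert (Hs : forall x y, cball c0 r x -> cball c0 r y -> seg_continuous f x y)
    by (intros x y; now apply seg_continuous_ball).
  rewrite (seg_int_mid f a b), (seg_int_mid f b c), (seg_int_mid f c a) by auto.
  rewrite (seg_int_swap f (midpt c a) (midpt a b)), (seg_int_swap f (midpt a b) (midpt b c)),
    (seg_int_swap f (midpt b c) (midpt c a)) by auto.
  ring.
Qed.

Lemma Cmod_half (x y : C) : (2 * x)%C = y -> Cmod x = / 2 * Cmod y.
Proof.
  intros <-. rewrite Cmod_mult, Cmod_R, Rabs_pos_eq by lra. lra.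
Qed.

(** The four quarter integrals add up to the whole, so one of them carries at least a quarter of its
    modulus. That the chosen quarter stays inside the old triangle enters through the last clause:
    every closed disc containing the old vertices contains the new ones. *)
Lemma tri_step (f : C -> C) (c0 : C) (r : R) (a b c : C) :
  (forall z, cball c0 r z -> ccontinuous f z) ->
  cball c0 r a -> cball c0 r b -> cball c0 r c ->
  exists a' b' c',
    Cmod (tri_int f a b c) <= 4 * Cmod (tri_int f a' b' c') /\
    tri_perimeter a' b' c' = / 2 * tri_perimeter a b c /\
    Cmod (a' - a)%C <= tri_perimeter a b c /\
    (forall p M, Cmod (a - p)%C <= M -> Cmod (b - p)%C <= M -> Cmod (c - p)%C <= M ->
       Cmod (a' - p)%C <= M /\ Cmod (b' - p)%C <= M /\ Cmod (c' - p)%C <= M).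
Proof.
  intros Hf Ha Hb Hc. apply NNPP; intros Hno.
  assert (Hsm : forall a' b' c',
    tri_perimeter a' b' c' = / 2 * tri_perimeter a b c ->
    Cmod (a' - a)%C <= tri_perimeter a b c ->
    (forall p M, Cmod (a - p)%C <= M -> Cmod (b - p)%C <= M -> Cmod (c - p)%C <= M ->
       Cmod (a' - p)%C <= M /\ Cmod (b' - p)%C <= M /\ Cmod (c' - p)%C <= M) ->
    4 * Cmod (tri_int f a' b' c') < Cmod (tri_int f a b c)).
  { intros a' b' c' H1 H2 H3. apply Rnot_le_lt; intros H.
    apply Hno. exists a', b', c'. auto. }
  assert (Hself : Cmod (a - a)%C = 0)
    by (replace (a - a)%C with (RtoC 0) by ring; apply Cmod_0).
  assert (P1 := Cmod_ge_0 (b - a)). assert (P2 := Cmod_ge_0 (c - b)).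
  assert (P3 := Cmod_ge_0 (a - c)).
  assert (Hma : Cmod (midpt a b - a)%C = / 2 * Cmod (b - a)%C)
    by (apply Cmod_half; unfold midpt; field).
  assert (Hca : Cmod (midpt c a - a)%C = / 2 * Cmod (a - c)%C)
    by (rewrite (Cmod_sub_sym a c); apply Cmod_half; unfold midpt; field).
  assert (E : Cmod (tri_int f a b c) <= Cmod (tri_int f a (midpt a b) (midpt c a))
     + Cmod (tri_int f (midpt a b) b (midpt b c))
     + Cmod (tri_int f (midpt c a) (midpt b c) c)
     + Cmod (tri_int f (midpt a b) (midpt b c) (midpt c a))).
  { rewrite (tri_int_split f c0 r) by auto.
    eapply Rle_trans; [ apply Cmod_triangle | ]. apply Rplus_le_compat_r.
    eapply Rle_trans; [ apply Cmod_triangle | ]. apply Rplus_le_compat_r.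
    apply Cmod_triangle. }
  assert (Hd : forall x y u v, (2 * (x - y))%C = (u - v)%C -> Cmod (x - y)%C = / 2 * Cmod (u - v)%C)
    by (intros; now apply Cmod_half).
  assert (K1 := Hsm a (midpt a b) (midpt c a)).
  assert (K2 := Hsm (midpt a b) b (midpt b c)).
  assert (K3 := Hsm (midpt c a) (midpt b c) c).
  assert (K4 := Hsm (midpt a b) (midpt b c) (midpt c a)).
  unfold tri_perimeter in *.
  rewrite Hself in K1. rewrite Hma in K2, K4. rewrite Hca in K3.
  assert (4 * Cmod (tri_int f a (midpt a b) (midpt c a)) < Cmod (tri_int f a b c)).
  { apply K1; [ | lra | intros; auto using midpt_dist ].
    rewrite (Hd (midpt a b) a b a), (Hd (midpt c a) (midpt a b) c b), (Hd a (midpt c a) a c);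
      [ ring | unfold midpt; field .. ]. }
  assert (4 * Cmod (tri_int f (midpt a b) b (midpt b c)) < Cmod (tri_int f a b c)).
  { apply K2; [ | lra | intros; auto using midpt_dist ].
    rewrite (Hd b (midpt a b) b a), (Hd (midpt b c) b c b), (Hd (midpt a b) (midpt b c) a c);
      [ ring | unfold midpt; field .. ]. }
  assert (4 * Cmod (tri_int f (midpt c a) (midpt b c) c) < Cmod (tri_int f a b c)).
  { apply K3; [ | lra | intros; auto using midpt_dist ].
    rewrite (Hd (midpt b c) (midpt c a) b a), (Hd c (midpt b c) c b), (Hd (midpt c a) c a c);
      [ ring | unfold midpt; field .. ]. }
  assert (4 * Cmod (tri_int f (midpt a b) (midpt b c) (midpt c a)) < Cmod (tri_int f a b c)).
  { apply K4; [ | lra | intros; auto using midpt_dist ].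
    rewrite (Hd (midpt b c) (midpt a b) c a), (Hd (midpt c a) (midpt b c) a b),
      (Hd (midpt a b) (midpt c a) b c); [ | unfold midpt; field .. ].
    rewrite (Cmod_sub_sym c a), (Cmod_sub_sym a b), (Cmod_sub_sym b c). ring. }
  lra.
Qed.

Lemma tri_int_affine (p q a b c : C) : tri_int (fun z => p + 2 * q * z)%C a b c = 0%C.
Proof.
  unfold tri_int. rewrite !seg_int_affine. ring.
Qed.

(** Affine functions have vanishing triangle integrals, so only the deviation counts, and it is
    estimated edge by edge. *)
Lemma tri_int_near_affine (f : C -> C) (c0 : C) (r : R) (a b c p q : C) (M : R) :
  (forall z, cball c0 r z -> ccontinuous f z) ->
  cball c0 r a -> cball c0 r b -> cball c0 r c ->
  (forall x y t, (x = a \/ x = b \/ x = c) -> (y = a \/ y = b \/ y = c) -> 0 <= t <= 1 ->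
     Cmod (f (seg_pt x y t) - (p + 2 * q * seg_pt x y t))%C <= M) ->
  Cmod (tri_int f a b c) <= 2 * M * tri_perimeter a b c.
Proof.
  intros Hf Ha Hb Hc HM.
  set (g := fun z => (p + 2 * q * z)%C).
  assert (Hg : forall z, ccontinuous g z).
  { intros z. apply is_cderive_continuous with (2 * q)%C.
    intros eps He. exists 1; split; [ lra | ]. intros w _. unfold g.
    match goal with |- Cmod ?e <= _ => replace e with (RtoC 0) by ring end.
    rewrite Cmod_0. assert (H := Cmod_ge_0 (w - z)). nra. }
  assert (Hs : forall x y, cball c0 r x -> cball c0 r y -> seg_continuous f x y)
    by (intros x y; now apply seg_continuous_ball).
  assert (Hgs : forall x y, seg_continuous g x y) by (intros x y t _; apply Hg).
  assert (E : tri_int f a b c = (seg_int (fun z => f z - g z) a b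
     + seg_int (fun z => f z - g z) b c + seg_int (fun z => f z - g z) c a)%C).
  { rewrite !seg_int_minus by auto.
    assert (H := tri_int_affine p q a b c). fold g in H. unfold tri_int in *.
    replace (seg_int f a b + seg_int f b c + seg_int f c a)%C with
      (seg_int f a b + seg_int f b c + seg_int f c a - 0)%C by ring.
    rewrite <- H. ring. }
  assert (B : forall x y, (x = a \/ x = b \/ x = c) -> (y = a \/ y = b \/ y = c) ->
    cball c0 r x -> cball c0 r y ->
    Cmod (seg_int (fun z => f z - g z)%C x y) <= 2 * (Cmod (y - x)%C * M)).
  { intros x y Hx Hy Hxb Hyb. apply seg_int_bound.
    - intros t Ht. apply ccontinuous_minus; [ now apply Hs | apply Hg ].
    - intros t Ht. now apply HM. }
  rewrite E. unfold tri_perimeter.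
  eapply Rle_trans; [ apply Cmod_triangle | ].
  eapply Rle_trans; [ apply Rplus_le_compat_r, Cmod_triangle | ].
  assert (B1 := B a b). assert (B2 := B b c). assert (B3 := B c a).
  assert (Cmod (seg_int (fun z => f z - g z)%C a b) <= 2 * (Cmod (b - a)%C * M)) by auto.
  assert (Cmod (seg_int (fun z => f z - g z)%C b c) <= 2 * (Cmod (c - b)%C * M)) by auto.
  assert (Cmod (seg_int (fun z => f z - g z)%C c a) <= 2 * (Cmod (a - c)%C * M)) by auto.
  lra.
Qed.

(** The integral loses at most a factor 4 per subdivision, and the squared perimeter loses exactly
    that factor. Near the limit point p the function is affine up to eps times the distance, so the
    n-th integral is at most 6 eps times the n-th squared perimeter, and the powers of 4 cancel. *)
Lemma Goursat (f : C -> C) (c0 : C) (r : R) (a b c : C) :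
  (forall z, cball c0 r z -> exists l, is_cderive f z l) ->
  cball c0 r a -> cball c0 r b -> cball c0 r c -> tri_int f a b c = 0%C.
Proof.
  intros Hd Ha Hb Hc.
  assert (Hf : forall z, cball c0 r z -> ccontinuous f z).
  { intros z Hz. destruct (Hd z Hz) as [l Hl]. eapply is_cderive_continuous; eauto. }
  set (inb := fun T : C * C * C =>
    cball c0 r (fst (fst T)) /\ cball c0 r (snd (fst T)) /\ cball c0 r (snd T)).
  set (TI := fun T : C * C * C => tri_int f (fst (fst T)) (snd (fst T)) (snd T)).
  set (TP := fun T : C * C * C => tri_perimeter (fst (fst T)) (snd (fst T)) (snd T)).
  set (near := fun (T : C * C * C) p M => Cmod (fst (fst T) - p)%C <= M /\
    Cmod (snd (fst T) - p)%C <= M /\ Cmod (snd T - p)%C <= M).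
  assert (Hstep : forall T, exists T', inb T ->
    Cmod (TI T) <= 4 * Cmod (TI T') /\ TP T' = / 2 * TP T /\
    Cmod (fst (fst T') - fst (fst T))%C <= TP T /\ (forall p M, near T p M -> near T' p M)).
  { intros [[x y] z]. destruct (classic (inb (x, y, z))) as [Hi | Hi].
    - destruct Hi as [H1 [H2 H3]].
      destruct (tri_step f c0 r x y z Hf H1 H2 H3) as [x' [y' [z' [K1 [K2 [K3 K4]]]]]].
      exists (x', y', z'). intros _. repeat split; auto;
      intros; apply (K4 p M); try apply H.
    - exists (x, y, z). intros H; contradiction. }
  apply (choice (fun T T' => inb T ->
    Cmod (TI T) <= 4 * Cmod (TI T') /\ TP T' = / 2 * TP T /\
    Cmod (fst (fst T') - fst (fst T))%C <= TP T /\ (forall p M, near T p M -> near T' p M)))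
    in Hstep.
  destruct Hstep as [next Hnext].
  set (T := fun n => Nat.iter n next (a, b, c)).
  set (M := Rmax (Cmod (a - c0)%C) (Rmax (Cmod (b - c0)%C) (Cmod (c - c0)%C))).
  assert (HMr : M < r) by (repeat apply Rmax_lub_lt; assumption).
  assert (HT0 : near (T O) c0 M).
  { split; [ apply Rmax_l | split ]; (eapply Rle_trans; [ | apply Rmax_r ]);
      [ apply Rmax_l | apply Rmax_r ]. }
  assert (Hin : forall T', near T' c0 M -> inb T').
  { intros T' [H1 [H2 H3]]. repeat split; unfold cball; lra. }
  assert (HTn : forall n, near (T n) c0 M).
  { induction n as [ | n IH ]; [ exact HT0 | ].
    apply (Hnext (T n)); auto. }
  assert (HTI : forall n, Cmod (TI (T O)) <= 4 ^ n * Cmod (TI (T n))).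
  { induction n as [ | n IH ]; [ simpl; lra | ].
    destruct (Hnext (T n) (Hin _ (HTn n))) as [H _].
    change (next (T n)) with (T (S n)) in H.
    assert (0 < 4 ^ n) by (apply pow_lt; lra). simpl pow. nra. }
  assert (HTP : forall n, TP (T n) = TP (T O) * (/ 2) ^ n).
  { induction n as [ | n IH ]; [ simpl; lra | ].
    destruct (Hnext (T n) (Hin _ (HTn n))) as [_ [H _]].
    change (next (T n)) with (T (S n)) in H. rewrite H, IH. simpl. ring. }
  assert (HP0 : 0 <= TP (T O)).
  { unfold TP, tri_perimeter.
    repeat apply Rplus_le_le_0_compat; apply Cmod_ge_0. }
  assert (Hpow : forall n, 0 < (/ 2) ^ n) by (intros n; apply pow_lt; lra).
  (* One step moves the first vertex by at most the perimeter, and perimeters halve, so the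
     displacement telescopes against [2 * TP]. *)
  assert (Hcau : forall n k, Cmod (fst (fst (T (n + k)%nat)) - fst (fst (T n)))%C
                             <= 2 * TP (T n) - 2 * TP (T (n + k)%nat)).
  { intros n. induction k as [ | k IH ].
    - rewrite Nat.add_0_r. rewrite Rminus_diag.
      match goal with |- Cmod ?e <= _ => replace e with (RtoC 0) by ring end.
      rewrite Cmod_0; lra.
    - rewrite Nat.add_succ_r.
      destruct (Hnext (T (n + k)%nat) (Hin _ (HTn _))) as [_ [H1 [H2 _]]].
      change (next (T (n + k)%nat)) with (T (S (n + k))) in H1, H2.
      eapply Rle_trans; [ apply (Cmod_sub_triangle _ (fst (fst (T (n + k)%nat)))) | ].
      lra. }
  destruct (bounded_seq_cluster (fun n => fst (fst (T n))) c0 M) as [p Hp];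
    [ intros n; apply HTn | ].
  assert (Hpc : Cmod (p - c0)%C <= M)
    by (apply (cluster_in_closed_ball (fun n => fst (fst (T n)))); [ intros n; apply HTn | exact Hp ]).
  assert (HTP0 : forall n, 0 <= TP (T n)).
  { intros n. rewrite HTP. specialize (Hpow n). nra. }
  assert (Hpn : forall n, Cmod (p - fst (fst (T n)))%C <= 2 * TP (T n)).
  { intros n. apply (cluster_in_closed_ball (fun k => fst (fst (T (n + k)%nat)))).
    - intros k. specialize (Hcau n k). specialize (HTP0 (n + k)%nat). lra.
    - intros eps N He. destruct (Hp eps (n + N)%nat He) as [m [Hm1 Hm2]].
      exists (m - n)%nat. split; [ lia | ].
      replace (n + (m - n))%nat with m by lia. exact Hm2. }
  destruct (Hd p) as [l Hl]; [ unfold cball; lra | ].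
  assert (Hbound : forall eps, 0 < eps -> Cmod (TI (T O)) <= 6 * eps * (TP (T O) * TP (T O))).
  { intros eps He. destruct (Hl eps He) as [d [Hdp Hl']].
    assert (HlimP : exists n, 3 * TP (T n) < d).
    { destruct (pow_lt_1_zero (/ 2)) with (y := d / (3 * TP (T O) + 1)) as [n Hn].
      - rewrite Rabs_pos_eq; lra.
      - apply Rdiv_lt_0_compat; lra.
      - exists n. specialize (Hn n (le_n n)). specialize (Hpow n).
        rewrite Rabs_pos_eq in Hn by lra. rewrite HTP.
        apply (Rmult_lt_compat_r (3 * TP (T O) + 1)) in Hn; [ | lra ].
        replace (d / (3 * TP (T O) + 1) * (3 * TP (T O) + 1)) with d in Hn by (field; lra).
        lra. }
    destruct HlimP as [n Hn]. specialize (HTP0 n).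
    assert (Hq : Cmod (TI (T n)) <= 2 * (eps * (3 * TP (T n))) * TP (T n)).
    { destruct (Hin _ (HTn n)) as [I1 [I2 I3]].
      (* The affine comparison function is the first-order expansion of f at p, its slope l written
         as twice [l / 2]. *)
      apply (tri_int_near_affine f c0 r _ _ _ (f p - l * p)%C (l / 2)%C); auto.
      set (x0 := fst (fst (T n))) in *. set (y0 := snd (fst (T n))) in *.
      set (z0 := snd (T n)) in *.
      assert (Hpx : Cmod (x0 - p)%C <= 2 * TP (T n))
        by (rewrite Cmod_sub_sym; apply Hpn).
      (* The first vertex is within two perimeters of p, and the other vertices are at most one
         perimeter further. *)
      assert (Hv : forall x, x = x0 \/ x = y0 \/ x = z0 -> Cmod (x - p)%C <= 3 * TP (T n)).
      { assert (Q1 := Cmod_ge_0 (y0 - x0)). assert (Q2 := Cmod_ge_0 (z0 - y0)).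
        assert (Q3 := Cmod_ge_0 (x0 - z0)).
        assert (QP : TP (T n) = Cmod (y0 - x0)%C + Cmod (z0 - y0)%C + Cmod (x0 - z0)%C)
          by reflexivity.
        assert (R1 := Cmod_sub_triangle y0 x0 p). assert (R2 := Cmod_sub_triangle z0 x0 p).
        rewrite (Cmod_sub_sym z0 x0) in R2.
        intros x [-> | [-> | ->]]; lra. }
      intros x y t Hx Hy Ht.
      assert (Hz : Cmod (seg_pt x y t - p)%C <= 3 * TP (T n))
        by (apply seg_pt_dist; auto).
      replace (f (seg_pt x y t) - (f p - l * p + 2 * (l / 2) * seg_pt x y t))%C
        with (f (seg_pt x y t) - f p - l * (seg_pt x y t - p))%C by field.
      eapply Rle_trans; [ apply Hl'; lra | ]. apply Rmult_le_compat_l; lra. }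
    eapply Rle_trans; [ apply (HTI n) | ].
    assert (H4 : 4 ^ n * ((/ 2) ^ n * (/ 2) ^ n) = 1).
    { rewrite <- !Rpow_mult_distr. replace (4 * (/ 2 * / 2)) with 1 by lra. apply pow1. }
    assert (0 < 4 ^ n) by (apply pow_lt; lra).
    eapply Rle_trans; [ apply Rmult_le_compat_l; [ lra | exact Hq ] | ].
    rewrite HTP. right.
    transitivity (6 * eps * (TP (T O) * TP (T O)) * (4 ^ n * ((/ 2) ^ n * (/ 2) ^ n))).
    - ring.
    - rewrite H4. ring. }
  apply Cmod_eq_0. change (Cmod (TI (T O)) = 0).
  apply Rle_antisym; [ | apply Cmod_ge_0 ].
  apply le_epsilon. intros eps He. rewrite Rplus_0_l.
  assert (Hq : 0 < 6 * (TP (T O) * TP (T O)) + 1) by nra.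
  eapply Rle_trans; [ apply (Hbound (eps / (6 * (TP (T O) * TP (T O)) + 1))) | ].
  - apply Rdiv_lt_0_compat; lra.
  - apply Rmult_le_reg_r with (6 * (TP (T O) * TP (T O)) + 1); [ exact Hq | ].
    replace (6 * (eps / (6 * (TP (T O) * TP (T O)) + 1)) * (TP (T O) * TP (T O)) *
      (6 * (TP (T O) * TP (T O)) + 1)) with (6 * eps * (TP (T O) * TP (T O))) by (field; lra).
    lra.
Qed.

(** Expressed by increments along segments instead of derivatives: this is what vanishing triangle
    integrals deliver directly. [primitive_cderive] recovers the derivative when f is continuous. *)
Definition is_primitive_on (c : C) (r : R) (F f : C -> C) : Prop :=
  forall a b, cball c r a -> cball c r b -> seg_int f a b = (F b - F a)%C.

Lemma primitive_of_tri_int_zero (f : C -> C) (c0 : C) (r : R) :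
  (forall z, cball c0 r z -> ccontinuous f z) ->
  (forall a b c, cball c0 r a -> cball c0 r b -> cball c0 r c -> tri_int f a b c = 0%C) ->
  exists F, is_primitive_on c0 r F f.
Proof.
  intros Hf Ht. exists (seg_int f c0). intros a b Ha Hb.
  assert (Hc : cball c0 r c0).
  { unfold cball in *. replace (c0 - c0)%C with (RtoC 0) by ring. rewrite Cmod_0.
    eapply Rle_lt_trans; [ apply Cmod_ge_0 | exact Ha ]. }
  specialize (Ht c0 a b Hc Ha Hb). unfold tri_int in Ht.
  rewrite (seg_int_swap f c0 b) in Ht by (apply (seg_continuous_ball f c0 r); auto).
  replace (seg_int f c0 b) with (seg_int f c0 a + seg_int f a b)%C; [ ring | ].
  replace (seg_int f c0 b) with (0 + seg_int f c0 b)%C by ring.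
  rewrite <- Ht. ring.
Qed.

(** * Cauchy's formula on circles and derivatives *)

Lemma uniform_continuity_closed_ball (f : C -> C) (c : C) (M eps : R) :
  (forall z, Cmod (z - c)%C <= M -> ccontinuous f z) -> 0 < eps ->
  exists d, 0 < d /\ forall z, Cmod (z - c)%C <= M ->
    forall w, Cmod (w - z)%C < d -> Cmod (f w - f z)%C < eps.
Proof.
  intros Hf He.
  apply (closed_ball_uniform c M
    (fun z d => forall w, Cmod (w - z)%C < d -> Cmod (f w - f z)%C < eps)).
  - intros z d d' H Hd w Hw. apply H. lra.
  - intros p Hp. assert (He2 : 0 < eps / 2) by lra.
    destruct (Hf p Hp _ He2) as [d [Hd H]].
    exists (d / 2); split; [ lra | ]. intros z _ Hz w Hw.
    assert (H1 := Cmod_sub_triangle w z p).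
    assert (Hw' : Cmod (f w - f p)%C < eps / 2) by (apply H; lra).
    assert (Hz' : Cmod (f z - f p)%C < eps / 2) by (apply H; lra).
    assert (H2 := Cmod_sub_triangle (f w) (f p) (f z)).
    rewrite (Cmod_sub_sym (f p)) in H2. lra.
Qed.

(** The left side is the integral of f - f z over the segment from z to z + h. The point is that d
    does not depend on z in the smaller disc: this permits differentiation under the circle
    integrals. *)
Lemma primitive_increment (c : C) (r M eps : R) (F f : C -> C) :
  is_primitive_on c r F f -> (forall z, cball c r z -> ccontinuous f z) ->
  M < r -> 0 < eps ->
  exists d, 0 < d /\ forall z, Cmod (z - c)%C <= M -> forall h, Cmod h < d ->
    Cmod (F (z + h) - F z - h * f z)%C <= eps * Cmod h.
Proof.
  intros HF Hf HM He. assert (He2 : 0 < eps / 2) by lra.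
  destruct (uniform_continuity_closed_ball f c M (eps / 2)) as [d [Hd H]]; auto.
  { intros z Hz. apply Hf. unfold cball. lra. }
  exists (Rmin d (r - M)); split; [ apply Rmin_pos; lra | ]. intros z Hz h Hh.
  assert (Hh1 := Rlt_le_trans _ _ _ Hh (Rmin_l _ _)).
  assert (Hh2 := Rlt_le_trans _ _ _ Hh (Rmin_r _ _)).
  assert (Hzb : cball c r z) by (unfold cball; lra).
  assert (Hzh : cball c r (z + h)%C).
  { unfold cball. replace (z + h - c)%C with ((z - c) + h)%C by ring.
    eapply Rle_lt_trans; [ apply Cmod_triangle | lra ]. }
  rewrite <- (HF z (z + h)%C Hzb Hzh).
  assert (Hk : seg_int (fun w => f z + 2 * 0 * w)%C z (z + h)%C = (h * f z)%C)
    by (rewrite seg_int_affine; ring).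
  assert (Hs : seg_continuous f z (z + h)%C) by (apply (seg_continuous_ball f c r); auto).
  assert (Hg : seg_continuous (fun w => f z + 2 * 0 * w)%C z (z + h)%C).
  { intros t _ e Hpos. exists 1; split; [ lra | ]. intros w _.
    match goal with |- Cmod ?e < _ => replace e with (RtoC 0) by ring end.
    now rewrite Cmod_0. }
  rewrite <- Hk, <- seg_int_minus by auto.
  apply Rle_trans with (2 * (Cmod (z + h - z)%C * (eps / 2))).
  - apply seg_int_bound.
    + intros t Ht. apply ccontinuous_minus; auto.
    + intros t Ht. left.
      replace (f (seg_pt z (z + h) t) - (f z + 2 * 0 * seg_pt z (z + h) t))%C
        with (f (seg_pt z (z + h) t) - f z)%C by ring.
      apply H; [ exact Hz | ]. unfold seg_pt.
      replace (z + t * (z + h - z) - z)%C with (RtoC t * h)%C by ring.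
      rewrite Cmod_mult, Cmod_R, Rabs_pos_eq by lra.
      assert (Hp := Cmod_ge_0 h). nra.
  - replace (z + h - z)%C with h by ring. lra.
Qed.

Lemma primitive_cderive (c : C) (r : R) (F f : C -> C) (z : C) :
  is_primitive_on c r F f -> (forall z, cball c r z -> ccontinuous f z) ->
  cball c r z -> is_cderive F z (f z).
Proof.
  intros HF Hf Hz eps He.
  destruct (primitive_increment c r (Cmod (z - c)%C) eps F f) as [d [Hd H]]; auto.
  exists d; split; [ exact Hd | ]. intros w Hw.
  specialize (H z (Rle_refl _) (w - z)%C Hw).
  replace (z + (w - z))%C with w in H by ring. rewrite (Cmult_comm (f z)). exact H.
Qed.

Definition cis (t : R) : C := (cos t, sin t).

Lemma Cmod_cis (t : R) : Cmod (cis t) = 1.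
Proof.
  assert (H := sin2_cos2 t). unfold Rsqr in H. unfold Cmod, cis; simpl.
  transitivity (sqrt 1); [ f_equal; lra | apply sqrt_1 ].
Qed.

Lemma cis_mult_conj (t : R) : (cis t * Cconj (cis t))%C = 1%C.
Proof.
  assert (H := sin2_cos2 t). unfold Rsqr in H.
  apply C_ext; simpl; lra.
Qed.

Lemma cis_derive (t : R) : is_path_derive cis t (Ci * cis t)%C.
Proof.
  split; simpl.
  - replace (0 * cos t - 1 * sin t) with (- sin t) by ring. apply is_derive_cos.
  - replace (0 * sin t + 1 * cos t) with (cos t) by ring. apply is_derive_sin.
Qed.

Lemma cis_conj_derive (t : R) : is_path_derive (fun t => Cconj (cis t)) t (- Ci * Cconj (cis t))%C.
Proof.
  split; simpl; auto_derive; auto; ring.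
Qed.

Lemma is_derive_value (h : R -> R) (t l l' : R) : is_derive h t l -> l = l' -> is_derive h t l'.
Proof.
  now intros H <-.
Qed.

Lemma is_path_derive_mult (f g : R -> C) (t : R) (l m : C) :
  is_path_derive f t l -> is_path_derive g t m ->
  is_path_derive (fun s => f s * g s)%C t (l * g t + f t * m)%C.
Proof.
  intros [H1 H2] [H3 H4]. split.
  - assert (K1 := is_derive_mult _ _ _ _ _ H1 H3 Rmult_comm).
    assert (K2 := is_derive_mult _ _ _ _ _ H2 H4 Rmult_comm).
    eapply is_derive_value; [ exact (is_derive_minus (V := R_NormedModule) _ _ _ _ _ K1 K2) | ].
    destruct l, m, (f t), (g t). unfold minus, plus, opp, mult; simpl. ring.
  - assert (K1 := is_derive_mult _ _ _ _ _ H1 H4 Rmult_comm).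
    assert (K2 := is_derive_mult _ _ _ _ _ H2 H3 Rmult_comm).
    eapply is_derive_value; [ exact (is_derive_plus (V := R_NormedModule) _ _ _ _ _ K1 K2) | ].
    destruct l, m, (f t), (g t). unfold minus, plus, opp, mult; simpl. ring.
Qed.

Lemma is_path_derive_affine (w k : C) (g : R -> C) (t : R) (l : C) :
  is_path_derive g t l -> is_path_derive (fun s => w + k * g s)%C t (k * l)%C.
Proof.
  intros H. apply (is_path_derive_comp (fun z => w + k * z)%C g t k l); [ | exact H ].
  intros eps He. exists 1; split; [ lra | ]. intros v _.
  match goal with |- Cmod ?e <= _ => replace e with (RtoC 0) by ring end.
  rewrite Cmod_0. assert (Hp := Cmod_ge_0 (v - g t)). nra.
Qed.

Definition circle_pt (w : C) (rho : R) (t : R) : C := (w + RtoC rho * cis t)%C.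

Lemma circle_pt_dist (w c : C) (rho t : R) : 0 <= rho ->
  Cmod (circle_pt w rho t - c)%C <= Cmod (w - c)%C + rho.
Proof.
  intros Hr. unfold circle_pt.
  replace (w + rho * cis t - c)%C with ((w - c) + rho * cis t)%C by ring.
  eapply Rle_trans; [ apply Cmod_triangle | ].
  rewrite Cmod_mult, Cmod_R, Cmod_cis, Rabs_pos_eq by lra. lra.
Qed.

Lemma circle_pt_derive (w : C) (rho t : R) :
  is_path_derive (circle_pt w rho) t (RtoC rho * (Ci * cis t))%C.
Proof.
  apply is_path_derive_affine, cis_derive.
Qed.

(* The first Fourier coefficient of [F] on a circle; up to normalisation it is
   the Cauchy integral for the derivative of [F] at the centre. *)
Definition circle_coef (F : C -> C) (w : C) (rho : R) : C :=
  CInt (fun t => F (circle_pt w rho t) * Cconj (cis t))%C 0 (2 * PI).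

Lemma two_PI_pos : 0 < 2 * PI.
Proof.
  assert (H := PI_RGT_0). lra.
Qed.

Lemma circle_path_continuous (F : C -> C) (w c : C) (r rho t : R) :
  (forall z, cball c r z -> ccontinuous F z) -> 0 <= rho -> Cmod (w - c)%C + rho < r ->
  ccontinuous_path (fun t => F (circle_pt w rho t)) t.
Proof.
  intros HF Hrho Hr. apply ccontinuous_path_comp.
  - apply HF. unfold cball. assert (H := circle_pt_dist w c rho t Hrho). lra.
  - eapply is_path_derive_continuous. apply circle_pt_derive.
Qed.

Lemma cis_conj_continuous (t : R) : ccontinuous_path (fun t => Cconj (cis t)) t.
Proof.
  eapply is_path_derive_continuous. apply cis_conj_derive.
Qed.

Lemma circle_coef_spec (F : C -> C) (w c : C) (r rho : R) :
  (forall z, cball c r z -> ccontinuous F z) -> 0 <= rho -> Cmod (w - c)%C + rho < r ->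
  is_CInt (fun t => F (circle_pt w rho t) * Cconj (cis t))%C 0 (2 * PI) (circle_coef F w rho).
Proof.
  intros HF Hrho Hr. apply CInt_correct; [ assert (H := two_PI_pos); lra | ].
  intros t _. apply ccontinuous_path_mult; [ | apply cis_conj_continuous ].
  now apply (circle_path_continuous F w c r).
Qed.

Lemma is_CInt_circle_bound (g : R -> C) (M : R) (l : C) :
  (forall t, Cmod (g t) <= M) ->
  is_CInt (fun t => g t * Cconj (cis t))%C 0 (2 * PI) l -> Cmod l <= 4 * PI * M.
Proof.
  intros HM H. apply Rle_trans with (2 * ((2 * PI - 0) * M)); [ | lra ].
  apply (is_CInt_bound (fun t => g t * Cconj (cis t))%C); [ | | exact H ].
  - assert (K := two_PI_pos); lra.
  - intros t _. rewrite Cmod_mult, Cmod_conj, Cmod_cis, Rmult_1_r. apply HM.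
Qed.

Section CirclePrimitive.

Variables (c : C) (r : R) (F f : C -> C).
Hypothesis HF : is_primitive_on c r F f.
Hypothesis Hf : forall z, cball c r z -> ccontinuous f z.

Lemma primitive_continuous (z : C) : cball c r z -> ccontinuous F z.
Proof.
  intros Hz. eapply is_cderive_continuous. now apply (primitive_cderive c r F f).
Qed.

Definition circle_mean (w : C) (rho : R) : C :=
  CInt (fun t => f (circle_pt w rho t)) 0 (2 * PI).

Lemma circle_mean_spec (w : C) (rho : R) : 0 <= rho -> Cmod (w - c)%C + rho < r ->
  is_CInt (fun t => f (circle_pt w rho t)) 0 (2 * PI) (circle_mean w rho).
Proof.
  intros Hrho Hr. apply CInt_correct; [ assert (H := two_PI_pos); lra | ].
  intros t _. now apply (circle_path_continuous f w c r).
Qed.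

(** Integration by parts on the circle: the function [F (circle_pt w rho t) * Cconj (cis t)] takes
    the same value at 0 and 2 PI, so its derivative, which is Ci times the difference of the two
    integrands, integrates to zero. *)
Lemma circle_coef_mean (w : C) (rho : R) : 0 <= rho -> Cmod (w - c)%C + rho < r ->
  circle_coef F w rho = (RtoC rho * circle_mean w rho)%C.
Proof.
  intros Hrho Hr.
  assert (H1 := circle_coef_spec F w c r rho primitive_continuous Hrho Hr).
  assert (H2 := circle_mean_spec w rho Hrho Hr).
  assert (H3 := is_CInt_scal Ci _ _ _ _ (is_CInt_minus _ _ _ _ _ _ (is_CInt_scal (RtoC rho) _ _ _ _ H2) H1)).
  set (g := fun t => (F (circle_pt w rho t) * Cconj (cis t))%C).
  assert (H4 : is_CInt (fun t => Ci * (RtoC rho * f (circle_pt w rho t)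
                 - F (circle_pt w rho t) * Cconj (cis t)))%C 0 (2 * PI) (g (2 * PI)%R - g 0%R)%C).
  { apply is_CInt_derive; [ assert (H := two_PI_pos); lra | | ].
    - intros t _.
      replace (Ci * (rho * f (circle_pt w rho t) - F (circle_pt w rho t) * Cconj (cis t)))%C with
        ((f (circle_pt w rho t) * (RtoC rho * (Ci * cis t))) * Cconj (cis t)
         + F (circle_pt w rho t) * (- Ci * Cconj (cis t)))%C.
      + apply is_path_derive_mult; [ | apply cis_conj_derive ].
        apply is_path_derive_comp; [ | apply circle_pt_derive ].
        apply (primitive_cderive c r F f); auto. unfold cball.
        assert (H := circle_pt_dist w c rho t Hrho). lra.
      + replace (f (circle_pt w rho t) * (rho * (Ci * cis t)) * Cconj (cis t))%C with
          (rho * Ci * f (circle_pt w rho t) * (cis t * Cconj (cis t)))%C by ring.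
        rewrite cis_mult_conj. ring.
    - intros t _. apply ccontinuous_path_mult; [ apply ccontinuous_path_const | ].
      apply ccontinuous_path_minus.
      + apply ccontinuous_path_mult; [ apply ccontinuous_path_const | ].
        now apply (circle_path_continuous f w c r).
      + apply ccontinuous_path_mult; [ | apply cis_conj_continuous ].
        apply (circle_path_continuous F w c r); auto using primitive_continuous. }
  assert (E := is_CInt_unique _ _ _ _ _ H3 H4).
  assert (Eg : g (2 * PI) = g 0).
  { unfold g, circle_pt, cis. rewrite cos_2PI, sin_2PI, cos_0, sin_0. reflexivity. }
  rewrite Eg in E.
  replace (circle_coef F w rho) with
    (rho * circle_mean w rho + Ci * (Ci * (rho * circle_mean w rho - circle_coef F w rho)))%C.
  - rewrite E. ring.
  - replace (Ci * (Ci * (rho * circle_mean w rho - circle_coef F w rho)))%C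
      with ((Ci * Ci) * (rho * circle_mean w rho - circle_coef F w rho))%C by ring.
    replace (Ci * Ci)%C with (- (1))%C by (apply C_ext; simpl; ring). ring.
Qed.

(** Differentiation under the integral sign in the radius: changing rho to s moves the point by (s -
    rho) cis t, so F changes by (s - rho) cis t times f up to a uniformly small error, and cis t
    cancels its conjugate. *)
Lemma circle_coef_derive (w : C) (rho : R) : 0 < rho -> Cmod (w - c)%C + rho < r ->
  is_path_derive (circle_coef F w) rho (circle_mean w rho).
Proof.
  intros Hrho Hr. apply is_path_derive_iff. intros eps He.
  assert (HPI := PI_RGT_0).
  destruct (primitive_increment c r (Cmod (w - c)%C + rho) (eps / (4 * PI)) F f) as [d [Hd H]];
    auto; [ apply Rdiv_lt_0_compat; lra | ].
  exists (Rmin d (Rmin rho (r - (Cmod (w - c)%C + rho)))).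
  split; [ repeat apply Rmin_pos; lra | ]. intros s Hs.
  assert (Hs1 := Rlt_le_trans _ _ _ Hs (Rmin_l _ _)).
  assert (Hs' := Rlt_le_trans _ _ _ Hs (Rmin_r _ _)).
  assert (Hs2 := Rlt_le_trans _ _ _ Hs' (Rmin_l _ _)).
  assert (Hs3 := Rlt_le_trans _ _ _ Hs' (Rmin_r _ _)).
  assert (Hsp : 0 <= s /\ Cmod (w - c)%C + s < r).
  { apply Rabs_lt_between in Hs2. apply Rabs_lt_between in Hs3. lra. }
  assert (H1 := circle_coef_spec F w c r s primitive_continuous (proj1 Hsp) (proj2 Hsp)).
  assert (H2 := circle_coef_spec F w c r rho primitive_continuous (Rlt_le _ _ Hrho) Hr).
  assert (H3 := is_CInt_scal (RtoC (s - rho)) _ _ _ _ (circle_mean_spec w rho (Rlt_le _ _ Hrho) Hr)).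
  rewrite (Cmult_comm (circle_mean w rho)).
  apply Rle_trans with (4 * PI * (eps / (4 * PI) * Rabs (s - rho))); [ | right; field; lra ].
  apply (is_CInt_circle_bound (fun t => F (circle_pt w s t) - F (circle_pt w rho t)
           - (RtoC (s - rho) * cis t) * f (circle_pt w rho t))%C).
  - intros t.
    replace (circle_pt w s t) with (circle_pt w rho t + RtoC (s - rho) * cis t)%C
      by (unfold circle_pt; rewrite RtoC_minus; ring).
    assert (Hm : Cmod (RtoC (s - rho) * cis t)%C = Rabs (s - rho))
      by (rewrite Cmod_mult, Cmod_R, Cmod_cis; ring).
    rewrite <- Hm. apply H.
    + apply circle_pt_dist. lra.
    + rewrite Hm. exact Hs1.
  - eapply is_CInt_ext;
      [ | exact (is_CInt_minus _ _ _ _ _ _ (is_CInt_minus _ _ _ _ _ _ H1 H2) H3) ].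
    intros t. simpl.
    replace (RtoC (s - rho) * f (circle_pt w rho t))%C with
      (RtoC (s - rho) * f (circle_pt w rho t) * 1)%C by ring.
    rewrite <- (cis_mult_conj t). ring.
Qed.

(** By the two preceding lemmas the coefficient equals rho times its own derivative in rho, so its
    quotient by rho has derivative zero. This takes the place of deforming one circle into
    another. *)
Lemma circle_coef_homogeneous (w : C) (rho rho' : R) :
  0 < rho -> rho < rho' -> Cmod (w - c)%C + rho' < r ->
  (RtoC rho' * circle_coef F w rho)%C = (RtoC rho * circle_coef F w rho')%C.
Proof.
  intros H0 H1 H2.
  assert (Hder : forall s, rho <= s <= rho' ->
     is_derive (fun s => Re (circle_coef F w s) / s) s 0 /\
     is_derive (fun s => Im (circle_coef F w s) / s) s 0).
  { intros s Hs. assert (Hsr : Cmod (w - c)%C + s < r) by lra.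
    destruct (circle_coef_derive w s) as [D1 D2]; [ lra | exact Hsr | ].
    assert (E := circle_coef_mean w s ltac:(lra) Hsr).
    assert (E1 : Re (circle_coef F w s) = s * Re (circle_mean w s))
      by (rewrite E; destruct (circle_mean w s); simpl; ring).
    assert (E2 : Im (circle_coef F w s) = s * Im (circle_mean w s))
      by (rewrite E; destruct (circle_mean w s); simpl; ring).
    assert (Did : is_derive (fun x : R => x) s 1) by exact (is_derive_id (K := R_AbsRing) s).
    split.
    - eapply is_derive_value; [ exact (is_derive_div _ _ _ _ _ D1 Did ltac:(lra)) | ].
      cbv beta. rewrite E1. field. lra.
    - eapply is_derive_value; [ exact (is_derive_div _ _ _ _ _ D2 Did ltac:(lra)) | ].
      cbv beta. rewrite E2. field. lra. }
  assert (K1 := eq_is_derive (V := R_NormedModule) _ rho rho' (fun s Hs => proj1 (Hder s Hs)) H1).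
  assert (K2 := eq_is_derive (V := R_NormedModule) _ rho rho' (fun s Hs => proj2 (Hder s Hs)) H1).
  cbv beta in K1, K2. revert K1 K2.
  generalize (circle_coef F w rho) (circle_coef F w rho'). intros [x y] [x' y'] K1 K2.
  simpl in K1, K2.
  assert (x = x' / rho' * rho) by (rewrite <- K1; field; lra).
  assert (y = y' / rho' * rho) by (rewrite <- K2; field; lra).
  subst x y. apply C_ext; simpl; field; lra.
Qed.

(** In the expansion F w + rho cis t f w + o(rho) the constant integrates to zero against the
    conjugate of cis t, and the linear term contributes 2 PI rho f w. *)
Lemma circle_coef_small (w : C) (eps : R) : cball c r w -> 0 < eps ->
  exists d, 0 < d /\ forall rho, 0 < rho < d ->
    Cmod (circle_coef F w rho - RtoC rho * (RtoC (2 * PI) * f w))%C <= eps * rho.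
Proof.
  intros Hw He. assert (HPI := PI_RGT_0).
  destruct (primitive_increment c r (Cmod (w - c)%C) (eps / (4 * PI)) F f) as [d [Hd H]];
    auto; [ apply Rdiv_lt_0_compat; lra | ].
  unfold cball in Hw.
  exists (Rmin d (r - Cmod (w - c)%C)); split; [ apply Rmin_pos; lra | ]. intros rho [Hr0 Hr].
  assert (Hr1 := Rlt_le_trans _ _ _ Hr (Rmin_l _ _)).
  assert (Hr2 := Rlt_le_trans _ _ _ Hr (Rmin_r _ _)).
  assert (H1 := circle_coef_spec F w c r rho primitive_continuous ltac:(lra) ltac:(lra)).
  (* Since Ci times - Ci is 1, this integrand is [F w * Cconj (cis t)], arranged as a multiple of
     the derivative of [Cconj (cis t)]. *)
  assert (H2 : is_CInt (fun t => Ci * F w * (- Ci * Cconj (cis t)))%C 0 (2 * PI) 0%C).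
  { replace (RtoC 0) with (Ci * F w * (Cconj (cis (2 * PI)%R) - Cconj (cis 0%R)))%C.
    - apply is_CInt_scal.
      apply (is_CInt_derive (fun t => Cconj (cis t))); [ lra | intros t _; apply cis_conj_derive | ].
      intros t _. apply ccontinuous_path_mult; [ apply ccontinuous_path_const | apply cis_conj_continuous ].
    - unfold cis. rewrite cos_2PI, sin_2PI, cos_0, sin_0. ring. }
  assert (H3 := is_CInt_const 0 (2 * PI) (RtoC rho * f w)%C).
  apply Rle_trans with (4 * PI * (eps / (4 * PI) * rho)); [ | right; field; lra ].
  apply (is_CInt_circle_bound (fun t => F (circle_pt w rho t) - F w - (RtoC rho * cis t) * f w)%C).
  - intros t.
    assert (Hm : Cmod (RtoC rho * cis t)%C = rho)
      by (rewrite Cmod_mult, Cmod_R, Cmod_cis, Rabs_pos_eq by lra; ring).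
    assert (Hi := H w (Rle_refl _) (RtoC rho * cis t)%C).
    rewrite Hm in Hi. exact (Hi Hr1).
  - assert (K := is_CInt_minus _ _ _ _ _ _ (is_CInt_minus _ _ _ _ _ _ H1 H2) H3).
    replace (circle_coef F w rho - rho * (RtoC (2 * PI) * f w))%C with
      (circle_coef F w rho - 0 - (RtoC (2 * PI) - 0) * (rho * f w))%C by ring.
    eapply is_CInt_ext; [ | exact K ]. intros t. simpl.
    replace (Ci * F w * (- Ci * Cconj (cis t)))%C with (- (Ci * Ci) * F w * Cconj (cis t))%C by ring.
    replace (Ci * Ci)%C with (- (1))%C by (apply C_ext; simpl; ring).
    replace (RtoC rho * f w)%C with (RtoC rho * f w * 1)%C by ring.
    rewrite <- (cis_mult_conj t) at 2. ring.
Qed.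

(** The quotient of the coefficient by rho is constant, and [circle_coef_small] identifies its limit
    as rho tends to 0. As f is the derivative of F, this is Cauchy's formula for F'. *)
Lemma Cauchy_circle (w : C) (rho : R) : 0 < rho -> Cmod (w - c)%C + rho < r ->
  (RtoC (2 * PI * rho) * f w)%C = circle_coef F w rho.
Proof.
  intros Hrho Hr.
  assert (E : (circle_coef F w rho - RtoC rho * (RtoC (2 * PI) * f w))%C = 0%C).
  { apply Cmod_eq_0. apply Rle_antisym; [ | apply Cmod_ge_0 ].
    apply le_epsilon. intros eps He. rewrite Rplus_0_l.
    destruct (circle_coef_small w (eps / rho)) as [d [Hd H]];
      [ unfold cball; lra | apply Rdiv_lt_0_compat; lra | ].
    set (s := Rmin (d / 2) (rho / 2)).
    assert (Hs0 : 0 < s) by (apply Rmin_pos; lra).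
    assert (Hs1 : s <= d / 2) by apply Rmin_l. assert (Hs2 : s <= rho / 2) by apply Rmin_r.
    specialize (H s ltac:(lra)).
    assert (Hh := circle_coef_homogeneous w s rho Hs0 ltac:(lra) Hr).
    apply Rmult_le_reg_l with s; [ exact Hs0 | ].
    replace (s * Cmod (circle_coef F w rho - rho * (RtoC (2 * PI) * f w))%C) with
      (Cmod (RtoC s * (circle_coef F w rho - rho * (RtoC (2 * PI) * f w)))%C)
      by (rewrite Cmod_mult, Cmod_R, Rabs_pos_eq by lra; reflexivity).
    replace (s * (circle_coef F w rho - rho * (RtoC (2 * PI) * f w)))%C with
      (RtoC rho * (circle_coef F w s - RtoC s * (RtoC (2 * PI) * f w)))%C.
    - rewrite Cmod_mult, Cmod_R, Rabs_pos_eq by lra.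
      replace (s * eps) with (rho * (eps / rho * s)) by (field; lra).
      apply Rmult_le_compat_l; lra.
    - transitivity (rho * circle_coef F w s - RtoC rho * (RtoC s * (RtoC (2 * PI) * f w)))%C; [ ring | ].
      rewrite Hh. ring. }
  rewrite RtoC_mult.
  replace (circle_coef F w rho) with
    (circle_coef F w rho - RtoC rho * (RtoC (2 * PI) * f w) + RtoC rho * (RtoC (2 * PI) * f w))%C by ring.
  rewrite E. ring.
Qed.

(** By [Cauchy_circle], f at a point is an integral of F over a circle centred there. At fixed
    radius the circle translates with the point, and F changes under a translation by v - w by (v -
    w) f up to a uniform error, so the integral can be differentiated. The input is only a
    continuous f with a primitive, which is what Morera's theorem supplies. *)
Lemma derivative_of_primitive_cderive (w : C) (rho : R) : 0 < rho -> Cmod (w - c)%C + rho < r ->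
  is_cderive f w (/ RtoC (2 * PI * rho) * circle_coef f w rho)%C.
Proof.
  intros Hrho Hr eps He. assert (HPI := PI_RGT_0).
  assert (Hk : 0 < 2 * PI * rho) by nra.
  destruct (primitive_increment c r (Cmod (w - c)%C + rho) (eps * rho / 2) F f) as [d [Hd H]];
    auto; [ nra | ].
  exists (Rmin d (r - (Cmod (w - c)%C + rho))); split; [ apply Rmin_pos; lra | ]. intros v Hv.
  assert (Hv1 := Rlt_le_trans _ _ _ Hv (Rmin_l _ _)).
  assert (Hv2 := Rlt_le_trans _ _ _ Hv (Rmin_r _ _)).
  assert (Hvr : Cmod (v - c)%C + rho < r)
    by (assert (T := Cmod_sub_triangle v w c); lra).
  assert (H1 := circle_coef_spec F v c r rho primitive_continuous (Rlt_le _ _ Hrho) Hvr).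
  assert (H2 := circle_coef_spec F w c r rho primitive_continuous (Rlt_le _ _ Hrho) Hr).
  assert (H3 := is_CInt_scal (v - w)%C _ _ _ _
                  (circle_coef_spec f w c r rho Hf (Rlt_le _ _ Hrho) Hr)).
  assert (Hne : RtoC (2 * PI * rho) <> 0%C) by (intros K; apply RtoC_inj in K; lra).
  replace (f v - f w - / RtoC (2 * PI * rho) * circle_coef f w rho * (v - w))%C with
    (/ RtoC (2 * PI * rho) * (circle_coef F v rho - circle_coef F w rho
       - (v - w) * circle_coef f w rho))%C.
  - rewrite Cmod_mult, Cmod_inv, Cmod_R, Rabs_pos_eq by (auto; lra).
    apply Rmult_le_reg_l with (2 * PI * rho); [ exact Hk | ].
    rewrite <- Rmult_assoc, Rinv_r, Rmult_1_l by lra.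
    replace (2 * PI * rho * (eps * Cmod (v - w)%C)) with
      (4 * PI * (eps * rho / 2 * Cmod (v - w)%C)) by field.
    apply (is_CInt_circle_bound (fun t => F (circle_pt v rho t) - F (circle_pt w rho t)
             - (v - w) * f (circle_pt w rho t))%C).
    + intros t.
      replace (circle_pt v rho t) with (circle_pt w rho t + (v - w))%C by (unfold circle_pt; ring).
      apply H; [ apply circle_pt_dist; lra | exact Hv1 ].
    + eapply is_CInt_ext;
        [ | exact (is_CInt_minus _ _ _ _ _ _ (is_CInt_minus _ _ _ _ _ _ H1 H2) H3) ].
      intros t. simpl. ring.
  - rewrite <- (Cauchy_circle v rho Hrho Hvr), <- (Cauchy_circle w rho Hrho Hr). field. exact Hne.
Qed.

End CirclePrimitive.

(** * Regularity of derivatives and Morera's theorem *)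

Lemma is_cderive_unique (f : C -> C) (z l m : C) :
  is_cderive f z l -> is_cderive f z m -> l = m.
Proof.
  intros H1 H2.
  apply is_cderive_iff, is_C_derive_unique in H1.
  apply is_cderive_iff, is_C_derive_unique in H2. congruence.
Qed.

Lemma holomorphic_primitive (c : C) (r : R) (f : C -> C) :
  (forall z, cball c r z -> exists l, is_cderive f z l) -> exists F, is_primitive_on c r F f.
Proof.
  intros H. apply primitive_of_tri_int_zero.
  - intros z Hz. destruct (H z Hz) as [l Hl]. eapply is_cderive_continuous; eauto.
  - intros a b d Ha Hb Hd. now apply (Goursat f c r).
Qed.

(** With rho fixed, [derivative_of_primitive_cderive] writes f1 near w as a circle integral of f,
    which varies continuously with the centre because f is uniformly continuous on a closed disc. *)
Lemma derivative_continuous (c : C) (r : R) (f f1 : C -> C) (w : C) :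
  (forall z, cball c r z -> is_cderive f z (f1 z)) -> cball c r w -> ccontinuous f1 w.
Proof.
  intros Hd Hw.
  assert (Hf : forall z, cball c r z -> ccontinuous f z)
    by (intros z Hz; eapply is_cderive_continuous; apply Hd; exact Hz).
  destruct (holomorphic_primitive c r f) as [F HF]; [ intros z Hz; exists (f1 z); auto | ].
  unfold cball in Hw. set (rho := (r - Cmod (w - c)%C) / 2).
  assert (Hrho : 0 < rho) by (unfold rho; lra).
  assert (Hwr : Cmod (w - c)%C + rho < r) by (unfold rho; lra).
  assert (HPI := PI_RGT_0). assert (Hk : 0 < 2 * PI * rho) by nra.
  assert (Hne : RtoC (2 * PI * rho) <> 0%C) by (intros K; apply RtoC_inj in K; lra).
  assert (E : forall v, Cmod (v - c)%C + rho < r ->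
            f1 v = (/ RtoC (2 * PI * rho) * circle_coef f v rho)%C).
  { intros v Hv. apply (is_cderive_unique f v).
    - apply Hd. unfold cball. lra.
    - now apply (derivative_of_primitive_cderive c r F f). }
  intros eps He.
  destruct (uniform_continuity_closed_ball f c (Cmod (w - c)%C + rho) (eps * rho / 4))
    as [d [Hdp H]].
  { intros z Hz. apply Hf. unfold cball. lra. }
  { nra. }
  exists (Rmin d (r - (Cmod (w - c)%C + rho))); split; [ apply Rmin_pos; lra | ]. intros v Hv.
  assert (Hv1 := Rlt_le_trans _ _ _ Hv (Rmin_l _ _)).
  assert (Hv2 := Rlt_le_trans _ _ _ Hv (Rmin_r _ _)).
  assert (Hvr : Cmod (v - c)%C + rho < r)
    by (assert (T := Cmod_sub_triangle v w c); lra).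
  rewrite (E v Hvr), (E w Hwr).
  replace (/ RtoC (2 * PI * rho) * circle_coef f v rho - / RtoC (2 * PI * rho) * circle_coef f w rho)%C
    with (/ RtoC (2 * PI * rho) * (circle_coef f v rho - circle_coef f w rho))%C by ring.
  rewrite Cmod_mult, Cmod_inv, Cmod_R, Rabs_pos_eq by (auto; lra).
  assert (B : Cmod (circle_coef f v rho - circle_coef f w rho)%C <= 4 * PI * (eps * rho / 4)).
  { apply (is_CInt_circle_bound (fun t => f (circle_pt v rho t) - f (circle_pt w rho t))%C).
    - intros t. left. apply H.
      + apply circle_pt_dist. lra.
      + replace (circle_pt v rho t - circle_pt w rho t)%C with (v - w)%C by (unfold circle_pt; ring).
        exact Hv1.
    - eapply is_CInt_ext; [ | exact (is_CInt_minus _ _ _ _ _ _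
        (circle_coef_spec f v c r rho Hf (Rlt_le _ _ Hrho) Hvr)
        (circle_coef_spec f w c r rho Hf (Rlt_le _ _ Hrho) Hwr)) ].
      intros t. simpl. ring. }
  apply Rmult_lt_reg_l with (2 * PI * rho); [ exact Hk | ].
  rewrite <- Rmult_assoc, Rinv_r, Rmult_1_l by lra. nra.
Qed.

(** Once f1 is known to be continuous, f is a primitive of it along segments, so f1 falls under
    [derivative_of_primitive_cderive]. *)
Lemma derivative_holomorphic (c : C) (r : R) (f f1 : C -> C) (w : C) :
  (forall z, cball c r z -> is_cderive f z (f1 z)) -> cball c r w ->
  exists l, is_cderive f1 w l.
Proof.
  intros Hd Hw.
  assert (Hf1 : forall z, cball c r z -> ccontinuous f1 z)
    by (intros z Hz; now apply (derivative_continuous c r f f1)).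
  assert (HF : is_primitive_on c r f f1).
  { intros a b Ha Hb. apply seg_int_derive.
    - intros t Ht. apply Hd. now apply seg_pt_cball.
    - now apply (seg_continuous_ball f1 c r). }
  unfold cball in Hw. eexists.
  apply (derivative_of_primitive_cderive c r f f1 HF Hf1 w ((r - Cmod (w - c)%C) / 2)); lra.
Qed.

Lemma Morera (c : C) (r : R) (f : C -> C) (w : C) :
  (forall z, cball c r z -> ccontinuous f z) ->
  (forall x y z, cball c r x -> cball c r y -> cball c r z -> tri_int f x y z = 0%C) ->
  cball c r w -> exists l, is_cderive f w l.
Proof.
  intros Hf Ht Hw. destruct (primitive_of_tri_int_zero f c r Hf Ht) as [F HF].
  unfold cball in Hw. eexists.
  apply (derivative_of_primitive_cderive c r F f HF Hf w ((r - Cmod (w - c)%C) / 2)); lra.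
Qed.

(** * Second derivatives along lines *)

(** The second-order data at 0 of a function restricted to a line. The first derivative is required
    on a neighbourhood so that a second one at 0 makes sense; only values at 0 are recorded, so that
    jets add and compose. *)
Definition jet2 (u : R -> R) (a1 a2 : R) : Prop :=
  exists (u1 : R -> R) (d : R), 0 < d /\
    (forall t, Rabs t < d -> is_derive u t (u1 t)) /\ u1 0 = a1 /\ is_derive u1 0 a2.

Lemma jet2_plus (u v : R -> R) (a1 a2 b1 b2 : R) :
  jet2 u a1 a2 -> jet2 v b1 b2 -> jet2 (fun t => u t + v t) (a1 + b1) (a2 + b2).
Proof.
  intros [u1 [d [Hd [H1 [H2 H3]]]]] [v1 [e [He [K1 [K2 K3]]]]].
  exists (fun t => u1 t + v1 t), (Rmin d e).
  split; [ now apply Rmin_pos | ]. split; [ | split ].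
  - intros t Ht.
    apply (is_derive_plus (V := R_NormedModule)); [ apply H1 | apply K1 ];
      (eapply Rlt_le_trans; [ exact Ht | ]); [ apply Rmin_l | apply Rmin_r ].
  - now rewrite H2, K2.
  - now apply (is_derive_plus (V := R_NormedModule)).
Qed.

Lemma jet2_comp (h h1 u : R -> R) (a1 a2 h2 : R) :
  (forall s, is_derive h s (h1 s)) -> is_derive h1 (u 0) h2 -> jet2 u a1 a2 ->
  jet2 (fun t => h (u t)) (h1 (u 0) * a1) (h2 * (a1 * a1) + h1 (u 0) * a2).
Proof.
  intros Hh Hh1 [u1 [d [Hd [H1 [H2 H3]]]]].
  exists (fun t => h1 (u t) * u1 t), d. split; [ exact Hd | ]. split; [ | split ].
  - intros t Ht. rewrite Rmult_comm.
    exact (is_derive_comp (V := R_NormedModule) h u t _ _ (Hh (u t)) (H1 t Ht)).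
  - now rewrite H2.
  - assert (Hu0 : is_derive u 0 a1) by (rewrite <- H2; apply H1; rewrite Rabs_R0; exact Hd).
    assert (K := is_derive_comp (V := R_NormedModule) h1 u 0 _ _ Hh1 Hu0).
    eapply is_derive_value; [ exact (is_derive_mult _ _ _ _ _ K H3 Rmult_comm) | ].
    unfold plus, mult, scal; simpl. unfold mult; simpl. rewrite H2. ring.
Qed.

(** Fermat's theorem gives [u1 0 = 0]. If a2 were positive, u1 would be positive just to the right
    of 0, and by the mean value theorem u would exceed its maximum there. *)
Lemma jet2_max (u : R -> R) (a1 a2 d : R) : 0 < d ->
  (forall t, Rabs t < d -> u t <= u 0) -> jet2 u a1 a2 -> a2 <= 0.
Proof.
  intros Hd Hmax [u1 [e [He [H1 [H2 H3]]]]].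
  assert (Ha1 : u1 0 = 0).
  { set (m := Rmin d e).
    assert (Hm : 0 < m) by now apply Rmin_pos.
    assert (D0 : derivable_pt_lim u 0 (u1 0))
      by (apply is_derive_Reals, H1; rewrite Rabs_R0; exact He).
    assert (K := deriv_maximum u (- m) m 0 (exist _ _ D0) ltac:(lra) ltac:(lra)).
    apply K. intros x Hx1 Hx2. apply Hmax.
    apply Rlt_le_trans with m; [ apply Rabs_lt_between; lra | apply Rmin_l ]. }
  apply Rnot_lt_le; intros Hpos.
  destruct (proj1 (is_derive_R_iff _ _ _) H3 (a2 / 2)) as [d' [Hd' H]]; [ lra | ].
  set (s := Rmin (d / 2) (Rmin (e / 2) (d' / 2))).
  assert (Hs : 0 < s) by (repeat apply Rmin_pos; lra).
  assert (Hs1 : s <= d / 2) by apply Rmin_l.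
  assert (Hs2 : s <= e / 2) by (eapply Rle_trans; [ apply Rmin_r | apply Rmin_l ]).
  assert (Hs3 : s <= d' / 2) by (eapply Rle_trans; [ apply Rmin_r | apply Rmin_r ]).
  destruct (MVT_cor2 u u1 0 s Hs) as [x [E Hx]].
  { intros x Hx. apply is_derive_Reals, H1. rewrite Rabs_pos_eq; lra. }
  assert (Hle : u s <= u 0) by (apply Hmax; rewrite Rabs_pos_eq; lra).
  assert (Hx' := H x). rewrite Rminus_0_r, Rabs_pos_eq in Hx' by lra.
  specialize (Hx' ltac:(lra)). rewrite Ha1 in Hx'. apply Rabs_le_between in Hx'.
  assert (0 < u1 x) by nra. nra.
Qed.

(** Such a quadratic is s^2 - |z - c|^2 along a line traversed at unit speed. *)
Lemma jet2_ln_quadratic (al be : R) : 0 < al ->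
  jet2 (fun t => ln (al - be * t - t * t)) (- be / al) (- 2 / al - (be * be) / (al * al)).
Proof.
  intros Hal. assert (Hb := Rabs_pos be).
  (* For |t| < d one has t^2 <= |t|, so |be t| + t^2 stays below al / 2. *)
  set (d := Rmin 1 (al / (2 * (Rabs be + 1)))).
  assert (Hd : 0 < d) by (apply Rmin_pos; [ lra | apply Rdiv_lt_0_compat; lra ]).
  assert (Hp : forall t, Rabs t < d -> 0 < al - be * t - t * t).
  { intros t Ht.
    assert (Ht1 := Rlt_le_trans _ _ _ Ht (Rmin_l _ _)).
    assert (Ht2 := Rlt_le_trans _ _ _ Ht (Rmin_r _ _)).
    apply (Rmult_lt_compat_r (2 * (Rabs be + 1))) in Ht2; [ | lra ].
    replace (al / (2 * (Rabs be + 1)) * (2 * (Rabs be + 1))) with al in Ht2 by (field; lra).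
    assert (Hbt : be * t <= Rabs be * Rabs t) by (rewrite <- Rabs_mult; apply Rle_abs).
    assert (Htt : t * t <= Rabs t * 1).
    { rewrite <- (Rabs_pos_eq (t * t)) by nra. rewrite Rabs_mult.
      apply Rmult_le_compat_l; [ apply Rabs_pos | lra ]. }
    lra. }
  exists (fun t => (- be - 2 * t) / (al - be * t - t * t)), d.
  split; [ exact Hd | ]. split; [ | split ].
  - intros t Ht. specialize (Hp t Ht). auto_derive; [ lra | ]. field. lra.
  - simpl. field. lra.
  - auto_derive; [ lra | ]. field. lra.
Qed.

Lemma jet2_ln_norm (X Y X1 Y1 : R -> R) (x2 y2 d : R) : 0 < d ->
  (forall t, Rabs t < d -> is_derive X t (X1 t) /\ is_derive Y t (Y1 t) /\
     0 < X t * X t + Y t * Y t) ->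
  is_derive X1 0 x2 -> is_derive Y1 0 y2 ->
  let N := X 0 * X 0 + Y 0 * Y 0 in
  let p := (X 0 * X1 0 + Y 0 * Y1 0) / N in
  jet2 (fun t => ln (Cmod (X t, Y t))) p
    ((X1 0 * X1 0 + Y1 0 * Y1 0 + X 0 * x2 + Y 0 * y2) / N - 2 * (p * p)).
Proof.
  intros Hd H Hx2 Hy2 N p.
  exists (fun t => (X t * X1 t + Y t * Y1 t) / (X t * X t + Y t * Y t)), d.
  split; [ exact Hd | ]. split; [ | split ].
  - intros t Ht. destruct (H t Ht) as [HX [HY HN]].
    unfold Cmod; simpl.
    assert (Hs : 0 < sqrt (X t * (X t * 1) + Y t * (Y t * 1)))
      by (apply sqrt_lt_R0; lra).
    auto_derive.
    + repeat split; try (eexists; eassumption); lra.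
    + change (Derive (fun x => X x) t) with (Derive X t).
      change (Derive (fun x => Y x) t) with (Derive Y t).
      rewrite (is_derive_unique _ _ _ HX), (is_derive_unique _ _ _ HY).
      assert (Hss := sqrt_sqrt (X t * (X t * 1) + Y t * (Y t * 1)) ltac:(lra)).
      set (q := sqrt (X t * (X t * 1) + Y t * (Y t * 1))) in *.
      replace (X t * X t + Y t * Y t) with (q * q) by lra. field. lra.
  - reflexivity.
  - destruct (H 0) as [HX [HY HN]]; [ rewrite Rabs_R0; exact Hd | ].
    auto_derive.
    + repeat split; try (eexists; eassumption). lra.
    + change (Derive (fun x => X x) 0) with (Derive X 0).
      change (Derive (fun x => Y x) 0) with (Derive Y 0).
      change (Derive (fun x => X1 x) 0) with (Derive X1 0).
      change (Derive (fun x => Y1 x) 0) with (Derive Y1 0).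
      rewrite (is_derive_unique _ _ _ HX), (is_derive_unique _ _ _ HY),
        (is_derive_unique _ _ _ Hx2), (is_derive_unique _ _ _ Hy2).
      unfold p, N. field. lra.
Qed.

Lemma line_derive (z om : C) (t : R) : is_path_derive (fun t => z + om * RtoC t)%C t om.
Proof.
  apply is_path_derive_iff. intros eps He. exists 1; split; [ lra | ]. intros s _.
  match goal with |- Cmod ?e <= _ => replace e with (RtoC 0) by (rewrite RtoC_minus; ring) end.
  rewrite Cmod_0. assert (H := Rabs_pos (s - t)). nra.
Qed.

Lemma jet2_ln_Cmod (F F1 : C -> C) (F2 z om : C) (d : R) : 0 < d -> Cmod om = 1 ->
  (forall w, cball z d w -> is_cderive F w (F1 w)) -> is_cderive F1 z F2 -> F z <> 0%C ->
  let N := Re (F z) * Re (F z) + Im (F z) * Im (F z) in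
  let p := (Re (F z) * Re (F1 z * om)%C + Im (F z) * Im (F1 z * om)%C) / N in
  jet2 (fun t => ln (Cmod (F (z + om * RtoC t)%C))) p
    ((Re (F1 z * om)%C * Re (F1 z * om)%C + Im (F1 z * om)%C * Im (F1 z * om)%C
      + Re (F z) * Re (F2 * om * om)%C + Im (F z) * Im (F2 * om * om)%C) / N - 2 * (p * p)).
Proof.
  intros Hd Hom HF HF1 Hz N p.
  set (g := fun t => (z + om * RtoC t)%C).
  assert (g0 : g 0 = z) by (unfold g; ring).
  assert (Hc : ccontinuous F z).
  { apply is_cderive_continuous with (F1 z), HF. unfold cball.
    replace (z - z)%C with (RtoC 0) by ring. rewrite Cmod_0. exact Hd. }
  destruct (Hc (Cmod (F z))) as [e [He Hnz]]; [ now apply Cmod_gt_0 | ].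
  assert (Hg : forall t, Cmod (g t - z)%C = Rabs t).
  { intros t. unfold g. replace (z + om * t - z)%C with (om * RtoC t)%C by ring.
    rewrite Cmod_mult, Hom, Cmod_R. ring. }
  assert (D : is_path_derive (fun t => F1 (g t) * om)%C 0 (F2 * om * om)%C).
  { replace (F2 * om * om)%C with (F2 * om * om + F1 (g 0%R) * 0)%C by ring.
    apply is_path_derive_mult.
    - apply (is_path_derive_comp F1 g 0 F2 om); [ now rewrite g0 | apply line_derive ].
    - split; apply (is_derive_const (V := R_NormedModule)). }
  assert (K := jet2_ln_norm (fun t => Re (F (g t))) (fun t => Im (F (g t)))
    (fun t => Re (F1 (g t) * om)%C) (fun t => Im (F1 (g t) * om)%C)
    (Re (F2 * om * om)%C) (Im (F2 * om * om)%C) (Rmin d e)).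
  cbv beta in K. rewrite g0 in K.
  destruct K as [u1 [d' [K0 [K1 K2]]]].
  - now apply Rmin_pos.
  - intros t Ht.
    assert (Ht1 := Rlt_le_trans _ _ _ Ht (Rmin_l _ _)).
    assert (Ht2 := Rlt_le_trans _ _ _ Ht (Rmin_r _ _)).
    destruct (is_path_derive_comp F g t (F1 (g t)) om) as [D1 D2].
    + apply HF. unfold cball. now rewrite Hg.
    + apply line_derive.
    + split; [ exact D1 | split; [ exact D2 | ] ].
      rewrite <- Hg in Ht2. specialize (Hnz _ Ht2).
      assert (Hp : 0 < Cmod (F (g t))).
      { assert (T := Cmod_sub_ge (F z) (F z - F (g t))).
        replace (F z - (F z - F (g t)))%C with (F (g t)) in T by ring.
        rewrite (Cmod_sub_sym (F z)) in T. lra. }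
      assert (E := pow_lt _ 2 Hp). rewrite Cmod2_alt in E. cbv beta. lra.
  - exact (proj1 D).
  - exact (proj2 D).
  - exists u1, d'. auto.
Qed.

(** * A negatively curved metric on the twice punctured plane *)

(** Harmonicity of ln |F|: the second derivatives in the directions 1 and Ci cancel. The slopes p
    and p' are Re (F1 / F) and - Im (F1 / F) at z, whence the sum of their squares. *)
Lemma jet2_ln_Cmod_pair (F F1 : C -> C) (F2 z : C) (d : R) : 0 < d ->
  (forall w, cball z d w -> is_cderive F w (F1 w)) -> is_cderive F1 z F2 -> F z <> 0%C ->
  exists p p' q,
    jet2 (fun t => ln (Cmod (F (z + 1 * RtoC t)%C))) p q /\
    jet2 (fun t => ln (Cmod (F (z + Ci * RtoC t)%C))) p' (- q) /\
    p * p + p' * p' = (Cmod (F1 z) * Cmod (F1 z)) / (Cmod (F z) * Cmod (F z)).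
Proof.
  intros Hd HF HF1 Hz.
  assert (K1 := jet2_ln_Cmod F F1 F2 z 1 d Hd Cmod_1 HF HF1 Hz).
  assert (K2 := jet2_ln_Cmod F F1 F2 z Ci d Hd Cmod_Ci HF HF1 Hz).
  assert (HN : 0 < Re (F z) * Re (F z) + Im (F z) * Im (F z)).
  { assert (E := pow_lt _ 2 (proj1 (Cmod_gt_0 _) Hz)). rewrite Cmod2_alt in E. lra. }
  assert (E1 := Cmod2_alt (F1 z)). assert (E := Cmod2_alt (F z)).
  simpl pow in E1, E. rewrite !Rmult_1_r in E1, E.
  cbv zeta in K1, K2.
  match type of K1 with jet2 _ ?p ?q => exists p; exists (
    match F1 z with (a, b) => (- Re (F z) * b + Im (F z) * a) /
      (Re (F z) * Re (F z) + Im (F z) * Im (F z)) end), q end.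
  rewrite E1, E. clear E1 E.
  split; [ exact K1 | split ].
  - match type of K2 with jet2 _ ?p ?q =>
      match goal with |- jet2 _ ?p' ?q' =>
        replace p' with p; [ replace q' with q; [ exact K2 | ] | ] end end;
    clear K1 K2; revert HN; destruct (F z) as [x y], (F1 z) as [a b], F2 as [m n]; simpl;
    intros HN; field; lra.
  - clear K1 K2; revert HN; destruct (F z) as [x y], (F1 z) as [a b], F2 as [m n]; simpl;
    intros HN; field; lra.
Qed.

(* The metric is [exp (met (ln |w|) + met (ln |w - 1|))]. *)
Definition met (s : R) : R := - s / 2 - ln (ln (1 + exp (s / 2))) / 2.

Definition met1 (s : R) : R :=
  - 1 / 2 - exp (s / 2) / (4 * (1 + exp (s / 2)) * ln (1 + exp (s / 2))).

Definition met2 (s : R) : R :=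
  let x := exp (s / 2) in let L := ln (1 + x) in
  x * (x - L) / (8 * ((1 + x) * (1 + x)) * (L * L)).

Lemma ln_1p_pos (x : R) : 0 < x -> 0 < ln (1 + x).
Proof.
  intros Hx. rewrite <- ln_1. apply ln_increasing; lra.
Qed.

Lemma met_derive (s : R) : is_derive met s (met1 s).
Proof.
  assert (H := exp_pos (s / 2)). assert (HL := ln_1p_pos _ H).
  unfold met, met1. auto_derive.
  - unfold Rdiv in *. repeat split; lra.
  - unfold Rdiv in *. field. lra.
Qed.

Lemma met1_derive (s : R) : is_derive met1 s (met2 s).
Proof.
  assert (H := exp_pos (s / 2)). assert (HL := ln_1p_pos _ H).
  unfold met1, met2. auto_derive.
  - unfold Rdiv in *. repeat split; try lra. apply Rgt_not_eq. nra.
  - unfold Rdiv in *. field. lra.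
Qed.

Lemma ln_le_minus_1 (x : R) : 0 < x -> ln x <= x - 1.
Proof.
  intros Hx. assert (H := exp_ineq1_le (ln x)). rewrite exp_ln in H; lra.
Qed.

Lemma ln_1p_le (x : R) : 0 < x -> ln (1 + x) <= x.
Proof.
  intros Hx. assert (H := ln_le_minus_1 (1 + x)). lra.
Qed.

Lemma ln_1p_ge (x : R) : 0 < x -> x / (1 + x) <= ln (1 + x).
Proof.
  intros Hx. assert (H := ln_le_minus_1 (/ (1 + x)) ltac:(apply Rinv_0_lt_compat; lra)).
  rewrite ln_Rinv in H by lra.
  replace (x / (1 + x)) with (1 - / (1 + x)) by (field; lra). lra.
Qed.

(** With s = sqrt (1 + x), ln (1 + x) = 2 ln s <= 2 (s - 1), so the right side is at least (s - 1)^2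
    = x^2 / (s + 1)^2, and s + 1 <= 2 s. *)
Lemma sub_ln_1p_ge (x : R) : 0 < x -> x * x / (4 * (1 + x)) <= x - ln (1 + x).
Proof.
  intros Hx. set (s := sqrt (1 + x)).
  assert (Hs0 : 0 < s) by (apply sqrt_lt_R0; lra).
  assert (Hss : s * s = 1 + x) by (apply sqrt_sqrt; lra).
  assert (Hs1 : 1 < s) by nra.
  assert (Hl := ln_le_minus_1 s Hs0).
  rewrite <- Hss, ln_mult by assumption.
  assert (Hk : x * x / (4 * (s * s)) <= (s - 1) * (s - 1)).
  { apply Rmult_le_reg_r with (4 * (s * s)); [ nra | ].
    replace (x * x / (4 * (s * s)) * (4 * (s * s))) with (x * x) by (field; lra).
    replace (x * x) with ((s - 1) * (s - 1) * ((s + 1) * (s + 1)))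
      by (replace x with (s * s - 1) by lra; ring).
    apply Rmult_le_compat_l; nra. }
  nra.
Qed.

(* [met2 (ln (x^2))] is [curv x] divided by [8 (ln (1 + x))^2]. *)
Definition curv (x : R) : R := x * (x - ln (1 + x)) / ((1 + x) * (1 + x)).

Lemma curv_ge (x : R) : 0 < x ->
  (x / (1 + x)) * (x / (1 + x)) * (x / (1 + x)) / 4 <= curv x.
Proof.
  intros Hx. assert (H := sub_ln_1p_ge x Hx). unfold curv.
  replace (x / (1 + x) * (x / (1 + x)) * (x / (1 + x)) / 4) with
    (x * (x * x / (4 * (1 + x))) / ((1 + x) * (1 + x))) by (field; lra).
  apply Rmult_le_compat_r; [ left; apply Rinv_0_lt_compat; nra | ].
  apply Rmult_le_compat_l; lra.
Qed.

(** Here x / (1 + x) >= 1/3, and 1/108 is a quarter of (1/3)^3. *)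
Lemma curv_large (x : R) : / 2 <= x -> / 108 <= curv x.
Proof.
  intros Hx. eapply Rle_trans; [ | apply curv_ge; lra ].
  assert (H : / 3 <= x / (1 + x)).
  { apply Rmult_le_reg_r with (1 + x); [ lra | ].
    replace (x / (1 + x) * (1 + x)) with x by (field; lra). lra. }
  assert (/ 9 <= x / (1 + x) * (x / (1 + x))) by nra. nra.
Qed.

(** At 0 [curv] decays like x^3, but so does x^2 ln (1 + x), and the quotient keeps a positive lower
    bound. The value 2/27 is a quarter of (2/3)^3, from x / (1 + x) >= 2 x / 3. *)
Lemma curv_small (x : R) : 0 < x <= / 2 -> 2 / 27 <= curv x * / (x * x * ln (1 + x)).
Proof.
  intros Hx. assert (HL := ln_1p_pos x ltac:(lra)). assert (HL2 := ln_1p_le x ltac:(lra)).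
  assert (Hq : 2 / 3 * x <= x / (1 + x)).
  { apply Rmult_le_reg_r with (1 + x); [ lra | ].
    replace (x / (1 + x) * (1 + x)) with x by (field; lra). nra. }
  assert (H := curv_ge x ltac:(lra)).
  assert (Hxx : 0 < x * x) by nra.
  assert (Hc : 2 / 27 * (x * x * x) <= curv x).
  { assert (2 / 3 * x * (2 / 3 * x) <= x / (1 + x) * (x / (1 + x))) by nra.
    assert (2 / 3 * x * (2 / 3 * x) * (2 / 3 * x) <= x / (1 + x) * (x / (1 + x)) * (x / (1 + x)))
      by (apply Rmult_le_compat; nra).
    lra. }
  assert (Hp : 0 < x * x * ln (1 + x)) by nra.
  apply Rmult_le_reg_r with (x * x * ln (1 + x)); [ exact Hp | ].
  replace (curv x * / (x * x * ln (1 + x)) * (x * x * ln (1 + x))) with (curv x)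
    by (field; lra).
  eapply Rle_trans; [ | exact Hc ]. nra.
Qed.

(** For x^2 = |w| and y^2 = |w - 1|, al and be are the squares of the two factors of the density.
    The larger variable y is at least 1/2. If x is too, both values of [curv] are at least 1/108,
    and al be is dominated by al^2 + be^2. If x is small, the bound 12 on be turns al be into a
    multiple of al, which [curv_small] controls. The constant 2000 leaves room in both cases. *)
Lemma curvature_aux (x y : R) : 0 < x -> 0 < y -> 1 <= x * x + y * y -> x <= y ->
  let al := / (x * x * ln (1 + x)) in let be := / (y * y * ln (1 + y)) in
  al * be / 2000 <= curv x * (al * al) / 8 + curv y * (be * be) / 8.
Proof.
  intros Hx Hy Hxy Hle al be.
  assert (Hy2 : / 2 <= y) by nra.
  assert (HLx := ln_1p_pos x Hx). assert (HLy := ln_1p_pos y Hy).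
  assert (Hal : 0 < al) by (apply Rinv_0_lt_compat; repeat apply Rmult_lt_0_compat; lra).
  assert (Hbe : 0 < be) by (apply Rinv_0_lt_compat; repeat apply Rmult_lt_0_compat; lra).
  assert (Hcy := curv_large y Hy2).
  assert (Hcx : x <= / 2 -> 2 / 27 <= curv x * al) by (intros Hx2; apply curv_small; lra).
  assert (Hb : be <= 12).
  { unfold be. replace 12 with (/ (/ 12)) by field. apply Rinv_le_contravar; [ lra | ].
    assert (H3 := ln_1p_ge y Hy).
    assert (/ 3 <= y / (1 + y)).
    { apply Rmult_le_reg_r with (1 + y); [ lra | ].
      replace (y / (1 + y) * (1 + y)) with y by (field; lra). lra. }
    assert (/ 4 <= y * y) by nra.
    assert (/ 4 * / 3 <= y * y * ln (1 + y)) by (apply Rmult_le_compat; lra). lra. }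
  clearbody al be.
  assert (Hbb : 0 < be * be) by (apply Rmult_lt_0_compat; lra).
  assert (Haa : 0 < al * al) by (apply Rmult_lt_0_compat; lra).
  assert (Hab : 0 < al * be) by (apply Rmult_lt_0_compat; lra).
  assert (Hy3 : / 108 * (be * be) <= curv y * (be * be)) by (apply Rmult_le_compat_r; lra).
  destruct (Rle_lt_dec (/ 2) x) as [Hx2 | Hx2].
  - assert (Hx3 := curv_large x Hx2).
    assert (/ 108 * (al * al) <= curv x * (al * al)) by (apply Rmult_le_compat_r; lra).
    assert (Hsq := Rle_0_sqr (al - be)). unfold Rsqr in Hsq. lra.
  - specialize (Hcx ltac:(lra)).
    assert (2 / 27 * al <= curv x * al * al) by (apply Rmult_le_compat_r; lra).
    assert (al * be <= al * 12) by (apply Rmult_le_compat_l; lra).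
    lra.
Qed.

(** For X = |w| and Y = |w - 1| the right side is the Laplacian of u = met (ln |w|) + met (ln |w -
    1|), because ln |w| is harmonic with squared gradient 1 / |w|^2. That it is at least exp (2 u) /
    2000 says that the metric has curvature at most -1/2000. *)
Lemma curvature_bound (X Y : R) : 0 < X -> 0 < Y -> 1 <= X + Y ->
  exp (2 * (met (ln X) + met (ln Y))) / 2000 <= met2 (ln X) / (X * X) + met2 (ln Y) / (Y * Y).
Proof.
  intros HX HY H.
  assert (Hsq : forall Z, 0 < Z -> exp (ln Z / 2) * exp (ln Z / 2) = Z).
  { intros Z HZ. rewrite <- exp_plus. replace (ln Z / 2 + ln Z / 2) with (ln Z) by field.
    now apply exp_ln. }
  assert (Hphi : forall Z, 0 < Z -> exp (2 * met (ln Z)) = / (Z * ln (1 + exp (ln Z / 2)))).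
  { intros Z HZ. unfold met. assert (Hl := ln_1p_pos _ (exp_pos (ln Z / 2))).
    replace (2 * (- ln Z / 2 - ln (ln (1 + exp (ln Z / 2))) / 2))
      with (- (ln Z + ln (ln (1 + exp (ln Z / 2))))) by field.
    rewrite exp_Ropp, exp_plus, !exp_ln by assumption. reflexivity. }
  replace (2 * (met (ln X) + met (ln Y))) with (2 * met (ln X) + 2 * met (ln Y)) by ring.
  rewrite exp_plus, !Hphi by assumption.
  set (x := exp (ln X / 2)). set (y := exp (ln Y / 2)).
  assert (Hx : 0 < x) by apply exp_pos. assert (Hy : 0 < y) by apply exp_pos.
  assert (EX : X = x * x) by (symmetry; now apply Hsq).
  assert (EY : Y = y * y) by (symmetry; now apply Hsq).
  assert (HLx := ln_1p_pos x Hx). assert (HLy := ln_1p_pos y Hy).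
  assert (P1 : met2 (ln X) / (X * X) =
    curv x * (/ (x * x * ln (1 + x)) * / (x * x * ln (1 + x))) / 8).
  { unfold met2, curv. fold x. rewrite EX. field. lra. }
  assert (P2 : met2 (ln Y) / (Y * Y) =
    curv y * (/ (y * y * ln (1 + y)) * / (y * y * ln (1 + y))) / 8).
  { unfold met2, curv. fold y. rewrite EY. field. lra. }
  rewrite P1, P2, EX, EY.
  assert (Hxy : 1 <= x * x + y * y) by lra.
  destruct (Rle_lt_dec x y) as [Hl | Hl].
  - now apply curvature_aux.
  - assert (K := curvature_aux y x Hy Hx ltac:(lra) ltac:(lra)). cbv zeta in K.
    rewrite (Rmult_comm (/ (y * y * ln (1 + y)))) in K at 1. lra.
Qed.

(** Both |w| and |w - 1| are at most |w| + 1, and so are their square roots. Each factor of the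
    density is thus compared with the same quantity, and the two halves in [met] add up. *)
Lemma metric_ge (w : C) : w <> 0%C -> w <> 1%C ->
  / ((2 + Cmod w) * ln (2 + Cmod w)) <= exp (met (ln (Cmod w)) + met (ln (Cmod (w - 1)%C))).
Proof.
  intros H0 H1.
  assert (HX : 0 < Cmod w) by now apply Cmod_gt_0.
  assert (HY : 0 < Cmod (w - 1)%C).
  { apply Cmod_gt_0. intros E. apply H1. replace w with (w - 1 + 1)%C by ring. rewrite E. ring. }
  assert (HYX : Cmod (w - 1)%C <= Cmod w + 1).
  { unfold Cminus. eapply Rle_trans; [ apply Cmod_triangle | ].
    rewrite Cmod_opp, Cmod_1. lra. }
  set (X := Cmod w) in *. set (Y := Cmod (w - 1)%C) in *.
  assert (HL : 0 < ln (2 + X)) by (rewrite <- ln_1; apply ln_increasing; lra).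
  assert (Hexp : forall Z, 0 < Z -> Z <= X + 1 ->
    - (ln Z + ln (ln (2 + X))) / 2 <= met (ln Z)).
  { intros Z HZ HZX. unfold met. assert (Hp := exp_pos (ln Z / 2)).
    assert (Hl := ln_1p_pos _ Hp).
    assert (Hle : ln (ln (1 + exp (ln Z / 2))) <= ln (ln (2 + X))).
    { apply ln_le; [ exact Hl | ]. apply ln_le; [ lra | ].
      assert (exp (ln Z / 2) * exp (ln Z / 2) = Z).
      { rewrite <- exp_plus. replace (ln Z / 2 + ln Z / 2) with (ln Z) by field.
        now apply exp_ln. }
      nra. }
    lra. }
  assert (HlX : ln X <= ln (2 + X)) by (apply ln_le; lra).
  assert (HlY : ln Y <= ln (2 + X)) by (apply ln_le; lra).
  assert (KX := Hexp X HX ltac:(lra)). assert (KY := Hexp Y HY ltac:(lra)).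
  replace (/ ((2 + X) * ln (2 + X))) with (exp (- (ln (2 + X) + ln (ln (2 + X)))))
    by (rewrite exp_Ropp, exp_plus, !exp_ln by lra; reflexivity).
  destruct (Req_dec (- (ln (2 + X) + ln (ln (2 + X)))) (met (ln X) + met (ln Y))) as [-> | Hne];
    [ lra | ].
  left. apply exp_increasing. lra.
Qed.

(** * The Ahlfors-Schwarz lemma *)

Lemma continuous_Cmod_comp (g : C -> C) (z : C) : ccontinuous g z ->
  continuous (T := C_UniformSpace) (U := R_UniformSpace) (fun w => Cmod (g w)) z.
Proof.
  intros Hg P [e HP]. apply locally_cball.
  destruct (Hg e (cond_pos e)) as [d [Hd H]].
  exists d; split; [ exact Hd | ]. intros w Hw. apply HP.
  specialize (H w Hw). change (Rabs (Cmod (g w) - Cmod (g z)) < e).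
  assert (T1 := Cmod_sub_ge (g w) (g z)). assert (T2 := Cmod_sub_ge (g z) (g w)).
  rewrite Cmod_sub_sym in T2. apply Rabs_lt_between. lra.
Qed.

Lemma is_cderive_minus_const (f : C -> C) (z l k : C) :
  is_cderive f z l -> is_cderive (fun w => f w - k)%C z l.
Proof.
  intros H eps He. destruct (H eps He) as [d [Hd Hw]]. exists d; split; auto.
  intros w Hwd. replace (f w - k - (f z - k) - l * (w - z))%C with (f w - f z - l * (w - z))%C by ring.
  auto.
Qed.

Lemma cball_sub (c z w : C) (r d : R) : Cmod (z - c)%C + d <= r -> cball z d w -> cball c r w.
Proof.
  unfold cball. intros H Hw. assert (T := Cmod_sub_triangle w z c). lra.
Qed.

Lemma derivative_choice (c : C) (r : R) (f f1 : C -> C) :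
  (forall z, cball c r z -> is_cderive f z (f1 z)) ->
  exists f2, forall z, cball c r z -> is_cderive f1 z (f2 z).
Proof.
  intros Hd.
  destruct (choice (fun z l => cball c r z -> is_cderive f1 z l)) as [f2 Hf2]; [ | eauto ].
  intros z. destruct (classic (cball c r z)) as [Hz | Hz].
  - destruct (derivative_holomorphic c r f f1 z Hd Hz) as [l Hl]. eauto.
  - exists 0%C. intros; contradiction.
Qed.

Section Ahlfors.

Variables (c : C) (r s : R) (f f1 : C -> C).
Hypothesis Hs : 0 < s < r.
Hypothesis Hd : forall z, cball c r z -> is_cderive f z (f1 z).
Hypothesis Hf_0 : forall z, cball c r z -> f z <> 0%C.
Hypothesis Hf_1 : forall z, cball c r z -> f z <> 1%C.

Let dens (z : C) : R := exp (met (ln (Cmod (f z))) + met (ln (Cmod (f z - 1)%C))).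

(** Ahlfors' comparison function. Its weight vanishes on the circle |z - c| = s, so a positive
    maximum over the closed disc is attained in the interior and is a local maximum along every
    line. *)
Let v (z : C) : R := (s * s - Cmod (z - c)%C * Cmod (z - c)%C) * Cmod (f1 z) * dens z.

Lemma f_minus_1_nonzero (z : C) : cball c r z -> (f z - 1)%C <> 0%C.
Proof.
  intros Hz E. apply (Hf_1 z Hz). replace (f z) with (f z - 1 + 1)%C by ring. rewrite E. ring.
Qed.

Lemma Ahlfors_function_continuous (z : C) : cball c r z ->
  continuous (T := C_UniformSpace) (U := R_UniformSpace) v z.
Proof.
  intros Hz.
  assert (Hf := is_cderive_continuous _ _ _ (Hd z Hz)).
  assert (Hf' := is_cderive_continuous _ _ _ (is_cderive_minus_const _ _ _ 1 (Hd z Hz))).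
  assert (Hf1 := derivative_continuous c r f f1 z Hd Hz).
  assert (Hid : ccontinuous (fun w => w - c)%C z).
  { intros eps He. exists eps; split; [ exact He | ]. intros w Hw.
    now replace (w - c - (z - c))%C with (w - z)%C by ring. }
  assert (Hcomp : forall (h : R -> R) (g : C -> C), continuous h (Cmod (g z)) -> ccontinuous g z ->
    continuous (T := C_UniformSpace) (U := R_UniformSpace) (fun w => h (Cmod (g w))) z).
  { intros h g Hh Hg. apply (continuous_comp (fun w => Cmod (g w)) h); [ | exact Hh ].
    now apply continuous_Cmod_comp. }
  assert (Hphi : forall X, 0 < X -> continuous (fun X => met (ln X)) X).
  { intros X HX. apply (ex_derive_continuous (V := R_NormedModule)).
    apply (ex_derive_comp (V := R_NormedModule) met ln).
    - eexists. apply met_derive.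
    - auto_derive. exact HX. }
  unfold v, dens.
  apply (continuous_mult (K := R_AbsRing)); [ apply (continuous_mult (K := R_AbsRing)) | ].
  - apply (continuous_minus (V := R_NormedModule)); [ apply continuous_const | ].
    apply (continuous_mult (K := R_AbsRing)); now apply continuous_Cmod_comp.
  - now apply continuous_Cmod_comp.
  - apply (continuous_comp (fun w => met (ln (Cmod (f w))) + met (ln (Cmod (f w - 1)%C))) exp).
    + apply (continuous_plus (V := R_NormedModule)).
      * apply (Hcomp (fun X => met (ln X)) f); [ | exact Hf ].
        apply Hphi, Cmod_gt_0. auto.
      * apply (Hcomp (fun X => met (ln X)) (fun w => f w - 1)%C); [ | exact Hf' ].
        apply Hphi, Cmod_gt_0, f_minus_1_nonzero. auto.
    + apply (ex_derive_continuous (V := R_NormedModule)). auto_derive. auto.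
Qed.

Lemma Cmod_line_sq (p om : C) (t : R) : Cmod om = 1 ->
  Cmod (p + om * RtoC t)%C * Cmod (p + om * RtoC t)%C
  = Cmod p * Cmod p + 2 * (Re p * Re om + Im p * Im om) * t + t * t.
Proof.
  intros Hom. assert (E := Cmod2_alt om). rewrite Hom in E.
  assert (E1 := Cmod2_alt p). assert (E2 := Cmod2_alt (p + om * RtoC t)%C).
  simpl pow in *. rewrite !Rmult_1_r in *. rewrite E1, E2.
  destruct p as [x y], om as [a b]; simpl in *.
  transitivity (x * x + y * y + 2 * (x * a + y * b) * t + (a * a + b * b) * (t * t)); [ ring | ].
  rewrite <- E. ring.
Qed.

(** The second derivatives of ln v at p in the directions 1 and Ci are added. The term ln |f1|
    cancels, the weight gives -4 s^2 / al^2, and by [curvature_bound] the density gives at least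
    |f1|^2 dens^2 / 2000. Nonpositivity of the sum yields (v p)^2 <= 8000 s^2, and 8000 < 90^2. *)
Lemma Ahlfors_max (p : C) : Cmod (p - c)%C <= s -> 0 < v p ->
  (forall z, Cmod (z - c)%C <= s -> v z <= v p) -> v p <= 90 * s.
Proof.
  intros Hp Hv Hmax.
  assert (Hpr : cball c r p) by (unfold cball; lra).
  assert (Hdens : forall z, 0 < dens z) by (intros z; apply exp_pos).
  set (al := s * s - Cmod (p - c)%C * Cmod (p - c)%C).
  assert (Hpos : forall z, Cmod (z - c)%C <= s -> 0 < v z ->
    0 < s * s - Cmod (z - c)%C * Cmod (z - c)%C /\ 0 < Cmod (f1 z)).
  { intros z Hz Hvz. unfold v in Hvz. specialize (Hdens z).
    assert (P1 := Cmod_ge_0 (z - c)). assert (P2 := Cmod_ge_0 (f1 z)).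
    assert (P3 : 0 <= s * s - Cmod (z - c)%C * Cmod (z - c)%C) by nra.
    split.
    - destruct P3 as [P3 | P3]; [ exact P3 | ]. rewrite <- P3 in Hvz. lra.
    - destruct P2 as [P2 | P2]; [ exact P2 | ]. rewrite <- P2 in Hvz. lra. }
  destruct (Hpos p Hp Hv) as [Hal Hf1p]. fold al in Hal.
  assert (Hps : Cmod (p - c)%C < s) by (unfold al in Hal; assert (P := Cmod_ge_0 (p - c)); nra).
  destruct (derivative_choice c r f f1 Hd) as [f2 Hf2].
  (* The third derivative of f enters because ln |f1| is differentiated twice. *)
  destruct (derivative_holomorphic c r f1 f2 p Hf2 Hpr) as [F3 HF3].
  set (d := s - Cmod (p - c)%C).
  assert (Hdp : 0 < d) by (unfold d; lra).
  assert (Hsub : forall w, cball p d w -> cball c r w)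
    by (intros w; apply cball_sub; unfold d; lra).
  assert (Hsub' : forall w, cball p d w -> Cmod (w - c)%C <= s).
  { intros w Hw. unfold cball in Hw. assert (T := Cmod_sub_triangle w p c). unfold d in Hw. lra. }
  destruct (jet2_ln_Cmod_pair f1 f2 F3 p d) as [p3 [p3' [q3 [J3 [J3' _]]]]]; auto.
  { now apply Cmod_gt_0. }
  destruct (jet2_ln_Cmod_pair f f1 (f2 p) p d) as [p1 [p1' [q1 [J1 [J1' E1]]]]]; auto.
  destruct (jet2_ln_Cmod_pair (fun w => f w - 1)%C f1 (f2 p) p d) as [p2 [p2' [q2 [J2 [J2' E2]]]]];
    auto using is_cderive_minus_const, f_minus_1_nonzero.
  (* Positivity persists near p, so that ln v makes sense along short segments through p. *)
  assert (Hvp : exists e, 0 < e /\ forall w, cball p e w -> 0 < v w).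
  { assert (Hl : locally p (fun w => Rabs (v w - v p) < v p)).
    { apply (Ahlfors_function_continuous p Hpr (fun y => Rabs (y - v p) < v p)).
      exists (mkposreal _ Hv). intros y Hy. exact Hy. }
    apply locally_cball in Hl. destruct Hl as [e [He Hl]].
    exists e; split; [ exact He | ]. intros w Hw. specialize (Hl w Hw).
    apply Rabs_lt_between in Hl. lra. }
  destruct Hvp as [e [He Hve]].
  (* The second-derivative test for ln v along the line through p in direction om, with generic jets
     so that it serves both directions. *)
  assert (Hline : forall om p3 q3 p1 q1 p2 q2, Cmod om = 1 ->
    jet2 (fun t => ln (Cmod (f1 (p + om * RtoC t)%C))) p3 q3 ->
    jet2 (fun t => ln (Cmod (f (p + om * RtoC t)%C))) p1 q1 ->
    jet2 (fun t => ln (Cmod (f (p + om * RtoC t) - 1)%C)) p2 q2 ->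
    - 2 / al - (2 * (Re (p - c)%C * Re om + Im (p - c)%C * Im om)
                * (2 * (Re (p - c)%C * Re om + Im (p - c)%C * Im om))) / (al * al) + q3
    + (met2 (ln (Cmod (f p))) * (p1 * p1) + met1 (ln (Cmod (f p))) * q1
       + (met2 (ln (Cmod (f p - 1)%C)) * (p2 * p2) + met1 (ln (Cmod (f p - 1)%C)) * q2)) <= 0).
  { clear p3 p3' q3 J3 J3' p1 p1' q1 J1 J1' E1 p2 p2' q2 J2 J2' E2.
    intros om p3 q3 p1 q1 p2 q2 Hom J3 J1 J2.
    set (be := 2 * (Re (p - c)%C * Re om + Im (p - c)%C * Im om)).
    assert (Z0 : (p + om * RtoC 0)%C = p) by ring.
    apply (jet2_comp met met1 _ _ _ (met2 (ln (Cmod (f p))))) in J1;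
      [ | apply met_derive | rewrite Z0; apply met1_derive ].
    apply (jet2_comp met met1 _ _ _ (met2 (ln (Cmod (f p - 1)%C)))) in J2;
      [ | apply met_derive | rewrite Z0; apply met1_derive ].
    cbv beta in J1, J2. rewrite Z0 in J1, J2.
    assert (J := jet2_plus _ _ _ _ _ _ (jet2_plus _ _ _ _ _ _ (jet2_ln_quadratic al be Hal) J3)
                   (jet2_plus _ _ _ _ _ _ J1 J2)).
    cbv beta in J. revert J. apply (jet2_max _ _ _ (Rmin d e)); [ now apply Rmin_pos | ].
    intros t Ht.
    assert (Ht1 := Rlt_le_trans _ _ _ Ht (Rmin_l _ _)).
    assert (Ht2 := Rlt_le_trans _ _ _ Ht (Rmin_r _ _)).
    assert (Hdist : Cmod (p + om * RtoC t - p)%C = Rabs t).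
    { replace (p + om * RtoC t - p)%C with (om * RtoC t)%C by ring.
      rewrite Cmod_mult, Hom, Cmod_R. ring. }
    assert (Hw : cball p d (p + om * RtoC t)%C) by (unfold cball; now rewrite Hdist).
    assert (Hw' : cball p e (p + om * RtoC t)%C) by (unfold cball; now rewrite Hdist).
    (* Comparing exponentials turns the maximality of v into that of the sum of logarithms. *)
    assert (Hlnv : forall t, cball p d (p + om * RtoC t)%C -> 0 < v (p + om * RtoC t)%C ->
       exp (ln (al - be * t - t * t) + ln (Cmod (f1 (p + om * RtoC t)%C))
         + (met (ln (Cmod (f (p + om * RtoC t)%C))) + met (ln (Cmod (f (p + om * RtoC t) - 1)%C))))
       = v (p + om * RtoC t)%C).
    { clear t Ht Ht1 Ht2 Hdist Hw Hw'. intros t Hw Hvw.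
      destruct (Hpos _ (Hsub' _ Hw) Hvw) as [Q1 Q2].
      assert (EQ : s * s - Cmod (p + om * RtoC t - c)%C * Cmod (p + om * RtoC t - c)%C
                   = al - be * t - t * t).
      { replace (p + om * RtoC t - c)%C with ((p - c) + om * RtoC t)%C by ring.
        rewrite Cmod_line_sq by exact Hom. unfold al, be. ring. }
      unfold v. rewrite EQ. rewrite EQ in Q1.
      rewrite exp_plus, exp_plus, !exp_ln by assumption. reflexivity. }
    assert (Hv0 : 0 < v (p + om * RtoC 0)%C) by (rewrite Z0; exact Hv).
    assert (Hb0 : cball p d (p + om * RtoC 0)%C).
    { rewrite Z0. unfold cball. replace (p - p)%C with (RtoC 0) by ring. rewrite Cmod_0. exact Hdp. }
    assert (Ea := Hlnv t Hw (Hve _ Hw')). assert (Eb := Hlnv 0 Hb0 Hv0).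
    assert (Hle := Hmax _ (Hsub' _ Hw)).
    rewrite <- Z0 in Hle at 2. rewrite <- Ea, <- Eb in Hle.
    apply Rnot_lt_le. intros Hlt. apply exp_increasing in Hlt. lra. }
  assert (L1 := Hline 1%C _ _ _ _ _ _ Cmod_1 J3 J1 J2).
  assert (L2 := Hline Ci _ _ _ _ _ _ Cmod_Ci J3' J1' J2').
  clear Hline.
  assert (Hfp : 0 < Cmod (f p)) by (apply Cmod_gt_0; auto).
  assert (Hfp1 : 0 < Cmod (f p - 1)%C) by (apply Cmod_gt_0, f_minus_1_nonzero; auto).
  assert (Hcurv : exp (2 * (met (ln (Cmod (f p))) + met (ln (Cmod (f p - 1)%C)))) / 2000 <=
    met2 (ln (Cmod (f p))) / (Cmod (f p) * Cmod (f p))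
    + met2 (ln (Cmod (f p - 1)%C)) / (Cmod (f p - 1)%C * Cmod (f p - 1)%C)).
  { apply curvature_bound; auto.
    assert (T := Cmod_triangle (f p) (- (f p - 1))%C). rewrite Cmod_opp in T.
    replace (f p + - (f p - 1))%C with (RtoC 1) in T by ring. rewrite Cmod_1 in T. exact T. }
  replace (exp (2 * (met (ln (Cmod (f p))) + met (ln (Cmod (f p - 1)%C))))) with (dens p * dens p)
    in Hcurv by (unfold dens; rewrite <- exp_plus; f_equal; ring).
  set (A1 := met2 (ln (Cmod (f p)))) in *. set (A2 := met2 (ln (Cmod (f p - 1)%C))) in *.
  set (B1 := met1 (ln (Cmod (f p)))) in *. set (B2 := met1 (ln (Cmod (f p - 1)%C))) in *.
  (* The multiples of B1 and B2 cancel as well, since the second derivatives of ln |f| and of ln |f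
     - 1| in the two directions are opposite. *)
  assert (Hsum : A1 * (p1 * p1 + p1' * p1') + A2 * (p2 * p2 + p2' * p2')
     <= 4 * (s * s) / (al * al)).
  { assert (Hpc := Cmod2_alt (p - c)%C). rewrite <- !Rsqr_pow2 in Hpc. unfold Rsqr in Hpc.
    replace (4 * (s * s) / (al * al)) with
      (4 / al + 4 * (Re (p - c)%C * Re (p - c)%C + Im (p - c)%C * Im (p - c)%C) / (al * al)).
    - simpl Re in L1, L2. simpl Im in L1, L2.
      unfold Rdiv in *. simpl in *. lra.
    - rewrite <- Hpc. replace (s * s) with (al + Cmod (p - c)%C * Cmod (p - c)%C)
        by (unfold al; ring). field. lra. }
  rewrite E1, E2 in Hsum.
  assert (Hm : (Cmod (f1 p) * Cmod (f1 p)) * (dens p * dens p / 2000) <= 4 * (s * s) / (al * al)).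
  { eapply Rle_trans; [ | exact Hsum ].
    replace (A1 * (Cmod (f1 p) * Cmod (f1 p) / (Cmod (f p) * Cmod (f p))) +
       A2 * (Cmod (f1 p) * Cmod (f1 p) / (Cmod (f p - 1)%C * Cmod (f p - 1)%C))) with
      (Cmod (f1 p) * Cmod (f1 p) * (A1 / (Cmod (f p) * Cmod (f p)) +
        A2 / (Cmod (f p - 1)%C * Cmod (f p - 1)%C))) by (field; lra).
    apply Rmult_le_compat_l; [ nra | exact Hcurv ]. }
  assert (Hsq : v p * v p <= 8000 * (s * s)).
  { unfold v. fold al.
    apply (Rmult_le_compat_r (2000 * (al * al))) in Hm; [ | nra ].
    replace (4 * (s * s) / (al * al) * (2000 * (al * al))) with (8000 * (s * s)) in Hm
      by (field; lra).
    lra. }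
  apply Rnot_lt_le. intros Hlt. nra.
Qed.

Lemma Ahlfors (z : C) : Cmod (z - c)%C <= s ->
  (s * s - Cmod (z - c)%C * Cmod (z - c)%C) * Cmod (f1 z)
    * exp (met (ln (Cmod (f z))) + met (ln (Cmod (f z - 1)%C))) <= 90 * s.
Proof.
  intros Hz. change (v z <= 90 * s).
  destruct (closed_ball_argmax v c s) as [p [Hp Hmax]]; [ lra | | ].
  - intros w Hw. apply Ahlfors_function_continuous. unfold cball. lra.
  - apply Rle_trans with (v p); [ now apply Hmax | ].
    destruct (Rlt_le_dec 0 (v p)) as [Hv | Hv]; [ now apply Ahlfors_max | lra ].
Qed.

End Ahlfors.

(** * Growth and compactness *)

(** On the half disc the weight in Ahlfors' inequality is at least 3/4 s^2, and 90 divided by 3/4 is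
    120; [metric_ge] replaces the density by its lower bound. *)
Lemma derivative_bound (c : C) (r s : R) (f f1 : C -> C) (z : C) : 0 < s < r ->
  (forall z, cball c r z -> is_cderive f z (f1 z)) ->
  (forall z, cball c r z -> f z <> 0%C) -> (forall z, cball c r z -> f z <> 1%C) ->
  Cmod (z - c)%C <= s / 2 ->
  Cmod (f1 z) <= 120 / s * ((2 + Cmod (f z)) * ln (2 + Cmod (f z))).
Proof.
  intros Hs Hd H0 H1 Hz.
  assert (HA := Ahlfors c r s f f1 Hs Hd H0 H1 z ltac:(lra)).
  assert (Hzr : cball c r z) by (unfold cball; lra).
  assert (HM := metric_ge (f z) (H0 z Hzr) (H1 z Hzr)).
  assert (Hf := Cmod_ge_0 (f z)). assert (Hf1 := Cmod_ge_0 (f1 z)).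
  assert (HL : 0 < ln (2 + Cmod (f z))) by (rewrite <- ln_1; apply ln_increasing; lra).
  set (W := (2 + Cmod (f z)) * ln (2 + Cmod (f z))) in *.
  assert (HW : 0 < W) by (unfold W; apply Rmult_lt_0_compat; lra).
  clearbody W. assert (HWi : 0 < / W) by now apply Rinv_0_lt_compat.
  assert (Hq : 3 / 4 * (s * s) <= s * s - Cmod (z - c)%C * Cmod (z - c)%C)
    by (assert (P := Cmod_ge_0 (z - c)); nra).
  assert (K : 3 / 4 * (s * s) * Cmod (f1 z) * / W <= 90 * s).
  { eapply Rle_trans; [ | exact HA ]. apply Rmult_le_compat; [ | lra | | exact HM ].
    - apply Rmult_le_pos; nra.
    - apply Rmult_le_compat_r; assumption. }
  apply Rmult_le_reg_r with (3 / 4 * (s * s) * / W); [ apply Rmult_lt_0_compat; nra | ].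
  replace (120 / s * W * (3 / 4 * (s * s) * / W)) with (90 * s) by (field; lra). lra.
Qed.

Lemma Cmod_path_derive (g : R -> C) (t : R) (l : C) : is_path_derive g t l -> g t <> 0%C ->
  is_derive (fun t => Cmod (g t)) t ((Re (g t) * Re l + Im (g t) * Im l) / Cmod (g t)).
Proof.
  intros [H1 H2] Hg.
  assert (HN : 0 < Re (g t) * Re (g t) + Im (g t) * Im (g t)).
  { assert (E := pow_lt _ 2 (proj1 (Cmod_gt_0 _) Hg)). rewrite Cmod2_alt in E. lra. }
  assert (K1 := is_derive_mult _ _ _ _ _ H1 H1 Rmult_comm).
  assert (K2 := is_derive_mult _ _ _ _ _ H2 H2 Rmult_comm).
  assert (K := is_derive_plus (V := R_NormedModule) _ _ _ _ _ K1 K2).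
  assert (E : Cmod (g t) = sqrt (Re (g t) * Re (g t) + Im (g t) * Im (g t)))
    by (unfold Cmod; f_equal; unfold Re, Im; ring).
  assert (Hsq : is_derive sqrt (Re (g t) * Re (g t) + Im (g t) * Im (g t))
                  (/ (2 * sqrt (Re (g t) * Re (g t) + Im (g t) * Im (g t))))).
  { auto_derive; [ exact HN | ]. field. apply Rgt_not_eq, sqrt_lt_R0, HN. }
  apply (is_derive_ext (fun s => sqrt (Re (g s) * Re (g s) + Im (g s) * Im (g s)))).
  { intros s. unfold Cmod. f_equal. unfold Re, Im. ring. }
  eapply is_derive_value; [ exact (is_derive_comp (V := R_NormedModule) sqrt _ t _ _ Hsq K) | ].
  rewrite E. unfold scal, plus, mult; simpl. unfold mult; simpl.
  field. apply Rgt_not_eq, sqrt_lt_R0, HN.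
Qed.

(** Cauchy-Schwarz in the plane: the left side is the real part of [Cconj z * w]. *)
Lemma Re_Im_product_le (z w : C) : Re z * Re w + Im z * Im w <= Cmod z * Cmod w.
Proof.
  eapply Rle_trans; [ apply Rle_abs | ].
  rewrite <- (Cmod_conj z), <- Cmod_mult.
  eapply Rle_trans; [ | apply re_le_Cmod ]. right. f_equal.
  destruct z, w; simpl; ring.
Qed.

(* The metric bound makes [ln (ln (2 + |f|))] Lipschitz, which gives a Harnack-type inequality. *)
Lemma log_growth (c : C) (r s : R) (f f1 : C -> C) (z z' : C) : 0 < s < r ->
  (forall z, cball c r z -> is_cderive f z (f1 z)) ->
  (forall z, cball c r z -> f z <> 0%C) -> (forall z, cball c r z -> f z <> 1%C) ->
  Cmod (z - c)%C <= s / 2 -> Cmod (z' - c)%C <= s / 2 ->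
  ln (2 + Cmod (f z')) <= exp 120 * ln (2 + Cmod (f z)).
Proof.
  intros Hs Hd H0 H1 Hz Hz'.
  assert (HL : forall w, 0 < ln (2 + Cmod (f w))).
  { intros w. assert (P := Cmod_ge_0 (f w)). rewrite <- ln_1. apply ln_increasing; lra. }
  assert (Hseg : forall t, 0 <= t <= 1 -> Cmod (seg_pt z z' t - c)%C <= s / 2)
    by (intros t Ht; now apply seg_pt_dist).
  assert (Hb : forall t, 0 <= t <= 1 -> cball c r (seg_pt z z' t))
    by (intros t Ht; unfold cball; specialize (Hseg t Ht); lra).
  set (h := fun t => Cmod (f (seg_pt z z' t))).
  set (h1 := fun t => (Re (f (seg_pt z z' t)) * Re (f1 (seg_pt z z' t) * (z' - z))%C
    + Im (f (seg_pt z z' t)) * Im (f1 (seg_pt z z' t) * (z' - z))%C) / Cmod (f (seg_pt z z' t))).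
  assert (Hh : forall t, 0 <= t <= 1 -> is_derive h t (h1 t)).
  { intros t Ht. apply (Cmod_path_derive (fun t => f (seg_pt z z' t))); [ | auto ].
    apply is_path_derive_comp; [ auto | apply seg_pt_derive ]. }
  assert (Hh0 : forall t, 0 <= h t) by (intros t; apply Cmod_ge_0).
  assert (HLh : forall t, 0 < ln (2 + h t)) by (intros t; apply HL).
  destruct (MVT_cor2 (fun t => ln (ln (2 + h t))) (fun t => h1 t / ((2 + h t) * ln (2 + h t)))
              0 1 Rlt_0_1) as [t [E Ht]].
  { intros t Ht. apply is_derive_Reals. specialize (Hh t Ht).
    specialize (Hh0 t). specialize (HLh t).
    auto_derive.
    - repeat split; try (eexists; eassumption); lra.
    - change (Derive (fun x => h x) t) with (Derive h t).
      rewrite (is_derive_unique _ _ _ Hh). field. lra. }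
  (* The rate 120 / s is taken along a segment of length at most s. *)
  assert (Hbound : h1 t / ((2 + h t) * ln (2 + h t)) <= 120).
  { specialize (Hh0 t). specialize (HLh t).
    assert (Ht' : 0 <= t <= 1) by lra.
    assert (HW : 0 < (2 + h t) * ln (2 + h t)) by (apply Rmult_lt_0_compat; lra).
    assert (D := derivative_bound c r s f f1 _ Hs Hd H0 H1 (Hseg t Ht')).
    change (Cmod (f (seg_pt z z' t))) with (h t) in D.
    assert (Hzz : Cmod (z' - z)%C <= s).
    { assert (T := Cmod_sub_triangle z' c z). rewrite (Cmod_sub_sym c z) in T. lra. }
    assert (Hpos : 0 < Cmod (f (seg_pt z z' t))) by (apply Cmod_gt_0; auto).
    assert (Hh1 : h1 t <= Cmod (f1 (seg_pt z z' t)) * Cmod (z' - z)%C).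
    { rewrite <- Cmod_mult. unfold h1.
      apply Rmult_le_reg_r with (Cmod (f (seg_pt z z' t))); [ exact Hpos | ].
      unfold Rdiv. rewrite Rmult_assoc, Rinv_l, Rmult_1_r by lra.
      eapply Rle_trans; [ apply Re_Im_product_le | ]. right. ring. }
    apply Rmult_le_reg_r with ((2 + h t) * ln (2 + h t)); [ exact HW | ].
    unfold Rdiv. rewrite (Rmult_assoc (h1 t)), Rinv_l, Rmult_1_r by lra.
    eapply Rle_trans; [ exact Hh1 | ].
    apply Rle_trans with (120 / s * ((2 + h t) * ln (2 + h t)) * s).
    - apply Rmult_le_compat; try apply Cmod_ge_0; assumption.
    - right. field. lra. }
  assert (E0 : h 0 = Cmod (f z)) by (unfold h, seg_pt; do 2 f_equal; ring).
  assert (E1 : h 1 = Cmod (f z')) by (unfold h, seg_pt; do 2 f_equal; ring).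
  rewrite <- E0, <- E1.
  assert (Hle : ln (ln (2 + h 1)) <= 120 + ln (ln (2 + h 0))) by lra.
  rewrite <- (exp_ln (ln (2 + h 1))) by apply HLh.
  rewrite <- (exp_ln (ln (2 + h 0))) at 1 by apply HLh.
  rewrite <- exp_plus.
  destruct Hle as [Hlt | ->]; [ left; now apply exp_increasing | lra ].
Qed.

(** * Subsequences and the Arzela-Ascoli theorem *)

Definition strictly_increasing (phi : nat -> nat) : Prop := forall n, (phi n < phi (S n))%nat.

Lemma strictly_increasing_ge (phi : nat -> nat) (n : nat) :
  strictly_increasing phi -> (n <= phi n)%nat.
Proof.
  intros H. induction n as [ | n IH ]; [ lia | ]. specialize (H n). lia.
Qed.

Lemma strictly_increasing_comp (phi psi : nat -> nat) :
  strictly_increasing phi -> strictly_increasing psi ->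
  strictly_increasing (fun n => phi (psi n)).
Proof.
  intros Hphi Hpsi n.
  assert (Hm : forall a b, (a < b)%nat -> (phi a < phi b)%nat).
  { intros a b Hab. induction Hab as [ | b Hab IH ]; [ apply Hphi | ].
    specialize (Hphi b). lia. }
  apply Hm, Hpsi.
Qed.

Lemma subsequence_of_frequent (P : nat -> nat -> Prop) :
  (forall k N, exists n, (N <= n)%nat /\ P k n) ->
  exists phi, strictly_increasing phi /\ forall k, P k (phi k).
Proof.
  intros H.
  destruct (choice (fun kN n => (snd kN <= n)%nat /\ P (fst kN) n)) as [sel Hsel].
  { intros [k N]. apply H. }
  (* Asking for an index at least [S p] after p makes the selection strictly increasing. *)
  exists (nat_rec (fun _ => nat) (sel (O, O)) (fun k p => sel (S k, S p))). split.
  - intros n. simpl. match goal with |- (?p < sel ?q)%nat => destruct (Hsel q) as [K _] end.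
    simpl in K. lia.
  - intros [ | k ]; apply (Hsel (_, _)).
Qed.

(* Diagonal extraction: the limits [l k] are chosen one after the other so that
   [l 0, ..., l (k - 1)] is at each stage a joint cluster point. *)
Lemma diagonal_subsequence (a : nat -> nat -> C) (M : R) :
  (forall n k, Cmod (a n k) <= M) ->
  exists phi l, strictly_increasing phi /\
    forall k eps, 0 < eps -> exists N, forall n, (N <= n)%nat -> Cmod (a (phi n) k - l k)%C < eps.
Proof.
  intros HM.
  set (JC := fun (k : nat) (l : nat -> C) => forall eps N, 0 < eps ->
    exists n, (N <= n)%nat /\ forall j, (j < k)%nat -> Cmod (a n j - l j)%C < eps).
  set (upd := fun (l : nat -> C) (k : nat) (p : C) (j : nat) => if Nat.eq_dec j k then p else l j).
  (* Along indices that realise the joint cluster point ever more closely, the k-th coordinate has a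
     cluster point p; adjoining it keeps the cluster property joint. *)
  assert (Hstep : forall k l, exists p, JC k l -> JC (S k) (upd l k p)).
  { intros k l. destruct (classic (JC k l)) as [HJ | HJ]; [ | exists 0%C; intros; contradiction ].
    destruct (subsequence_of_frequent
      (fun m n => forall j, (j < k)%nat -> Cmod (a n j - l j)%C < / (INR m + 1)))
      as [psi [Hpsi HP]].
    { intros m N. apply HJ, inv_INR_pos. }
    destruct (bounded_seq_cluster (fun m => a (psi m) k) 0 M) as [p Hp].
    { intros m. replace (a (psi m) k - 0)%C with (a (psi m) k) by ring. apply HM. }
    exists p. intros _ eps N He.
    destruct (inv_INR_small eps He) as [N' HN'].
    destruct (Hp eps (max N N') He) as [m [Hm1 Hm2]].
    exists (psi m). split.
    - assert (Q := strictly_increasing_ge psi m Hpsi). lia.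
    - intros j Hj. unfold upd. destruct (Nat.eq_dec j k) as [-> | Hne]; [ exact Hm2 | ].
      eapply Rlt_trans; [ apply HP; lia | apply HN'; lia ]. }
  destruct (choice (fun kl p => JC (fst kl) (snd kl) -> JC (S (fst kl)) (upd (snd kl) (fst kl) p)))
    as [pick Hpick].
  { intros [k l]. apply Hstep. }
  set (L := nat_rec (fun _ => nat -> C) (fun _ => 0%C) (fun k l => upd l k (pick (k, l)))).
  assert (HL : forall k, JC k (L k)).
  { induction k as [ | k IH ].
    - intros eps N He. exists N. split; [ lia | ]. intros; lia.
    - apply (Hpick (k, L k)). exact IH. }
  (* Later stages change only later coordinates, so each limit is final once chosen. *)
  assert (Hstab : forall k j, (j < k)%nat -> L k j = L (S j) j).
  { intros k j Hj. induction Hj as [ | k Hj IH ]; [ reflexivity | ].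
    rewrite <- IH. simpl. unfold upd. destruct (Nat.eq_dec j k); [ lia | reflexivity ]. }
  set (l := fun j => L (S j) j).
  destruct (subsequence_of_frequent
    (fun m n => forall j, (j < m)%nat -> Cmod (a n j - l j)%C < / (INR m + 1))) as [phi [Hphi HP]].
  { intros m N. destruct (HL m (/ (INR m + 1)) N (inv_INR_pos m)) as [n [Hn1 Hn2]].
    exists n. split; [ exact Hn1 | ]. intros j Hj. unfold l. rewrite <- (Hstab m j Hj). auto. }
  exists phi, l. split; [ exact Hphi | ]. intros k eps He.
  destruct (inv_INR_small eps He) as [N HN].
  exists (max (S k) N). intros n Hn. eapply Rlt_trans; [ apply HP; lia | apply HN; lia ].
Qed.

(** A grid point need not lie in the disc. Each one is replaced by a disc point within its mesh
    width if there is one, and by the centre otherwise, so that the dense sequence stays where the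
    functions are controlled. *)
Lemma closed_ball_separable (c : C) (M : R) : 0 <= M -> exists d : nat -> C,
  (forall k, Cmod (d k - c)%C <= M) /\
  forall z eps, Cmod (z - c)%C <= M -> 0 < eps -> exists k, Cmod (d k - z)%C < eps.
Proof.
  intros HM.
  set (grid := fun n : nat =>
    let (p, n') := Cantor.of_nat n in let (q, m) := Cantor.of_nat n' in
    (c + ((- M + INR p / (INR m + 1))%R, (- M + INR q / (INR m + 1))%R))%C).
  set (mesh := fun n : nat =>
    let (p, n') := Cantor.of_nat n in let (q, m) := Cantor.of_nat n' in 2 * / (INR m + 1)).
  destruct (choice (fun n w => Cmod (w - c)%C <= M /\
    ((exists z, Cmod (z - c)%C <= M /\ Cmod (grid n - z)%C < mesh n) ->
      Cmod (grid n - w)%C < mesh n))) as [d Hd].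
  { intros n. destruct (classic (exists z, Cmod (z - c)%C <= M /\ Cmod (grid n - z)%C < mesh n))
      as [[z [Hz1 Hz2]] | Hno].
    - exists z. auto.
    - exists c. split; [ | intros; contradiction ].
      replace (c - c)%C with (RtoC 0) by ring. rewrite Cmod_0. exact HM. }
  exists d. split; [ intros k; apply Hd | ]. intros z eps Hz He.
  (* Going from [d n] to z through the grid point costs two mesh widths, that is 4 / (m + 1). *)
  destruct (inv_INR_small (eps / 4)) as [m Hm]; [ lra | ].
  specialize (Hm m (le_n m)). assert (Hm0 := pos_INR m).
  assert (Hi := inv_INR_pos m).
  assert (Hcoord : forall x, Rabs x <= M ->
    exists p : nat, Rabs (- M + INR p / (INR m + 1) - x) < / (INR m + 1)).
  { intros x Hx. apply Rabs_le_between in Hx.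
    destruct (nfloor_ex ((x + M) * (INR m + 1))) as [p Hp]; [ apply Rmult_le_pos; lra | ].
    exists p. apply Rabs_lt_between.
    assert (E : (x + M) * (INR m + 1) * / (INR m + 1) = x + M) by (field; lra).
    assert (Q1 : INR p * / (INR m + 1) <= (x + M) * (INR m + 1) * / (INR m + 1))
      by (apply Rmult_le_compat_r; lra).
    assert (Q2 : (x + M) * (INR m + 1) * / (INR m + 1) < (INR p + 1) * / (INR m + 1))
      by (apply Rmult_lt_compat_r; lra).
    unfold Rdiv. lra. }
  destruct (Hcoord (Re (z - c)%C)) as [p Hp]; [ eapply Rle_trans; [ apply re_le_Cmod | exact Hz ] | ].
  destruct (Hcoord (Im (z - c)%C)) as [q Hq]; [ eapply Rle_trans; [ apply im_le_Cmod | exact Hz ] | ].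
  set (n := Cantor.to_nat (p, Cantor.to_nat (q, m))).
  assert (Eg : grid n = (c + ((- M + INR p / (INR m + 1))%R, (- M + INR q / (INR m + 1))%R))%C)
    by (unfold grid, n; rewrite !Cantor.cancel_of_to; reflexivity).
  assert (Em : mesh n = 2 * / (INR m + 1))
    by (unfold mesh, n; rewrite !Cantor.cancel_of_to; reflexivity).
  assert (Hgz : Cmod (grid n - z)%C < mesh n).
  { rewrite Eg, Em.
    replace (c + ((- M + INR p / (INR m + 1))%R, (- M + INR q / (INR m + 1))%R) - z)%C with
      (((- M + INR p / (INR m + 1))%R, (- M + INR q / (INR m + 1))%R) - (z - c))%C by ring.
    eapply Rle_lt_trans; [ apply Cmod_le_components | ].
    change (Rabs (- M + INR p / (INR m + 1) - Re (z - c)%C)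
            + Rabs (- M + INR q / (INR m + 1) - Im (z - c)%C) < 2 * / (INR m + 1)).
    lra. }
  exists n. destruct (Hd n) as [_ Hdn].
  assert (Hgd : Cmod (grid n - d n)%C < mesh n) by (apply Hdn; exists z; auto).
  assert (T := Cmod_sub_triangle (d n) (grid n) z). rewrite (Cmod_sub_sym (d n) (grid n)) in T.
  rewrite Em in Hgz, Hgd. lra.
Qed.

(** The diagonal subsequence converges on a dense sequence. The common Lipschitz constant spreads
    convergence to every point of the disc, passes to the limit g, and makes the convergence uniform
    through [closed_ball_uniform]. *)
Lemma Arzela_Ascoli (u : nat -> C -> C) (c : C) (rho M K : R) : 0 <= rho -> 0 <= K ->
  (forall n z, Cmod (z - c)%C <= rho -> Cmod (u n z) <= M) ->
  (forall n z w, Cmod (z - c)%C <= rho -> Cmod (w - c)%C <= rho ->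
     Cmod (u n z - u n w)%C <= K * Cmod (z - w)%C) ->
  exists phi g, strictly_increasing phi /\
    (forall z w, Cmod (z - c)%C <= rho -> Cmod (w - c)%C <= rho ->
       Cmod (g z - g w)%C <= K * Cmod (z - w)%C) /\
    forall eps, 0 < eps -> exists N, forall n, (N <= n)%nat ->
      forall z, Cmod (z - c)%C <= rho -> Cmod (u (phi n) z - g z)%C < eps.
Proof.
  intros Hrho HK HM HL.
  destruct (closed_ball_separable c rho Hrho) as [d [Hd1 Hd2]].
  destruct (diagonal_subsequence (fun n k => u n (d k)) M) as [phi [l [Hphi Hl]]];
    [ intros n k; now apply HM | ].
  assert (Hlim : forall z, exists p, Cmod (z - c)%C <= rho -> forall eps, 0 < eps ->
    exists N, forall n, (N <= n)%nat -> Cmod (u (phi n) z - p)%C < eps).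
  { intros z. destruct (classic (Cmod (z - c)%C <= rho)) as [Hz | Hz];
      [ | exists 0%C; intros; contradiction ].
    destruct (bounded_seq_cluster (fun n => u (phi n) z) 0 M) as [p Hp].
    { intros n. replace (u (phi n) z - 0)%C with (u (phi n) z) by ring. now apply HM. }
    exists p. intros _ eps He.
    destruct (Hd2 z (eps / (6 * (K + 1)))) as [k Hk]; [ exact Hz | apply Rdiv_lt_0_compat; lra | ].
    destruct (Hl k (eps / 6)) as [N HN]; [ lra | ].
    assert (Hnear : forall n, (N <= n)%nat -> Cmod (u (phi n) z - l k)%C < eps / 3).
    { intros n Hn. specialize (HN n Hn). cbv beta in HN.
      assert (T := Cmod_sub_triangle (u (phi n) z) (u (phi n) (d k)) (l k)).
      assert (T2 := HL (phi n) z (d k) Hz (Hd1 k)). rewrite (Cmod_sub_sym z) in T2.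
      assert (K * Cmod (d k - z)%C <= eps / 6).
      { apply Rle_trans with (K * (eps / (6 * (K + 1)))).
        - apply Rmult_le_compat_l; lra.
        - apply Rmult_le_reg_r with (6 * (K + 1)); [ lra | ].
          replace (K * (eps / (6 * (K + 1))) * (6 * (K + 1))) with (K * eps) by (field; lra). nra. }
      lra. }
    exists N. intros n Hn. destruct (Hp (eps / 3) N) as [m [Hm1 Hm2]]; [ lra | ].
    assert (A1 := Hnear n Hn). assert (A2 := Hnear m Hm1).
    assert (T1 := Cmod_sub_triangle (u (phi n) z) (l k) p).
    assert (T2 := Cmod_sub_triangle (l k) (u (phi m) z) p).
    rewrite (Cmod_sub_sym (l k) (u (phi m) z)) in T2. lra. }
  apply choice in Hlim. destruct Hlim as [g Hg].
  assert (HgL : forall z w, Cmod (z - c)%C <= rho -> Cmod (w - c)%C <= rho ->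
       Cmod (g z - g w)%C <= K * Cmod (z - w)%C).
  { intros z w Hz Hw. apply le_epsilon. intros eps He.
    destruct (Hg z Hz (eps / 2)) as [N1 H1]; [ lra | ].
    destruct (Hg w Hw (eps / 2)) as [N2 H2]; [ lra | ].
    specialize (H1 (max N1 N2) ltac:(lia)). specialize (H2 (max N1 N2) ltac:(lia)).
    set (n := phi (max N1 N2)) in *.
    assert (T1 := Cmod_sub_triangle (g z) (u n z) (g w)).
    assert (T2 := Cmod_sub_triangle (u n z) (u n w) (g w)).
    assert (T3 := HL n z w Hz Hw). rewrite (Cmod_sub_sym (g z) (u n z)) in T1. lra. }
  exists phi, g. split; [ exact Hphi | split; [ exact HgL | ] ]. intros eps He.
  (* The condition 1 / (n + 1) < d encodes a lower bound on n, so that one real threshold governs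
     both index and distance. *)
  destruct (closed_ball_uniform c rho
    (fun z d => forall n, / (INR n + 1) < d -> Cmod (u (phi n) z - g z)%C < eps)) as [e [Hep Hu]].
  - intros z e e' H He' n Hn. apply H. lra.
  - intros p Hp. destruct (Hg p Hp (eps / 3)) as [N HN]; [ lra | ].
    exists (Rmin (/ (INR N + 1)) (eps / (3 * (K + 1)))).
    split; [ apply Rmin_pos; [ apply inv_INR_pos | apply Rdiv_lt_0_compat; lra ] | ].
    intros z Hz Hzp n Hn.
    assert (Hn1 := Rlt_le_trans _ _ _ Hn (Rmin_l _ _)).
    assert (Hz2 := Rlt_le_trans _ _ _ Hzp (Rmin_r _ _)).
    assert (HNn : (N <= n)%nat).
    { apply INR_le. assert (P1 := pos_INR n). assert (P2 := pos_INR N).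
      apply Rinv_lt_cancel in Hn1; lra. }
    specialize (HN n HNn).
    assert (Hk : K * Cmod (z - p)%C < eps / 3).
    { apply Rle_lt_trans with (K * (eps / (3 * (K + 1)))).
      - apply Rmult_le_compat_l; lra.
      - apply Rmult_lt_reg_r with (3 * (K + 1)); [ lra | ].
        replace (K * (eps / (3 * (K + 1))) * (3 * (K + 1))) with (K * eps) by (field; lra). nra. }
    assert (T1 := Cmod_sub_triangle (u (phi n) z) (u (phi n) p) (g z)).
    assert (T2 := Cmod_sub_triangle (u (phi n) p) (g p) (g z)).
    assert (T3 := HL (phi n) z p Hz Hp). assert (T4 := HgL p z Hp Hz).
    rewrite (Cmod_sub_sym p z) in T4. lra.
  - destruct (inv_INR_small e Hep) as [N HN]. exists N. intros n Hn z Hz. apply Hu; auto.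
Qed.

(** Triangle integrals of g are approximated by those of the [u n], which vanish by Goursat's
    theorem; Morera's theorem then applies to g. *)
Lemma Weierstrass_limit (u : nat -> C -> C) (g : C -> C) (c : C) (r : R) (w : C) :
  (forall n z, cball c r z -> exists l, is_cderive (u n) z l) ->
  (forall z, cball c r z -> ccontinuous g z) ->
  (forall eps, 0 < eps -> exists n, forall z, cball c r z -> Cmod (u n z - g z)%C < eps) ->
  cball c r w -> exists l, is_cderive g w l.
Proof.
  intros Hu Hg Hlim. apply Morera; [ exact Hg | ].
  intros x y z Hx Hy Hz. apply Cmod_eq_0. apply Rle_antisym; [ | apply Cmod_ge_0 ].
  apply le_epsilon. intros eps He. rewrite Rplus_0_l.
  assert (P1 := Cmod_ge_0 (y - x)). assert (P2 := Cmod_ge_0 (z - y)).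
  assert (P3 := Cmod_ge_0 (x - z)).
  set (P := tri_perimeter x y z).
  assert (HP : 0 <= P) by (unfold P, tri_perimeter; lra).
  destruct (Hlim (eps / (2 * (P + 1)))) as [n Hn]; [ apply Rdiv_lt_0_compat; lra | ].
  assert (Huc : forall z, cball c r z -> ccontinuous (u n) z).
  { intros v Hv. destruct (Hu n v Hv) as [l Hl]. eapply is_cderive_continuous; eauto. }
  assert (B : forall a b, cball c r a -> cball c r b ->
    Cmod (seg_int (u n) a b - seg_int g a b)%C <= 2 * (Cmod (b - a)%C * (eps / (2 * (P + 1))))).
  { intros a b Ha Hb.
    assert (S1 := seg_continuous_ball (u n) c r a b Huc Ha Hb).
    assert (S2 := seg_continuous_ball g c r a b Hg Ha Hb).
    rewrite <- seg_int_minus by assumption. apply seg_int_bound.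
    - intros t Ht. apply ccontinuous_minus; auto.
    - intros t Ht. left. apply Hn. now apply seg_pt_cball. }
  assert (E := Goursat (u n) c r x y z (Hu n) Hx Hy Hz).
  assert (B1 := B x y Hx Hy). assert (B2 := B y z Hy Hz). assert (B3 := B z x Hz Hx).
  replace (tri_int g x y z) with (- ((seg_int (u n) x y - seg_int g x y)
    + (seg_int (u n) y z - seg_int g y z) + (seg_int (u n) z x - seg_int g z x)) + tri_int (u n) x y z)%C
    by (unfold tri_int; ring).
  rewrite E. replace (RtoC 0) with (- 0)%C by ring. rewrite <- Copp_plus_distr, Cmod_opp, Cplus_0_r.
  eapply Rle_trans; [ apply Cmod_triangle | ].
  eapply Rle_trans; [ apply Rplus_le_compat_r, Cmod_triangle | ].
  apply Rle_trans with (2 * (P * (eps / (2 * (P + 1))))).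
  - unfold P at 1, tri_perimeter. lra.
  - apply Rmult_le_reg_r with (P + 1); [ lra | ].
    replace (2 * (P * (eps / (2 * (P + 1)))) * (P + 1)) with (P * eps) by (field; lra). nra.
Qed.

Lemma Lipschitz_of_derivative_bound (f f1 : C -> C) (c : C) (r rho K : R) (z w : C) : rho < r ->
  (forall z, cball c r z -> is_cderive f z (f1 z)) ->
  (forall z, Cmod (z - c)%C <= rho -> Cmod (f1 z) <= K) ->
  Cmod (z - c)%C <= rho -> Cmod (w - c)%C <= rho ->
  Cmod (f z - f w)%C <= 2 * K * Cmod (z - w)%C.
Proof.
  intros Hr Hd HK Hz Hw.
  assert (Hs : forall t, 0 <= t <= 1 -> Cmod (seg_pt w z t - c)%C <= rho)
    by (intros t Ht; now apply seg_pt_dist).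
  assert (Hc : seg_continuous f1 w z).
  { intros t Ht. apply (derivative_continuous c r f f1); [ exact Hd | ].
    specialize (Hs t Ht). unfold cball. lra. }
  rewrite <- (seg_int_derive f f1 w z); [ | | exact Hc ].
  - eapply Rle_trans; [ apply (seg_int_bound f1 w z K Hc) | right; ring ].
    intros t Ht. apply HK, Hs, Ht.
  - intros t Ht. apply Hd. specialize (Hs t Ht). unfold cball. lra.
Qed.

(** * Montel's theorem *)

Lemma is_cderive_affine_comp (f : C -> C) (z l a k : C) :
  is_cderive f z l -> is_cderive (fun w => k * (f w - a))%C z (k * l)%C.
Proof.
  intros H eps He. assert (Hk := Cmod_ge_0 k).
  destruct (H (eps / (Cmod k + 1))) as [d [Hd Hw]]; [ apply Rdiv_lt_0_compat; lra | ].
  exists d; split; [ exact Hd | ]. intros w Hwd. specialize (Hw w Hwd).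
  replace (k * (f w - a) - k * (f z - a) - k * l * (w - z))%C with
    (k * (f w - f z - l * (w - z)))%C by ring.
  rewrite Cmod_mult. assert (P := Cmod_ge_0 (w - z)).
  apply Rle_trans with ((Cmod k + 1) * (eps / (Cmod k + 1) * Cmod (w - z)%C)).
  - apply Rmult_le_compat; try lra. apply Cmod_ge_0.
  - right. field. lra.
Qed.

Lemma open_cball (c : C) (r : R) : open (cball c r).
Proof.
  intros z Hz. apply locally_cball. unfold cball in Hz.
  exists (r - Cmod (z - c)%C). split; [ lra | ]. intros w. apply cball_sub. lra.
Qed.

Lemma omit_normalize (f : C -> C) (a b z : C) : a <> b -> f z <> a -> f z <> b ->
  (/ (b - a) * (f z - a))%C <> 0%C /\ (/ (b - a) * (f z - a))%C <> 1%C /\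
  f z = (a + (b - a) * (/ (b - a) * (f z - a)))%C.
Proof.
  intros Hab Ha Hb.
  assert (Hba : (b - a)%C <> 0%C).
  { intros E. apply Hab. replace b with (b - a + a)%C by ring. rewrite E. ring. }
  assert (E : f z = (a + (b - a) * (/ (b - a) * (f z - a)))%C) by (field; exact Hba).
  repeat split; auto; intros E'; rewrite E' in E; [ apply Ha | apply Hb ]; rewrite E; ring.
Qed.

Lemma bounded_sequence_normal (v v1 : nat -> C -> C) (z0 : C) (r rho M K : R) : 0 < rho < r -> 0 <= K ->
  (forall n z, cball z0 r z -> is_cderive (v n) z (v1 n z)) ->
  (forall n z, Cmod (z - z0)%C <= rho -> Cmod (v n z) <= M) ->
  (forall n z, Cmod (z - z0)%C <= rho -> Cmod (v1 n z) <= K) ->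
  exists phi g, strictly_increasing phi /\ holomorphic (cball z0 rho) g /\
    loc_unif_cvg (cball z0 rho) (fun n => v (phi n)) g.
Proof.
  intros Hr HK Hd HM HK1.
  destruct (Arzela_Ascoli v z0 rho M (2 * K)) as [phi [g [Hphi [HgL Hlim]]]]; try lra; auto.
  { intros n z w Hz Hw.
    apply (Lipschitz_of_derivative_bound (v n) (v1 n) z0 r rho K); auto; lra. }
  exists phi, g. split; [ exact Hphi | split ].
  - intros z Hz.
    destruct (Weierstrass_limit (fun n => v (phi n)) g z0 rho z) as [l Hl]; auto.
    + intros n w Hw. exists (v1 (phi n) w). apply Hd. unfold cball in *. lra.
    + intros w Hw eps He. unfold cball in Hw.
      exists (Rmin (rho - Cmod (w - z0)%C) (eps / (2 * K + 1))).
      split; [ apply Rmin_pos; [ lra | apply Rdiv_lt_0_compat; lra ] | ]. intros x Hx.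
      assert (Hx1 := Rlt_le_trans _ _ _ Hx (Rmin_l _ _)).
      assert (Hx2 := Rlt_le_trans _ _ _ Hx (Rmin_r _ _)).
      assert (T := Cmod_sub_triangle x w z0).
      assert (B := HgL x w ltac:(lra) ltac:(lra)).
      apply (Rmult_lt_compat_r (2 * K + 1)) in Hx2; [ | lra ].
      replace (eps / (2 * K + 1) * (2 * K + 1)) with eps in Hx2 by (field; lra).
      assert (P := Cmod_ge_0 (x - w)). lra.
    + intros eps He. destruct (Hlim eps He) as [N HN].
      exists N. intros w Hw. apply HN; [ lia | ]. unfold cball in Hw. lra.
    + exists l. now apply is_cderive_iff.
  - intros z Hz. exists (fun _ => True). split; [ apply filter_true | ].
    intros eps He. destruct (Hlim eps He) as [N HN]. exists N. intros n Hn w _ Hw.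
    apply HN; [ exact Hn | ]. unfold cball in Hw. lra.
Qed.

(** An affine map moves a and b to 0 and 1. By [log_growth] a bound at one point of the disc gives a
    bound at every other, with constants common to the family, so the values at z0 decide between a
    holomorphic limit and infinity. The radius r / 4 is half of s = r / 2, the range of the growth
    estimate. *)
Theorem Montel (F : fun_family) (z0 a b : C) (r : R) : 0 < r -> a <> b ->
  (forall f z, F f -> cball z0 r z -> exists l, is_cderive f z l) ->
  (forall f z, F f -> cball z0 r z -> f z <> a /\ f z <> b) ->
  normal_on F (cball z0 (r / 4)).
Proof.
  intros Hr Hab Hhol Homit u Hu.
  set (s := r / 2). assert (Hs : 0 < s < r) by (unfold s; lra).
  assert (Hrho : r / 4 = s / 2) by (unfold s; field). rewrite Hrho.
  set (k := (/ (b - a))%C). set (ut := fun n z => (k * (u n z - a))%C).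
  destruct (choice (fun n (f1 : C -> C) => forall z, cball z0 r z -> is_cderive (u n) z (f1 z)))
    as [u1 Hu1].
  { intros n. destruct (choice (fun z l => cball z0 r z -> is_cderive (u n) z l)) as [f1 Hf1]; eauto.
    intros z. destruct (classic (cball z0 r z)) as [Hz | Hz].
    - destruct (Hhol (u n) z (Hu n) Hz) as [l Hl]. eauto.
    - exists 0%C. intros; contradiction. }
  assert (Hut : forall n z, cball z0 r z -> is_cderive (ut n) z (k * u1 n z)%C)
    by (intros n z Hz; now apply is_cderive_affine_comp, Hu1).
  assert (Hnorm : forall n z, cball z0 r z ->
    ut n z <> 0%C /\ ut n z <> 1%C /\ u n z = (a + (b - a) * ut n z)%C).
  { intros n z Hz. destruct (Homit (u n) z (Hu n) Hz). now apply omit_normalize. }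
  assert (Hba : 0 < Cmod (b - a)%C).
  { apply Cmod_gt_0. intros E. apply Hab. replace b with (b - a + a)%C by ring. rewrite E. ring. }
  assert (Hk : Cmod k = / Cmod (b - a)%C) by (apply Cmod_inv; now apply Cmod_gt_0).
  assert (Hin : forall z, Cmod (z - z0)%C <= s / 2 -> cball z0 r z)
    by (intros z Hz; unfold cball; lra).
  assert (Hgrow : forall n z z', Cmod (z - z0)%C <= s / 2 -> Cmod (z' - z0)%C <= s / 2 ->
    ln (2 + Cmod (ut n z')) <= exp 120 * ln (2 + Cmod (ut n z))).
  { intros n z z'. apply (log_growth z0 r s (ut n) (fun w => k * u1 n w)%C); auto;
      intros w Hw; now apply Hnorm. }
  assert (Hz00 : Cmod (z0 - z0)%C <= s / 2)
    by (replace (z0 - z0)%C with (RtoC 0) by ring; rewrite Cmod_0; lra).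
  assert (Hln : forall x, 0 <= x -> exp (ln (2 + x)) = 2 + x) by (intros x Hx; apply exp_ln; lra).
  assert (Hexp : forall x y, x <= y -> exp x <= exp y)
    by (intros x y [H | ->]; [ left; now apply exp_increasing | lra ]).
  assert (He : 0 < exp 120) by apply exp_pos.
  assert (Hfrom : forall n z z' M, Cmod (z - z0)%C <= s / 2 -> Cmod (z' - z0)%C <= s / 2 ->
    Cmod (ut n z) <= M -> ln (2 + Cmod (ut n z')) <= exp 120 * ln (2 + M)).
  { intros n z z' M Hz Hz' HM. eapply Rle_trans; [ now apply (Hgrow n z z') | ].
    apply Rmult_le_compat_l; [ lra | ]. assert (P := Cmod_ge_0 (ut n z)). apply ln_le; lra. }
  (* Either infinitely many values at z0 stay within one bound, or the whole sequence tends to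
     infinity at z0. *)
  destruct (classic (exists M, forall N, exists n, (N <= n)%nat /\ Cmod (ut n z0) <= M))
    as [[M HM] | Hunb].
  - destruct (subsequence_of_frequent (fun _ n => Cmod (ut n z0) <= M)) as [psi [Hpsi HP]];
      [ intros _ N; apply HM | ].
    set (La := exp 120 * ln (2 + M)).
    assert (Hlog : forall n z, Cmod (z - z0)%C <= s / 2 -> ln (2 + Cmod (ut (psi n) z)) <= La)
      by (intros n z Hz; now apply (Hfrom _ z0)).
    assert (Hle : forall n z, Cmod (z - z0)%C <= s / 2 -> 2 + Cmod (ut (psi n) z) <= exp La).
    { intros n z Hz. rewrite <- Hln by apply Cmod_ge_0. now apply Hexp, Hlog. }
    assert (HLa : 0 < La).
    { eapply Rlt_le_trans; [ | apply (Hlog O z0 Hz00) ].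
      assert (P := Cmod_ge_0 (ut (psi O) z0)). rewrite <- ln_1. apply ln_increasing; lra. }
    destruct (bounded_sequence_normal (fun n => u (psi n)) (fun n => u1 (psi n)) z0 r (s / 2)
      (Cmod a + Cmod (b - a)%C * exp La) (Cmod (b - a)%C * (120 / s * (exp La * La))))
      as [phi [g [Hphi [Hg Hcv]]]].
    + lra.
    + assert (0 < exp La) by apply exp_pos. assert (0 < 120 / s) by (apply Rdiv_lt_0_compat; lra).
      apply Rmult_le_pos; [ lra | ]. apply Rmult_le_pos; [ lra | ]. apply Rmult_le_pos; lra.
    + intros n z Hz. now apply Hu1.
    + intros n z Hz. destruct (Hnorm (psi n) z (Hin z Hz)) as [_ [_ ->]].
      eapply Rle_trans; [ apply Cmod_triangle | ]. rewrite Cmod_mult.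
      apply Rplus_le_compat_l, Rmult_le_compat_l; [ lra | ]. specialize (Hle n z Hz). lra.
    + intros n z Hz.
      assert (D := derivative_bound z0 r s (ut (psi n)) (fun w => k * u1 (psi n) w)%C z Hs
        (Hut (psi n)) (fun w Hw => proj1 (Hnorm (psi n) w Hw))
        (fun w Hw => proj1 (proj2 (Hnorm (psi n) w Hw))) Hz).
      cbv beta in D. rewrite Cmod_mult, Hk in D.
      apply Rmult_le_reg_l with (/ Cmod (b - a)%C); [ now apply Rinv_0_lt_compat | ].
      rewrite <- Rmult_assoc, Rinv_l, Rmult_1_l by lra.
      eapply Rle_trans; [ exact D | ].
      assert (0 < 120 / s) by (apply Rdiv_lt_0_compat; lra).
      assert (P := Cmod_ge_0 (ut (psi n) z)).
      apply Rmult_le_compat_l; [ lra | ]. apply Rmult_le_compat; auto; [ lra | ].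
      rewrite <- ln_1. apply ln_le; lra.
    + exists (fun n => psi (phi n)). split; [ now apply strictly_increasing_comp | ].
      left. exists g. split; assumption.
  - exists (fun n => n). split; [ intros n; lia | ]. right.
    intros z Hz. exists (fun _ => True). split; [ apply filter_true | ]. intros M.
    (* If |u n w| <= M, then |ut n w| <= M', and the growth estimate from w to z0 gives |ut n z0| <=
       M''. *)
    set (M' := / Cmod (b - a)%C * (Rabs M + Cmod a)).
    set (M'' := exp (exp 120 * ln (2 + M'))).
    assert (HN : exists N, forall n, (N <= n)%nat -> M'' < Cmod (ut n z0)).
    { apply NNPP. intros Hno. apply Hunb. exists M''. intros N. apply NNPP. intros Hn.
      apply Hno. exists N. intros n Hn'. apply Rnot_le_lt. intros Hle. apply Hn. exists n. auto. }
    destruct HN as [N HN]. exists N. intros n Hn w _ Hw.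
    apply Rnot_le_lt. intros Hle. specialize (HN n Hn).
    assert (Hw' : Cmod (w - z0)%C <= s / 2) by (unfold cball in Hw; lra).
    assert (Hutw : Cmod (ut n w) <= M').
    { unfold ut, M'. rewrite Cmod_mult, Hk.
      apply Rmult_le_compat_l; [ left; now apply Rinv_0_lt_compat | ].
      eapply Rle_trans; [ apply Cmod_triangle | ]. rewrite Cmod_opp.
      assert (P := Rle_abs M). lra. }
    assert (K := Hfrom n w z0 M' Hw' Hz00 Hutw). apply Hexp in K.
    rewrite Hln in K by apply Cmod_ge_0. fold M'' in K. lra.
Qed.

(** * Normality of unions, and the theorem *)

Lemma normal_on_weaken (F F' : fun_family) (G : C -> Prop) :
  (forall f, F' f -> F f) -> normal_on F G -> normal_on F' G.
Proof.
  intros H HF u Hu. apply HF. auto.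
Qed.

(** A sequence drawn from a union need not lie in either family; meeting F infinitely often is
    enough to extract from it. *)
Lemma normal_on_frequent (F : fun_family) (G G' : C -> Prop) (u : nat -> C -> C) :
  normal_on F G -> sub_set G' G ->
  (forall N, exists n, (N <= n)%nat /\ F (u n)) ->
  exists phi, strictly_increasing phi /\
    ((exists g, holomorphic G' g /\ loc_unif_cvg G' (fun n => u (phi n)) g) \/
     loc_unif_cvg_infty G' (fun n => u (phi n))).
Proof.
  intros HF Hsub Hfr.
  destruct (subsequence_of_frequent (fun _ n => F (u n))) as [psi [Hpsi HP]]; [ auto | ].
  destruct (HF (fun n => u (psi n)) HP) as [phi [Hphi Hlim]].
  exists (fun n => psi (phi n)). split; [ now apply strictly_increasing_comp | ].
  destruct Hlim as [[g [Hg Hcv]] | Hinf].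
  - left. exists g. split; [ intros z Hz; apply Hg, Hsub, Hz | ].
    intros z Hz. destruct (Hcv z (Hsub z Hz)) as [V [HV HVe]]. exists V. split; [ exact HV | ].
    intros eps He. destruct (HVe eps He) as [N HN]. exists N. intros n Hn w Hw Hw'.
    apply HN; auto.
  - right. intros z Hz. destruct (Hinf z (Hsub z Hz)) as [V [HV HVM]].
    exists V. split; [ exact HV | ].
    intros M. destruct (HVM M) as [N HN]. exists N. intros n Hn w Hw Hw'. apply HN; auto.
Qed.

(** One of the two families contains infinitely many terms of the sequence, and its convergence
    restricts to the intersection. *)
Lemma normal_on_union (F1 F2 : fun_family) (G1 G2 : C -> Prop) :
  normal_on F1 G1 -> normal_on F2 G2 ->
  normal_on (family_union F1 F2) (fun z => G1 z /\ G2 z).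
Proof.
  intros H1 H2 u Hu.
  destruct (classic (forall N, exists n, (N <= n)%nat /\ F1 (u n))) as [Hf | Hf].
  - apply (normal_on_frequent F1 G1); auto. intros z Hz; apply Hz.
  - apply (normal_on_frequent F2 G2); auto; [ intros z Hz; apply Hz | ].
    apply not_all_ex_not in Hf. destruct Hf as [N0 Hf]. intros N.
    exists (max N N0). split; [ lia | ].
    destruct (Hu (max N N0)) as [K | K]; [ | exact K ].
    exfalso. apply Hf. exists (max N N0). split; [ lia | exact K ].
Qed.

Lemma Fatou_union (D : C -> Prop) (F1 F2 : fun_family) (z : C) :
  Fatou D (family_union F1 F2) z <-> Fatou D F1 z /\ Fatou D F2 z.
Proof.
  split.
  - intros [Hz [G [Ho [HG [Hs Hn]]]]].
    split; (split; [ exact Hz | exists G; repeat split; auto ]);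
      eapply normal_on_weaken; try exact Hn; intros f Hf; [ now left | now right ].
  - intros [[Hz [G1 [Ho1 [HG1 [Hs1 Hn1]]]]] [_ [G2 [Ho2 [HG2 [Hs2 Hn2]]]]]].
    split; [ exact Hz | ]. exists (fun w => G1 w /\ G2 w).
    split; [ now apply open_and | ]. split; [ auto | ]. split.
    + intros w Hw. apply Hs1, Hw.
    + now apply normal_on_union.
Qed.

Theorem theorem1p1 :
  forall D : C -> Prop, is_domain D ->
    (forall F1 F2 : fun_family, subfamily_H D F1 -> subfamily_H D F2 ->
       forall z : C,
         Julia D (family_union F1 F2) z <-> Julia D F1 z \/ Julia D F2 z)
    /\
    (forall F : fun_family, subfamily_H D F ->
       forall (z0 : C) (N : C -> Prop),
         Julia D F z0 -> locally z0 N -> sub_set N D ->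
         forall a b : C,
           ~ family_image F N a -> ~ family_image F N b -> a = b).
Proof.
  intros D _. split.
  (* De Morgan's law, used classically, turns the intersection of Fatou-like sets into the union of
     Julia-like sets. *)
  - intros F1 F2 _ _ z. unfold Julia. rewrite Fatou_union. tauto.
  (* By contraposition: two omitted values make the family normal on a disc around z0, which puts z0
     in the Fatou-like set. *)
  - intros F HF z0 N [Hz0 HJ] HN HND a b Ha Hb. apply NNPP. intros Hab. apply HJ.
    split; [ exact Hz0 | ]. apply locally_cball in HN. destruct HN as [r [Hr HN]].
    exists (cball z0 (r / 4)). split; [ apply open_cball | ]. split; [ | split ].
    + unfold cball. replace (z0 - z0)%C with (RtoC 0) by ring. rewrite Cmod_0. lra.
    + intros z Hz. apply HND, HN. unfold cball in *. lra.
    + apply (Montel F z0 a b); auto.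
      * intros f z Hf Hz. destruct (HF f Hf z (HND z (HN z Hz))) as [l Hl].
        exists l. now apply is_cderive_iff.
      * intros f z Hf Hz. split; intros E; [ apply Ha | apply Hb ]; exists f, z; auto.
Qed.
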